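(* Let $T>0$ and let $\mathcal{F}=\{f_0,f_1,f_2\}$ be an ET-system on $[0,T)$ (so in particular each $f_i\in C^2([0,T))$), with each $f_i$ continuous on $[0,T]$ and $f_0(t)>0$ for all $t\in[0,T]$. Let $A,B\in \mathrm{span}(\mathcal{F})$. Then the Abel equation $$\frac{dx}{dt}=A(t)x^3+B(t)x^2,\qquad t\in[0,T],$$ has at most two non-zero limit cycles, counted with multiplicities. Moreover, this upper bound is sharp, i.e., for every such $\mathcal{F}$ there exist $A,B\in\mathrm{span}(\mathcal{F})$ for which the equation has exactly two non-zero limit cycles counted with multiplicities.
   Context: ET-system: a set of linearly independent real functions $\mathcal{F}=\{f_0,\dots,f_m\}$ on an interval $E$ is an extended Chebyshev system (ET-system) on $E$ if all $f_i\in C^m(E)$ and $Z(\mathcal{F})=\dim(\mathrm{span}(\mathcal{F}))-1=m$, where $\mathrm{span}(\mathcal{F})=\{\sum_{i=0}^m\lambda_i f_i:\lambda_i\in\mathbb{R}\}$ and $Z(\mathcal{F})$ is the maximum number of zeros in $E$, counted with multiplicities, of a non-trivial function in $\mathrm{span}(\mathcal{F})$. Limit cycles: let $x(t,x_0)$ denote the solution with $x(0,x_0)=x_0$ and let $P(x_0)=x(T,x_0)$ be the Poincaré map (defined where the solution exists on all of $[0,T]$). A closed solution is a solution defined on $[0,T]$ with $x(0)=x(T)$. A limit cycle is a closed solution that is isolated among the closed solutions. It is non-zero if it is not the solution $x\equiv 0$. The multiplicity of a limit cycle with initial value $x_0$ is the multiplicity of $x_0$ as a zero of $P(x)-x$.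 *)

(* Defs.v *)
(* Stdlib reals. Functions on an interval are total functions R -> R of which
   only the values on the interval matter; derivatives and continuity are taken
   relative to the interval (D_in, continue_in), hence one-sided at endpoints. *)
From Stdlib Require Import Reals List ClassicalEpsilon.
Open Scope R_scope.

Definition Icc (a b t : R) : Prop := a <= t <= b.
Definition Ico (a b t : R) : Prop := a <= t < b.

Definition continuous_in (E : R -> Prop) (f : R -> R) : Prop :=
  forall t, E t -> continue_in f E t.

(* g 0, ..., g n are the successive derivatives of f relative to E. *)
Definition derivatives_in (E : R -> Prop) (f : R -> R) (n : nat)
    (g : nat -> R -> R) : Prop :=
  (forall t, E t -> g 0%nat t = f t) /\
  (forall j, (j < n)%nat -> forall t, E t -> D_in (g j) (g (S j)) E t).

Definition class_C (n : nat) (E : R -> Prop) (f : R -> R) : Prop :=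
  exists g, derivatives_in E f n g /\ continuous_in E (g n).

(* t is a zero of f in E of multiplicity at least k: the derivatives of f of
   orders 0, ..., k - 1 exist on E and vanish at t.  Lower bounds are used because
   a C^m function may vanish at t together with all its m derivatives, in which
   case no exact multiplicity is available.  No condition on f for k = 0. *)
Definition zero_mult_ge (E : R -> Prop) (f : R -> R) (t : R) (k : nat) : Prop :=
  E t /\
  exists g, derivatives_in E f (pred k) g /\
            (forall j, (j < k)%nat -> g j t = 0).

(* mult_ge t k reads "t is counted at least k times"; the points with
   their multiplicities have total count at least n. *)
Definition count_ge (mult_ge : R -> nat -> Prop) (n : nat) : Prop :=
  exists l : list (R * nat),
    NoDup (map fst l) /\
    (forall t k, In (t, k) l -> mult_ge t k) /\
    (n <= list_sum (map snd l))%nat.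

Definition count_le (mult_ge : R -> nat -> Prop) (n : nat) : Prop :=
  ~ count_ge mult_ge (S n).

Definition lin_comb (m : nat) (f : nat -> R -> R) (lam : nat -> R) (t : R) : R :=
  sum_f_R0 (fun i => lam i * f i t) m.

Definition in_span (E : R -> Prop) (m : nat) (f : nat -> R -> R) (h : R -> R) :
    Prop :=
  exists lam, forall t, E t -> h t = lin_comb m f lam t.

Definition lin_indep (E : R -> Prop) (m : nat) (f : nat -> R -> R) : Prop :=
  forall lam, (forall t, E t -> lin_comb m f lam t = 0) ->
              forall i, (i <= m)%nat -> lam i = 0.

Definition nontrivial (E : R -> Prop) (h : R -> R) : Prop :=
  exists t, E t /\ h t <> 0.

(* Z({f 0, ..., f m}) = n on E. *)
Definition max_zeros (E : R -> Prop) (m : nat) (f : nat -> R -> R) (n : nat) :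
    Prop :=
  (exists h, in_span E m f h /\ nontrivial E h /\
             count_ge (zero_mult_ge E h) n) /\
  (forall h, in_span E m f h -> nontrivial E h ->
             count_le (zero_mult_ge E h) n).

(* {f 0, ..., f m}; linear independence makes the span of dimension m + 1. *)
Definition ET_system (E : R -> Prop) (m : nat) (f : nat -> R -> R) : Prop :=
  lin_indep E m f /\
  (forall i, (i <= m)%nat -> class_C m E (f i)) /\
  max_zeros E m f m.

Definition solution (T : R) (A B x : R -> R) : Prop :=
  forall t, Icc 0 T t ->
    D_in x (fun s => A s * x s ^ 3 + B s * x s ^ 2) (Icc 0 T) t.

Definition poincare_dom (T : R) (A B : R -> R) (x0 : R) : Prop :=
  exists x, solution T A B x /\ x 0 = x0.

(* Unspecified outside poincare_dom. *)
Definition poincare (T : R) (A B : R -> R) (x0 : R) : R :=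
  epsilon (inhabits 0)
    (fun y => exists x, solution T A B x /\ x 0 = x0 /\ x T = y).

Definition closed_solution (T : R) (A B x : R -> R) : Prop :=
  solution T A B x /\ x 0 = x T.

(* Isolation is with respect to uniform distance on [0, T]. *)
Definition limit_cycle (T : R) (A B x : R -> R) : Prop :=
  closed_solution T A B x /\
  exists eps, 0 < eps /\
    forall y, closed_solution T A B y ->
      (forall t, Icc 0 T t -> Rabs (y t - x t) < eps) ->
      forall t, Icc 0 T t -> y t = x t.

(* Limit cycles are indexed by their initial values: for A and B continuous on
   [0, T], a solution is determined on [0, T] by its initial value. *)
Definition nonzero_limit_cycle_mult_ge (T : R) (A B : R -> R) (x0 : R) (k : nat) :
    Prop :=
  (exists x, limit_cycle T A B x /\ nontrivial (Icc 0 T) x /\ x 0 = x0) /\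
  zero_mult_ge (poincare_dom T A B) (fun y => poincare T A B y - y) x0 k.

Definition at_most_nonzero_limit_cycles (T : R) (A B : R -> R) (n : nat) : Prop :=
  count_le (nonzero_limit_cycle_mult_ge T A B) n.

Definition exactly_nonzero_limit_cycles (T : R) (A B : R -> R) (n : nat) : Prop :=
  count_ge (nonzero_limit_cycle_mult_ge T A B) n /\
  count_le (nonzero_limit_cycle_mult_ge T A B) n.

(* Main.v *)
Require Import Defs.
From Stdlib Require Import Reals List Classical ClassicalEpsilon Lra Lia.
From Coquelicot Require Import Coquelicot.
Open Scope R_scope.

(** Let f be the first function of the system and embed the equation in the family
    x' = A x^3 + (B + l f) x^2.  Since f > 0, solutions increase with l, so that an initial
    value x is that of a closed solution for at most one parameter l = L(x).  Solutions of
    a larger parameter cross a given closed solution upwards only; hence a solution that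
    starts and ends below it stays below and cannot blow up, and a shooting argument in l
    shows that L is defined on an interval as soon as it is defined at its ends
    ([closed_below_pos], [cycles_between]).  The nonzero closed solutions of the original
    equation are the nonzero zeros of L; at 0 the value of L is fixed by continuity.

    The heart of the proof is that all critical points of L are nondegenerate extrema of
    the same type.  They correspond to the singular closed solutions u, those where the
    Poincare map has derivative 1, that is, where A u^2 has mean 0.  Put
    E = exp(int_0^t A u^2).  In the plane with coordinates u/E and 1/E such a solution is
    a closed curve of velocity p (B + l f, -A), where p = u^2/E.  The Chebyshev property
    makes this curve convex: a combination of A and B + l f that vanishes at t has mean 0
    against p, hence changes sign, so its zero at t is simple and it has at most one other
    zero ([area_sign_of_wronskian]).  The second derivative of L is, up to a factor of
    constant sign, a weighted area enclosed by the curve ([singular_coefficient_sign]); it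
    is nonzero, its sign is given by the orientation of the curve, and the orientation is
    the same for all l ([area_sign_family]).  At the zero solution the same argument
    applies with p = 1.

    So, for a suitable sign s, the function s L has no interior maximum
    ([parameter_no_interior_max]): it has at most two zeros, at most one if one of
    them is critical, and no zero of multiplicity three.  When A, B and f are dependent,
    the equation has a first integral or a function of one sign in the span of A and B,
    and there is at most one limit cycle, a simple one ([dependent_cycles]).

    For the sharpness, subtract multiples of f from the two other functions to give them
    mean 0 and take them as A and B.  Then L has a strict extremum at 0, and a level of L
    close to L(0) = 0, on the right side, is attained at two points of opposite signs
    ([two_cycles_exist]). *)

Set Bullet Behavior "Strict Subproofs".

(** * Calculus on a compact interval *)

Definition clip (a b x : R) : R := Rmax a (Rmin b x).

Lemma clip_range a b x : a <= b -> a <= clip a b x <= b.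
Proof.
  intros h; unfold clip, Rmax, Rmin; repeat destruct Rle_dec; lra.
Qed.

Lemma clip_id a b x : a <= x <= b -> clip a b x = x.
Proof.
  intros h; unfold clip, Rmax, Rmin; repeat destruct Rle_dec; lra.
Qed.

Lemma clip_lipschitz a b x y : Rabs (clip a b x - clip a b y) <= Rabs (x - y).
Proof.
  unfold clip, Rmax, Rmin, Rabs; repeat destruct Rle_dec; repeat destruct Rcase_abs; lra.
Qed.

Lemma continuous_of_lipschitz (g : R -> R) K :
  (forall s t, Rabs (g s - g t) <= K * Rabs (s - t)) -> forall t, continuous g t.
Proof.
  intros h t. apply continuity_pt_filterlim.
  intros eps heps.
  assert (hK : 0 < Rabs K + 1) by (generalize (Rabs_pos K); lra).
  exists (eps / (Rabs K + 1)); split.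
  - apply Rdiv_lt_0_compat; lra.
  - intros x [_ hx]. simpl in *. unfold R_dist in *.
    apply Rle_lt_trans with (1 := h x t).
    apply Rle_lt_trans with ((Rabs K + 1) * Rabs (x - t)).
    + apply Rmult_le_compat_r; [apply Rabs_pos|]. generalize (Rle_abs K); lra.
    + replace eps with ((Rabs K + 1) * (eps / (Rabs K + 1))) by (field; lra).
      apply Rmult_lt_compat_l; lra.
Qed.

Lemma continuous_clip a b t : continuous (clip a b) t.
Proof.
  apply continuous_of_lipschitz with 1. intros; rewrite Rmult_1_l; apply clip_lipschitz.
Qed.

Lemma exp_le_exp x y : x <= y -> exp x <= exp y.
Proof. intros [h|<-]; [left; apply exp_increasing; exact h|lra]. Qed.

Section Interval.

Variable T : R.
Hypothesis hT : 0 < T.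

Notation "'on_I' t , P" := (forall t, 0 <= t <= T -> P)
  (at level 200, t name, right associativity).

(** One-sided continuity on [0, T], expressed as continuity on the whole line of
    the extension by constants. *)
Definition cts (g : R -> R) : Prop :=
  forall t, continuous (fun s => g (clip 0 T s)) t.

Lemma cts_at (g : R -> R) : (on_I t, continuous g t) -> cts g.
Proof.
  intros h t. apply continuous_comp; [apply continuous_clip|].
  apply h, clip_range; lra.
Qed.

Lemma cts_derive (g dg : R -> R) :
  (on_I t, is_derive g t (dg t)) -> cts g.
Proof.
  intros h; apply cts_at; intros t ht.
  apply @ex_derive_continuous. exists (dg t); auto.
Qed.

Lemma cts_const c : cts (fun _ => c).
Proof. intros t; apply continuous_const. Qed.

Lemma cts_plus g h : cts g -> cts h -> cts (fun t => g t + h t).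
Proof. intros hg hh t. apply (continuous_plus (V := R_NormedModule)); auto. Qed.

Lemma cts_opp g : cts g -> cts (fun t => - g t).
Proof. intros hg t. apply (continuous_opp (V := R_NormedModule)); auto. Qed.

Lemma cts_minus g h : cts g -> cts h -> cts (fun t => g t - h t).
Proof. intros hg hh t. apply (continuous_minus (V := R_NormedModule)); auto. Qed.

Lemma cts_mult g h : cts g -> cts h -> cts (fun t => g t * h t).
Proof. intros hg hh t. apply (continuous_mult (K := R_AbsRing)); auto. Qed.

Lemma cts_pow g n : cts g -> cts (fun t => g t ^ n).
Proof.
  intros hg; induction n as [|n IH]; simpl; [apply cts_const|].
  apply cts_mult; auto.
Qed.

Lemma cts_inv g :
  cts g -> (on_I t, g t <> 0) -> cts (fun t => / g t).
Proof.
  intros hg h0 t. apply (continuous_comp (fun s => g (clip 0 T s)) Rinv); [apply hg|].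
  apply continuous_Rinv, h0, clip_range; lra.
Qed.

Lemma cts_div g h :
  cts g -> cts h -> (on_I t, h t <> 0) ->
  cts (fun t => g t / h t).
Proof. intros; apply cts_mult; auto; apply cts_inv; auto. Qed.

Lemma cts_exp g : cts g -> cts (fun t => exp (g t)).
Proof.
  intros hg t. apply (continuous_comp (fun s => g (clip 0 T s)) exp); [apply hg|].
  apply continuous_exp.
Qed.

Lemma cts_ext g h : (on_I t, g t = h t) -> cts g -> cts h.
Proof.
  intros e hg t. apply continuous_ext with (2 := hg t).
  intros s; apply e, clip_range; lra.
Qed.

(** Integrating the extension by constants makes the primitive differentiable, on both
    sides, at the end points too. *)
Definition prim (g : R -> R) (t : R) : R := RInt (fun s => g (clip 0 T s)) 0 t.

Lemma prim_0 g : prim g 0 = 0.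
Proof. unfold prim. rewrite RInt_point. reflexivity. Qed.

Lemma prim_derive_clip g t : cts g -> is_derive (prim g) t (g (clip 0 T t)).
Proof.
  intros hg. apply (is_derive_RInt (fun s => g (clip 0 T s)) (prim g) 0 t); [|apply hg].
  apply filter_forall. intros b. unfold prim. apply @RInt_correct.
  apply @ex_RInt_continuous. intros z _; apply hg.
Qed.

Lemma prim_derive g t : cts g -> 0 <= t <= T -> is_derive (prim g) t (g t).
Proof.
  intros hg ht. rewrite <- (clip_id 0 T t ht) at 2. apply prim_derive_clip; auto.
Qed.

Lemma cts_prim g : cts g -> cts (prim g).
Proof. intros hg. apply cts_derive with g. intros; apply prim_derive; auto. Qed.

Lemma mvt (g dg : R -> R) s t :
  (forall r, s <= r <= t -> is_derive g r (dg r)) -> s < t ->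
  exists c, s <= c <= t /\ g t - g s = dg c * (t - s).
Proof.
  intros hg hst. destruct (MVT_gen g s t dg) as [c hc].
  - intros r; rewrite Rmin_left, Rmax_right by lra. intros hr; apply hg; lra.
  - intros r; rewrite Rmin_left, Rmax_right by lra. intros hr.
    apply continuity_pt_filterlim, @ex_derive_continuous. exists (dg r); apply hg; lra.
  - rewrite Rmin_left, Rmax_right in hc by lra. exists c; exact hc.
Qed.

Lemma derive_nonneg_incr (g dg : R -> R) s t :
  (forall r, s <= r <= t -> is_derive g r (dg r)) ->
  (forall r, s <= r <= t -> 0 <= dg r) -> s <= t -> g s <= g t.
Proof.
  intros hg hp hst. destruct hst as [hst|<-]; [|lra].
  destruct (mvt g dg s t hg hst) as [c [hc e]].
  generalize (Rmult_le_pos (dg c) (t - s) (hp c hc)); lra.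
Qed.

Lemma derive_zero_const (g : R -> R) :
  (on_I r, is_derive g r 0) ->
  on_I t, g t = g 0.
Proof.
  intros hg t [[h0|<-] h1]; [|reflexivity].
  destruct (mvt g (fun _ => 0) 0 t) as [c [_ e]]; auto; [|lra].
  intros; apply hg; lra.
Qed.

Lemma prim_ftc (F g : R -> R) t :
  (on_I r, is_derive F r (g r)) -> cts g -> 0 <= t <= T ->
  prim g t = F t - F 0.
Proof.
  intros hF hg ht.
  assert (e := derive_zero_const (fun r => prim g r - F r)). simpl in e.
  rewrite prim_0 in e. enough (prim g t - F t = 0 - F 0) by lra.
  apply e; auto. intros r hr.
  replace 0 with (minus (g r) (g r)) by (unfold minus, plus, opp; simpl; ring).
  apply @is_derive_minus; auto. apply prim_derive; auto.
Qed.

Definition J (g : R -> R) : R := prim g T.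

Lemma J_ftc (F g : R -> R) :
  (on_I r, is_derive F r (g r)) -> cts g -> J g = F T - F 0.
Proof. intros; apply prim_ftc; auto; lra. Qed.

Lemma prim_ext g h t :
  (on_I r, g r = h r) -> prim g t = prim h t.
Proof. intros e. apply RInt_ext. intros r _. apply e, clip_range; lra. Qed.

Lemma prim_plus g h t :
  cts g -> cts h -> prim (fun r => g r + h r) t = prim g t + prim h t.
Proof.
  intros hg hh. apply (RInt_plus (V := R_CompleteNormedModule));
  apply @ex_RInt_continuous; intros z _; auto.
Qed.

Lemma prim_scal g c t : cts g -> prim (fun r => c * g r) t = c * prim g t.
Proof.
  intros hg. apply (RInt_scal (V := R_CompleteNormedModule)).
  apply @ex_RInt_continuous; intros z _; auto.
Qed.

Lemma prim_minus g h t :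
  cts g -> cts h -> prim (fun r => g r - h r) t = prim g t - prim h t.
Proof.
  intros hg hh. apply (RInt_minus (V := R_CompleteNormedModule));
  apply @ex_RInt_continuous; intros z _; auto.
Qed.

Lemma J_ext g h : (on_I r, g r = h r) -> J g = J h.
Proof. apply prim_ext. Qed.

Lemma J_plus g h : cts g -> cts h -> J (fun r => g r + h r) = J g + J h.
Proof. apply prim_plus. Qed.

Lemma J_scal g c : cts g -> J (fun r => c * g r) = c * J g.
Proof. apply prim_scal. Qed.

Lemma J_minus g h : cts g -> cts h -> J (fun r => g r - h r) = J g - J h.
Proof. apply prim_minus. Qed.

Lemma prim_abs_le g K t :
  cts g -> (on_I r, Rabs (g r) <= K) -> 0 <= t <= T ->
  Rabs (prim g t) <= T * K.
Proof.
  intros hg hK ht. apply Rle_trans with ((t - 0) * K).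
  - apply abs_RInt_le_const; [lra| |].
    + apply @ex_RInt_continuous; intros z _; auto.
    + intros r _; apply hK, clip_range; lra.
  - apply Rmult_le_compat_r; [|lra].
    apply Rle_trans with (2 := hK 0 ltac:(lra)), Rabs_pos.
Qed.

Lemma J_abs_le g K :
  cts g -> (on_I r, Rabs (g r) <= K) -> Rabs (J g) <= T * K.
Proof. intros; apply prim_abs_le; auto; lra. Qed.

Lemma RInt_clip_pos g a b :
  cts g -> 0 <= a -> a < b -> b <= T -> (forall r, a < r < b -> 0 < g r) ->
  prim g a < prim g b.
Proof.
  intros hg h0 h1 h2 hp.
  assert (0 < RInt (fun s => g (clip 0 T s)) a b).
  { apply RInt_gt_0; auto. intros r hr. rewrite clip_id by lra; auto. }
  assert (e : prim g a + RInt (fun s => g (clip 0 T s)) a b = prim g b).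
  { apply (RInt_Chasles (V := R_CompleteNormedModule));
    apply @ex_RInt_continuous; intros z _; auto. }
  lra.
Qed.

Lemma J_pos g : cts g -> (forall r, 0 < r < T -> 0 < g r) -> 0 < J g.
Proof.
  intros hg hp. generalize (RInt_clip_pos g 0 T hg).
  rewrite prim_0. intros h; apply h; auto; lra.
Qed.

Lemma J_nonneg g : cts g -> (on_I r, 0 <= g r) -> 0 <= J g.
Proof.
  intros hg hp. apply RInt_ge_0; [lra| |].
  - apply @ex_RInt_continuous; intros z _; auto.
  - intros r hr; apply hp, clip_range; lra.
Qed.

Lemma cts_bounded g : cts g -> exists K, 0 < K /\ on_I t, Rabs (g t) <= K.
Proof.
  intros hg.
  destruct (continuity_ab_maj (fun s => Rabs (g (clip 0 T s))) 0 T) as [m [hm _]]; [lra| |].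
  - intros c _. apply continuity_pt_filterlim.
    apply (continuous_comp (fun s => g (clip 0 T s)) Rabs); [apply hg|].
    apply continuous_Rabs.
  - exists (Rabs (g (clip 0 T m)) + 1). split; [generalize (Rabs_pos (g (clip 0 T m))); lra|].
    intros t ht. generalize (hm t ht). rewrite (clip_id 0 T t ht). lra.
Qed.

Lemma ivt_sign (g : R -> R) a b :
  (forall t, a <= t <= b -> continuous g t) -> (forall t, a <= t <= b -> g t <> 0) ->
  a <= b -> 0 < g a * g b.
Proof.
  intros hc h0 hab. destruct (Rlt_or_le 0 (g a * g b)) as [h|h]; auto. exfalso.
  destruct (IVT_cor (fun t => g (clip a b t)) a b) as [z [hz e]]; auto.
  - intros t. apply continuity_pt_filterlim.
    apply (continuous_comp (clip a b) g); [apply continuous_clip|].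
    apply hc, clip_range, hab.
  - rewrite !clip_id by lra; exact h.
  - rewrite clip_id in e by lra. apply (h0 z); auto.
Qed.

Lemma cts_sign g : cts g -> (on_I t, g t <> 0) ->
  on_I t, 0 < g 0 * g t.
Proof.
  intros hg h0 t ht.
  generalize (ivt_sign (fun s => g (clip 0 T s)) 0 t).
  rewrite !clip_id by lra. intros h; apply h; [| |lra].
  - intros; apply hg.
  - intros s hs; apply h0, clip_range; lra.
Qed.

Create HintDb cts.
Hint Resolve cts_const cts_plus cts_opp cts_minus cts_mult cts_pow cts_exp
  cts_prim : cts.

(** * Linear equations, comparison and existence of solutions *)

(** Replaces the derivatives of abstract functions left by auto_derive by the values
    given in H. *)
Ltac rewrite_derive H :=
  let e := fresh in
  match type of H with
  | is_derive ?z ?t ?l =>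
      assert (e : Derive (fun x : R => z x) t = l) by (apply is_derive_unique; exact H);
      rewrite ?e; clear e
  end.

Lemma is_derive_mult_exp (z K : R -> R) t dz k :
  is_derive z t dz -> is_derive K t k ->
  is_derive (fun s => z s * exp (- K s)) t ((dz - k * z t) * exp (- K t)).
Proof.
  intros h1 h2. auto_derive.
  - repeat split; eexists; eassumption.
  - rewrite_derive h1; rewrite_derive h2; ring.
Qed.

Lemma is_derive_Rinv (z : R -> R) t dz :
  is_derive z t dz -> z t <> 0 -> is_derive (fun s => / z s) t (- dz / z t ^ 2).
Proof.
  intros h1 h0. auto_derive.
  - repeat split; auto; eexists; eassumption.
  - rewrite_derive h1; field; auto.
Qed.

Lemma is_derive_Rmult (y z : R -> R) t dy dz :
  is_derive y t dy -> is_derive z t dz ->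
  is_derive (fun s => y s * z s) t (dy * z t + y t * dz).
Proof.
  intros h1 h2. auto_derive.
  - repeat split; eexists; eassumption.
  - rewrite_derive h1; rewrite_derive h2; ring.
Qed.

Lemma is_derive_Rminus (y z : R -> R) t dy dz :
  is_derive y t dy -> is_derive z t dz -> is_derive (fun s => y s - z s) t (dy - dz).
Proof. intros; apply @is_derive_minus; auto. Qed.

Lemma is_derive_eq (z : R -> R) t (a b : R) : is_derive z t a -> a = b -> is_derive z t b.
Proof. intros h <-; exact h. Qed.

Lemma linear_solution (z k r : R -> R) :
  cts k -> cts r ->
  (on_I t, is_derive z t (k t * z t + r t)) ->
  on_I t,
  z t * exp (- prim k t) = z 0 + prim (fun s => r s * exp (- prim k s)) t.
Proof.
  intros hk hr hz t ht.
  assert (hc : cts (fun s => r s * exp (- prim k s))) by auto with cts.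
  rewrite (prim_ftc (fun s => z s * exp (- prim k s)) (fun s => r s * exp (- prim k s)) t); auto.
  - rewrite prim_0, Ropp_0, exp_0. ring.
  - intros s hs. eapply is_derive_eq.
    + apply is_derive_mult_exp; [apply hz; auto|apply prim_derive; auto].
    + ring.
Qed.

Lemma homogeneous_solution (z k : R -> R) :
  cts k -> (on_I t, is_derive z t (k t * z t)) ->
  on_I t, z t = z 0 * exp (prim k t).
Proof.
  intros hk hz.
  assert (e := linear_solution z k (fun _ => 0) hk (cts_const 0)).
  assert (e0 : on_I t, prim (fun s => 0 * exp (- prim k s)) t = 0).
  { intros t ht. rewrite (prim_ftc (fun _ => 0) (fun s => 0 * exp (- prim k s)) t); auto with cts; [ring|].
    intros s hs. rewrite Rmult_0_l. apply @is_derive_const. }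
  intros t ht. specialize (e ltac:(intros s hs; rewrite Rplus_0_r; auto) t ht).
  rewrite e0, Rplus_0_r in e by auto. rewrite <- e, Rmult_assoc, <- exp_plus,
    Rplus_opp_l, exp_0; ring.
Qed.

(** Squaring avoids the derivative of an absolute value; the exponential weights of both
    signs give the estimate in both directions of time. *)
Lemma gronwall (z dz : R -> R) L eps :
  0 <= L ->
  (on_I t, is_derive z t (dz t)) ->
  (on_I t, Rabs (dz t) <= L * Rabs (z t) + eps) ->
  forall s t, 0 <= s <= T -> 0 <= t <= T ->
  z t ^ 2 <= (z s ^ 2 + eps ^ 2) * exp ((2 * L + 1) * T).
Proof.
  intros hL hz hb.
  set (K := 2 * L + 1).
  assert (hq : on_I t,
    Rabs (2 * z t * dz t) <= K * z t ^ 2 + eps ^ 2).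
  { intros t ht. specialize (hb t ht).
    rewrite !Rabs_mult, (Rabs_pos_eq 2) by lra.
    rewrite <- (pow2_abs (z t)). generalize (Rabs_pos (z t)) (Rabs_pos (dz t)); intros.
    unfold K. generalize (pow2_ge_0 (Rabs (z t) - eps)).
    assert (Rabs (z t) * Rabs (dz t) <= Rabs (z t) * (L * Rabs (z t) + eps))
      by (apply Rmult_le_compat_l; lra).
    intros. nra. }
  assert (hd : forall sg t, 0 <= t <= T ->
    is_derive (fun r => (z r ^ 2 + eps ^ 2) * exp (sg * K * r)) t
      ((2 * z t * dz t + sg * K * (z t ^ 2 + eps ^ 2)) * exp (sg * K * t))).
  { intros sg t ht. specialize (hz t ht). auto_derive.
    - repeat split; eexists; eassumption.
    - rewrite_derive hz; ring. }
  assert (hK : 1 <= K) by (unfold K; lra).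
  assert (hmono : forall sg s t, sg = 1 \/ sg = -1 -> 0 <= s -> s <= t -> t <= T ->
    sg * ((z s ^ 2 + eps ^ 2) * exp (sg * K * s)) <=
    sg * ((z t ^ 2 + eps ^ 2) * exp (sg * K * t))).
  { intros sg s t hsg h1 h2 h3.
    apply (derive_nonneg_incr (fun r => sg * ((z r ^ 2 + eps ^ 2) * exp (sg * K * r)))
      (fun r => sg * ((2 * z r * dz r + sg * K * (z r ^ 2 + eps ^ 2)) * exp (sg * K * r)))); auto.
    - intros r hr. apply (is_derive_scal (fun r => (z r ^ 2 + eps ^ 2) * exp (sg * K * r))).
      apply hd; lra.
    - intros r hr. assert (hb' := hq r ltac:(lra)). apply Rabs_le_between in hb'.
      assert (0 <= (K - 1) * eps ^ 2) by (apply Rmult_le_pos; [lra|apply pow2_ge_0]).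
      rewrite <- Rmult_assoc. apply Rmult_le_pos; [|left; apply exp_pos].
      destruct hsg as [->| ->]; lra. }
  assert (hz2 := fun r => pow2_ge_0 (z r)). assert (he2 := pow2_ge_0 eps).
  intros s t hs ht.
  assert (hfin : forall x, x <= K * T -> z t ^ 2 + eps ^ 2 <= (z s ^ 2 + eps ^ 2) * exp x ->
    z t ^ 2 <= (z s ^ 2 + eps ^ 2) * exp (K * T)).
  { intros x hx h. apply exp_le_exp in hx. specialize (hz2 s). nra. }
  destruct (Rle_or_lt s t) as [hst|hst].
  - assert (h := hmono (-1) s t ltac:(auto) ltac:(lra) hst ltac:(lra)).
    apply (hfin (-1 * K * s + K * t)); [nra|].
    rewrite exp_plus, <- Rmult_assoc.
    replace (z t ^ 2 + eps ^ 2) with ((z t ^ 2 + eps ^ 2) * exp (-1 * K * t) * exp (K * t)).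
    + apply Rmult_le_compat_r; [left; apply exp_pos|lra].
    + rewrite Rmult_assoc, <- exp_plus.
      replace (-1 * K * t + K * t) with 0 by ring. rewrite exp_0; ring.
  - assert (h := hmono 1 t s ltac:(auto) ltac:(lra) ltac:(lra) ltac:(lra)).
    apply (hfin (1 * K * s)); [nra|]. assert (h1 := exp_ineq1_le (1 * K * t)).
    assert (0 <= K * t) by (apply Rmult_le_pos; lra).
    assert (0 <= (z t ^ 2 + eps ^ 2) * (exp (1 * K * t) - 1)).
    { specialize (hz2 t). apply Rmult_le_pos; lra. }
    lra.
Qed.

(** After its last zero the function would have to increase. *)
Lemma positive_of_decreasing_at_zeros (z dz : R -> R) :
  (on_I t, is_derive z t (dz t)) ->
  (on_I t, z t = 0 -> dz t < 0) ->
  0 < z T -> on_I t, 0 < z t.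
Proof.
  intros hz h0 hTp t ht.
  destruct (Rlt_or_le 0 (z t)) as [h|h]; auto. exfalso.
  assert (hc : on_I r, continuity_pt z r).
  { intros r hr. apply continuity_pt_filterlim, @ex_derive_continuous.
    exists (dz r); auto. }
  destruct (completeness (fun r => 0 <= r <= T /\ z r <= 0)) as [m [hub hlub]].
  { exists T. intros r hr; lra. }
  { exists t; auto. }
  assert (hm : 0 <= m <= T).
  { split; [apply Rle_trans with t; [lra|apply hub; auto]|apply hlub; intros r hr; lra]. }
  assert (hafter : forall r, m < r <= T -> 0 < z r).
  { intros r hr. destruct (Rlt_or_le 0 (z r)); auto.
    assert (r <= m) by (apply hub; split; auto; lra). lra. }
  assert (hmz : z m = 0).
  { destruct (Rtotal_order (z m) 0) as [hn|[he|hp]]; auto; exfalso.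
    - assert (m < T) by (destruct hm as [_ [?| ->]]; auto; lra).
      destruct (hc m hm (- z m)) as [d [hd hdc]]; [lra|].
      set (r := Rmin (m + d / 2) T).
      assert (m < r <= T /\ r - m < d) as [hr hrd]
        by (unfold r, Rmin; destruct Rle_dec; lra).
      generalize (hafter r hr). specialize (hdc r). simpl in hdc; unfold R_dist in hdc.
      rewrite (Rabs_pos_eq (r - m)) in hdc by lra.
      intros. assert (h2 : Rabs (z r - z m) < - z m).
      { apply hdc; split; [split; [exact I|lra]|lra]. }
      apply Rabs_def2 in h2. lra.
    - destruct (hc m hm (z m)) as [d [hd hdc]]; [lra|].
      assert (m <= m - d); [|lra]. apply hlub. intros r [hr hzr].
      destruct (Rle_or_lt r (m - d)) as [|hlt]; auto. exfalso.
      assert (r <= m) by (apply hub; auto).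
      specialize (hdc r). simpl in hdc; unfold R_dist in hdc.
      assert (r <> m) by (intros ->; lra).
      assert (h2 : Rabs (z r - z m) < z m).
      { apply hdc; split; [split; [exact I|auto]|]. rewrite Rabs_left1; lra. }
      apply Rabs_def2 in h2. lra. }
  assert (hneg := h0 m hm hmz).
  assert (m < T) by (destruct hm as [_ [?| ->]]; auto; lra).
  specialize (hz m hm). apply is_derive_Reals in hz.
  destruct (hz (- dz m)) as [d hd]; [lra|].
  set (k := Rmin (d / 2) (T - m)).
  assert (hdp := cond_pos d).
  assert (0 < k /\ k < d /\ m + k <= T) as (hk & hkd & hkT)
    by (unfold k, Rmin; destruct Rle_dec; lra).
  specialize (hd k ltac:(lra)). rewrite Rabs_pos_eq in hd by lra.
  specialize (hd hkd). rewrite hmz, Rminus_0_r in hd. apply Rabs_def2 in hd.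
  generalize (hafter (m + k) ltac:(lra)); intros.
  assert (0 < z (m + k) / k) by (apply Rdiv_lt_0_compat; lra). lra.
Qed.

Lemma prim_abs_le_fun (g G dG : R -> R) t :
  cts g -> (on_I r, is_derive G r (dG r)) ->
  (on_I r, Rabs (g r) <= dG r) -> 0 <= t <= T ->
  Rabs (prim g t) <= G t - G 0.
Proof.
  intros hg hG hb ht. apply Rabs_le. split.
  - enough (G 0 + prim g 0 <= G t + prim g t) by (rewrite prim_0 in *; lra).
    apply (derive_nonneg_incr (fun r => G r + prim g r) (fun r => dG r + g r)); [| |lra].
    + intros r hr. apply @is_derive_plus; [apply hG; lra|apply prim_derive; auto; lra].
    + intros r hr. generalize (hb r ltac:(lra)) (Rabs_maj2 (g r)); lra.
  - enough (G 0 - prim g 0 <= G t - prim g t) by (rewrite prim_0 in *; lra).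
    apply (derive_nonneg_incr (fun r => G r - prim g r) (fun r => dG r - g r)); [| |lra].
    + intros r hr. apply @is_derive_minus; [apply hG; lra|apply prim_derive; auto; lra].
    + intros r hr. generalize (hb r ltac:(lra)) (Rle_abs (g r)); lra.
Qed.

Lemma abs_limit_le (u : nat -> R) l c K :
  is_lim_seq u (Finite l) -> (forall n, Rabs (u n - c) <= K) -> Rabs (l - c) <= K.
Proof.
  intros hu hK.
  apply (is_lim_seq_le (fun n => Rabs (u n - c)) (fun _ => K) (Finite (Rabs (l - c))) (Finite K));
    [auto| |apply is_lim_seq_const].
  apply (is_lim_seq_abs (fun n => u n - c) (Finite (l - c))), is_lim_seq_minus'; [auto|].
  apply is_lim_seq_const.
Qed.

Lemma half_pow_small M eps : 0 <= M -> 0 < eps -> exists n, M * (/ 2) ^ n < eps.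
Proof.
  intros hM he.
  destruct (pow_lt_1_zero (/ 2) ltac:(rewrite Rabs_pos_eq; lra) (eps / (M + 1)))
    as [N hN]; [apply Rdiv_lt_0_compat; lra|].
  exists N. specialize (hN N (le_n N)). rewrite Rabs_pos_eq in hN by (apply pow_le; lra).
  apply Rle_lt_trans with ((M + 1) * (/ 2) ^ N).
  - apply Rmult_le_compat_r; [apply pow_le; lra|lra].
  - apply Rmult_lt_compat_l with (r := M + 1) in hN; [|lra].
    replace ((M + 1) * (eps / (M + 1))) with eps in hN by (field; lra). exact hN.
Qed.

Fixpoint picard (F : R -> R -> R) (x0 : R) (n : nat) : R -> R :=
  match n with
  | O => fun _ => x0
  | S m => fun t => x0 + prim (fun s => F s (picard F x0 m s)) t
  end.

(** The weight exp (2 L t) turns the Picard operator into a contraction of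
    ratio 1/2 on the whole of [0, T]. *)
Lemma picard_lindelof (F : R -> R -> R) K L (x0 : R) :
  0 < L ->
  (forall x, cts x -> cts (fun t => F t (x t))) ->
  (forall t x, 0 <= t <= T -> Rabs (F t x) <= K) ->
  (forall t x y, 0 <= t <= T -> Rabs (F t x - F t y) <= L * Rabs (x - y)) ->
  exists x, x 0 = x0 /\ on_I t, is_derive x t (F t (x t)).
Proof.
  intros hL hF hK hlip.
  assert (hK0 : 0 <= K) by (apply Rle_trans with (2 := hK 0 0 ltac:(lra)), Rabs_pos).
  set (X := picard F x0).
  assert (hX : forall n, cts (X n)).
  { induction n as [|n IH]; [apply cts_const|].
    apply cts_plus; [apply cts_const|apply cts_prim, hF, IH]. }
  assert (hXS : forall n t, X (S n) t = x0 + prim (fun s => F s (X n s)) t) by reflexivity.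
  assert (hX0 : forall t, X O t = x0) by reflexivity.
  clearbody X.
  (* W n bounds the n-th step of the iteration. *)
  set (W := fun n t => T * K * exp (2 * L * t) * (/ 2) ^ n).
  assert (hstep : forall n t, 0 <= t <= T -> Rabs (X (S n) t - X n t) <= W n t).
  { induction n as [|n IH]; intros t ht.
    - rewrite hXS, hX0.
      replace (x0 + _ - x0) with (prim (fun s => F s (X O s)) t) by ring.
      apply Rle_trans with (T * K).
      + apply prim_abs_le; auto.
      + unfold W. simpl. rewrite Rmult_1_r.
        assert (1 <= exp (2 * L * t)).
        { destruct (Req_dec t 0) as [->|h]; [rewrite Rmult_0_r, exp_0; lra|].
          left. rewrite <- exp_0. apply exp_increasing. nra. }
        assert (0 <= T * K) by (apply Rmult_le_pos; lra). nra.
    - rewrite (hXS (S n) t), (hXS n t).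
      replace (x0 + _ - _) with
        (prim (fun s => F s (X (S n) s)) t - prim (fun s => F s (X n s)) t) by ring.
      rewrite <- prim_minus by auto.
      apply Rle_trans with (W (S n) t - W (S n) 0).
      + apply (prim_abs_le_fun _ (W (S n)) (fun r => 2 * L * W (S n) r)); auto with cts.
        * intros r hr. unfold W. generalize ((/ 2) ^ S n). intros q. auto_derive; auto. simpl; ring.
        * intros r hr. apply Rle_trans with (1 := hlip r _ _ hr).
          apply Rle_trans with (L * W n r).
          -- apply Rmult_le_compat_l; auto; lra.
          -- unfold W; simpl; right; field.
      + assert (0 <= W (S n) 0); [|lra].
        unfold W. repeat apply Rmult_le_pos; try lra; [left; apply exp_pos|apply pow_le; lra]. }
  set (M := T * K * exp (2 * L * T)).
  assert (hM : 0 <= M).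
  { unfold M. repeat apply Rmult_le_pos; try lra; left; apply exp_pos. }
  assert (hstep' : forall n t, 0 <= t <= T -> Rabs (X (S n) t - X n t) <= M * (/ 2) ^ n).
  { intros n t ht. apply Rle_trans with (1 := hstep n t ht). unfold W, M.
    apply Rmult_le_compat_r; [apply pow_le; lra|]. apply Rmult_le_compat_l; [nra|].
    destruct (Req_dec t T) as [->|h]; [lra|]. left; apply exp_increasing; nra. }
  assert (hcauchy : forall p n t, 0 <= t <= T ->
    Rabs (X (p + n)%nat t - X n t) <= 2 * M * (/ 2) ^ n - 2 * M * (/ 2) ^ (p + n)).
  { induction p as [|p IH]; intros n t ht.
    - simpl. rewrite Rminus_diag, Rabs_R0. lra.
    - replace (X (S p + n)%nat t - X n t) with
        ((X (S (p + n)) t - X (p + n)%nat t) + (X (p + n)%nat t - X n t)) by (simpl; ring).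
      apply Rle_trans with (1 := Rabs_triang _ _).
      generalize (hstep' (p + n)%nat t ht) (IH n t ht). simpl (S p + n)%nat.
      simpl ((/ 2) ^ S (p + n)). lra. }
  assert (hlim : on_I t, is_lim_seq (fun n => X n t)
                   (Finite (real (Lim_seq (fun n => X n t))))).
  { intros t ht. apply Lim_seq_correct', ex_lim_seq_cauchy_corr. intros eps.
    destruct (half_pow_small (2 * M) (eps / 2)) as [N hN];
      [lra|generalize (cond_pos eps); lra|].
    assert (h : forall n, (N <= n)%nat -> Rabs (X n t - X N t) < eps / 2).
    { intros n hn. replace n with ((n - N) + N)%nat by lia.
      apply Rle_lt_trans with (1 := hcauchy (n - N)%nat N t ht).
      generalize (pow_le (/ 2) (n - N + N) ltac:(lra)). nra. }
    exists N. intros n m hn hm.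
    replace (X n t - X m t) with ((X n t - X N t) - (X m t - X N t)) by ring.
    apply Rle_lt_trans with (1 := Rabs_triang _ _). rewrite Rabs_Ropp.
    generalize (h n hn) (h m hm); lra. }
  set (Y := fun t => real (Lim_seq (fun n => X n t))).
  assert (hY : forall n t, 0 <= t <= T -> Rabs (Y t - X n t) <= 2 * M * (/ 2) ^ n).
  { intros n t ht.
    apply (abs_limit_le (fun p => X (p + n)%nat t)).
    - apply (is_lim_seq_incr_n (fun p => X p t)), hlim, ht.
    - intros p. apply Rle_trans with (1 := hcauchy p n t ht).
      generalize (pow_le (/ 2) (p + n) ltac:(lra)). nra. }
  assert (hXlip : forall n s t, 0 <= s <= T -> 0 <= t <= T ->
    Rabs (X n s - X n t) <= K * Rabs (s - t)).
  { intros [|n].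
    - intros; rewrite !hX0, Rminus_diag, Rabs_R0.
      apply Rmult_le_pos; [auto|apply Rabs_pos].
    - assert (h : forall s t, 0 <= s <= T -> 0 <= t <= T -> s < t ->
        Rabs (X (S n) s - X (S n) t) <= K * Rabs (s - t)).
      { intros s t hs ht hst. rewrite Rabs_minus_sym, (Rabs_minus_sym s).
        destruct (mvt (X (S n)) (fun r => F r (X n r)) s t) as [c [hc ->]]; auto.
        - intros r hr. apply (is_derive_ext (fun r => x0 + prim (fun s => F s (X n s)) r));
            [intros; symmetry; apply hXS|].
          apply is_derive_eq with (0 + F r (X n r)); [|ring].
          apply @is_derive_plus; [apply @is_derive_const|].
          apply (prim_derive (fun s => F s (X n s))); auto; lra.
        - rewrite Rabs_mult. apply Rmult_le_compat_r; [apply Rabs_pos|].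
          apply hK; lra. }
      intros s t hs ht. destruct (Rtotal_order s t) as [hlt|[<-|hlt]]; auto.
      + rewrite !Rminus_diag, Rabs_R0; lra.
      + rewrite Rabs_minus_sym, (Rabs_minus_sym s); auto. }
  assert (hYc : cts Y).
  { intros r. apply (continuous_of_lipschitz (fun r => Y (clip 0 T r)) K). intros s t.
    apply Rle_trans with (K * Rabs (clip 0 T s - clip 0 T t)).
    - assert (hs := clip_range 0 T s ltac:(lra)). assert (ht := clip_range 0 T t ltac:(lra)).
      replace (Y (clip 0 T s) - Y (clip 0 T t)) with
        ((Y (clip 0 T s) - Y (clip 0 T t)) - 0) by ring.
      apply (abs_limit_le (fun n => X n (clip 0 T s) - X n (clip 0 T t))).
      + apply (is_lim_seq_minus' (fun n => X n (clip 0 T s)) (fun n => X n (clip 0 T t)));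
          apply hlim; auto.
      + intros n. rewrite Rminus_0_r. auto.
    - apply Rmult_le_compat_l; auto. apply clip_lipschitz. }
  set (Z := fun t => x0 + prim (fun s => F s (Y s)) t).
  assert (hZ : on_I t, Z t = Y t).
  { intros t ht. apply Rminus_diag_uniq, Rabs_eq_0, Rle_antisym; [|apply Rabs_pos].
    apply Rle_plus_epsilon. intros eps he.
    destruct (half_pow_small ((T * L + 1) * (2 * M)) eps) as [n hn]; auto.
    { assert (0 < T * L) by (apply Rmult_lt_0_compat; lra). apply Rmult_le_pos; lra. }
    assert (h1 : Rabs (Z t - X (S n) t) <= T * (L * (2 * M * (/ 2) ^ n))).
    { unfold Z. rewrite hXS. replace (_ - _) with
        (prim (fun s => F s (Y s)) t - prim (fun s => F s (X n s)) t) by ring.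
      rewrite <- prim_minus by auto.
      apply prim_abs_le; auto with cts. intros r hr.
      apply Rle_trans with (1 := hlip r _ _ hr). apply Rmult_le_compat_l; [lra|auto]. }
    assert (h2 := hY (S n) t ht). simpl in h2.
    replace (Z t - Y t) with ((Z t - X (S n) t) - (Y t - X (S n) t)) by ring.
    apply Rle_trans with (1 := Rabs_triang _ _). rewrite Rabs_Ropp.
    assert (0 <= M * (/ 2) ^ n) by (apply Rmult_le_pos; [auto|apply pow_le; lra]).
    lra. }
  exists Z. split; [unfold Z; rewrite prim_0; ring|].
  intros t ht. rewrite (hZ t ht).
  apply is_derive_eq with (0 + F t (Y t)); [|ring].
  apply @is_derive_plus; [apply @is_derive_const|].
  apply (prim_derive (fun s => F s (Y s))); auto.
Qed.

(** * Relative and two-sided derivatives *)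

Lemma D_in_is_derive (E : R -> Prop) (g dg : R -> R) t d :
  0 < d -> (forall y, Rabs (y - t) < d -> E y) -> D_in g dg E t ->
  is_derive g t (dg t).
Proof.
  intros hd hE hg. apply is_derive_Reals. intros eps he.
  destruct (hg eps he) as [a [ha hlim]]. simpl in hlim; unfold Rdist in hlim.
  assert (hm : 0 < Rmin a d) by (apply Rmin_pos; lra).
  exists (mkposreal _ hm). intros h h0 hh. simpl in hh.
  assert (Rmin a d <= a /\ Rmin a d <= d) as [? ?] by (split; [apply Rmin_l|apply Rmin_r]).
  specialize (hlim (t + h)). replace (t + h - t) with h in hlim by ring.
  apply hlim. split; [split|lra].
  - apply hE. replace (t + h - t) with h by ring. lra.
  - lra.
Qed.

Lemma is_derive_D_in (E : R -> Prop) (g dg : R -> R) t :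
  is_derive g t (dg t) -> D_in g dg E t.
Proof.
  intros hg eps he. apply is_derive_Reals in hg. destruct (hg eps he) as [d hd].
  exists d; split; [apply cond_pos|]. simpl; unfold Rdist.
  intros y [[_ hy] hyd]. specialize (hd (y - t) ltac:(lra) hyd).
  replace (t + (y - t)) with y in hd by ring. exact hd.
Qed.

Lemma continuous_in_cts g : continuous_in (Icc 0 T) g -> cts g.
Proof.
  intros hg t. apply continuity_pt_filterlim. intros eps he.
  assert (hct := clip_range 0 T t ltac:(lra)).
  destruct (hg (clip 0 T t) hct eps he) as [a [ha hlim]].
  exists a; split; auto. simpl in *; unfold Rdist in *.
  intros y [_ hy]. destruct (Req_dec (clip 0 T y) (clip 0 T t)) as [->|hne].
  - rewrite Rminus_diag, Rabs_R0; auto.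
  - apply hlim. split; [split; auto|].
    + apply clip_range; lra.
    + apply Rle_lt_trans with (2 := hy), clip_lipschitz.
Qed.

(** * Solutions of Abel equations *)

Definition sol (A B v : R -> R) : Prop :=
  on_I t, is_derive v t (A t * v t ^ 3 + B t * v t ^ 2).

Lemma sol_cts A B v : sol A B v -> cts v.
Proof. intros h. eapply cts_derive; exact h. Qed.

Hint Resolve sol_cts : cts.

Lemma sol_ext A B A' B' v :
  (on_I t, A t = A' t) -> (on_I t, B t = B' t) ->
  sol A B v -> sol A' B' v.
Proof. intros hA hB hv t ht. rewrite <- hA, <- hB by auto. apply hv, ht. Qed.

Lemma sol_solution A B A' B' v :
  (on_I t, A t = A' t) -> (on_I t, B t = B' t) ->
  sol A B v -> solution T A' B' v.
Proof.
  intros hA hB hv t ht. apply is_derive_D_in. rewrite <- hA, <- hB by exact ht.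
  apply hv, ht.
Qed.

(** Continuing the integral of the right-hand side past the end points turns
    one-sided derivatives into two-sided ones. *)
Lemma solution_sol A B A' B' x :
  cts A -> cts B ->
  (on_I t, A t = A' t) -> (on_I t, B t = B' t) ->
  solution T A' B' x -> exists v, sol A B v /\ on_I t, v t = x t.
Proof.
  intros hA hB eA eB hx.
  assert (hxc : cts x).
  { apply continuous_in_cts. intros t ht. eapply cont_deriv, hx, ht. }
  set (g := fun s => A s * x s ^ 3 + B s * x s ^ 2).
  assert (hg : cts g) by (unfold g; auto with cts).
  set (v := fun t => x 0 + prim g t).
  assert (hv : on_I t, is_derive v t (g t)).
  { intros t ht. apply is_derive_eq with (0 + g t); [|ring].
    apply @is_derive_plus; [apply @is_derive_const|apply prim_derive; auto]. }
  assert (e : on_I t, v t = x t).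
  { intros t ht. set (w := fun s => x (clip 0 T s) - v (clip 0 T s)).
    assert (hw : forall s, continuous w s).
    { intros s. apply (continuous_minus (V := R_NormedModule)); [apply hxc|].
      exact (cts_derive v g hv s). }
    destruct (MVT_gen w 0 t (fun _ => 0)) as [c [_ hc]].
    - rewrite Rmin_left, Rmax_right by lra. intros r hr.
      apply is_derive_ext_loc with (fun s => x s - v s).
      + assert (hd : 0 < Rmin r (T - r)) by (apply Rmin_pos; lra).
        exists (mkposreal _ hd). intros y hy.
        assert (Rabs (y - r) < Rmin r (T - r)) as hy' by exact hy.
        apply Rabs_def2 in hy'.
        generalize (Rmin_l r (T - r)) (Rmin_r r (T - r)); intros.
        unfold w. rewrite clip_id by lra. reflexivity.
      + apply is_derive_eq with (g r - g r); [|ring].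
        apply is_derive_Rminus; [|apply hv; lra].
        unfold g. rewrite eA, eB by lra.
        apply (D_in_is_derive (Icc 0 T) x (fun s => A' s * x s ^ 3 + B' s * x s ^ 2) r
          (Rmin r (T - r))).
        * apply Rmin_pos; lra.
        * intros y hy. apply Rabs_def2 in hy.
          generalize (Rmin_l r (T - r)) (Rmin_r r (T - r)). unfold Icc; lra.
        * apply hx; unfold Icc; lra.
    - intros r _. apply continuity_pt_filterlim, hw.
    - unfold w in hc. rewrite !clip_id in hc by lra.
      unfold v in hc at 2. rewrite prim_0 in hc. lra. }
  exists v; split; auto. intros t ht. rewrite e by auto. apply hv, ht.
Qed.

Lemma sol_exp A B v :
  cts A -> cts B -> sol A B v -> on_I t,
  v t = v 0 * exp (prim (fun s => A s * v s ^ 2 + B s * v s) t).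
Proof.
  intros hA hB hv. assert (hc : cts v) by eauto with cts.
  apply homogeneous_solution; auto with cts.
  intros t ht. eapply is_derive_eq; [apply hv, ht|ring].
Qed.

Lemma sol_same_sign A B v :
  cts A -> cts B -> sol A B v -> forall s t, 0 <= s <= T -> 0 <= t <= T ->
  v s <> 0 -> 0 < v s * v t.
Proof.
  intros hA hB hv s t hs ht. rewrite (sol_exp A B v hA hB hv s hs), (sol_exp A B v hA hB hv t ht).
  intros h. set (a := exp _) in *. set (b := exp _).
  assert (0 < a * b) by (apply Rmult_lt_0_compat; apply exp_pos).
  assert (0 < (v 0) ^ 2) by (apply pow2_gt_0; intros e; apply h; rewrite e; ring).
  replace (v 0 * a * (v 0 * b)) with (v 0 ^ 2 * (a * b)) by ring.
  apply Rmult_lt_0_compat; auto.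
Qed.

Lemma sol_nonzero A B v :
  cts A -> cts B -> sol A B v -> v 0 <> 0 -> on_I t, v t <> 0.
Proof.
  intros hA hB hv h0 t ht e.
  generalize (sol_same_sign A B v hA hB hv 0 t ltac:(lra) ht h0). rewrite e; lra.
Qed.

Lemma sol_pos A B v :
  cts A -> cts B -> sol A B v -> 0 < v 0 -> on_I t, 0 < v t.
Proof.
  intros hA hB hv h0 t ht.
  generalize (sol_same_sign A B v hA hB hv 0 t ltac:(lra) ht ltac:(lra)). nra.
Qed.

Lemma sol_difference A B u v :
  cts A -> cts B -> sol A B u -> sol A B v -> on_I t,
  u t - v t = (u 0 - v 0) * exp (prim (fun s =>
    A s * (u s ^ 2 + u s * v s + v s ^ 2) + B s * (u s + v s)) t).
Proof.
  intros hA hB hu hv.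
  assert (hcu : cts u) by eauto with cts. assert (hcv : cts v) by eauto with cts.
  apply (homogeneous_solution (fun t => u t - v t)); auto 10 with cts.
  intros t ht. eapply is_derive_eq; [apply is_derive_Rminus; [apply hu, ht|apply hv, ht]|ring].
Qed.

Lemma sol_unique A B u v s :
  cts A -> cts B -> sol A B u -> sol A B v -> 0 <= s <= T -> u s = v s ->
  on_I t, u t = v t.
Proof.
  intros hA hB hu hv hs e t ht.
  assert (h := sol_difference A B u v hA hB hu hv).
  assert (e0 : u 0 - v 0 = 0).
  { specialize (h s hs). rewrite e, Rminus_diag in h. symmetry in h.
    apply Rmult_integral in h. destruct h as [h|h]; auto.
    set (x := prim _ s) in h. generalize (exp_pos x); lra. }
  specialize (h t ht). rewrite e0, Rmult_0_l in h. lra.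
Qed.

Lemma sol_opp A B v : sol A B v -> sol A (fun t => - B t) (fun t => - v t).
Proof.
  intros hv t ht. eapply is_derive_eq; [apply @is_derive_opp, hv, ht|].
  unfold opp; simpl; ring.
Qed.

Lemma poincare_eq A B A' B' v :
  cts A -> cts B ->
  (on_I t, A t = A' t) -> (on_I t, B t = B' t) ->
  sol A B v -> poincare T A' B' (v 0) = v T.
Proof.
  intros hA hB eA eB hv. unfold poincare.
  assert (h : exists y, exists x, solution T A' B' x /\ x 0 = v 0 /\ x T = y).
  { exists (v T), v. split; auto. eapply sol_solution; eauto. }
  assert (s := epsilon_spec (inhabits 0) _ h). set (y := epsilon _ _) in *.
  destruct s as [x [hx [e0 eT]]].
  destruct (solution_sol A B A' B' x) as [w [hw ew]]; auto.
  rewrite <- eT, <- ew by lra.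
  apply (sol_unique A B w v 0); auto; try lra. rewrite ew; lra.
Qed.

(** Cutting the right-hand side off at height M makes it bounded and Lipschitz,
    so that its solutions exist on all of [0, T]; those that stay below M solve the
    Abel equation itself. *)
Definition cut_field (A B : R -> R) (M t x : R) : R :=
  A t * clip (- M) M x ^ 3 + B t * clip (- M) M x ^ 2.

Definition cut_sol (A B : R -> R) (M : R) (v : R -> R) : Prop :=
  on_I t, is_derive v t (cut_field A B M t (v t)).

Lemma clip_abs M x : 0 <= M -> Rabs (clip (- M) M x) <= M.
Proof. intros h. apply Rabs_le, clip_range; lra. Qed.

Lemma cut_sol_sol A B M v :
  cut_sol A B M v -> (on_I t, Rabs (v t) <= M) -> sol A B v.
Proof.
  intros hv hM t ht. assert (h := hM t ht). apply Rabs_le_between in h.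
  generalize (hv t ht). unfold cut_field. rewrite clip_id by lra. auto.
Qed.

Lemma sol_cut_sol A B M v :
  sol A B v -> (on_I t, Rabs (v t) <= M) -> cut_sol A B M v.
Proof.
  intros hv hM t ht. assert (h := hM t ht). apply Rabs_le_between in h.
  unfold cut_field. rewrite clip_id by lra. apply hv, ht.
Qed.

Lemma cut_sol_zero A B M : 0 <= M -> cut_sol A B M (fun _ => 0).
Proof.
  intros hM t ht. unfold cut_field. rewrite clip_id by lra.
  eapply is_derive_eq; [apply @is_derive_const|]. unfold zero; simpl; ring.
Qed.

Lemma cut_field_lipschitz A B M KA KB t x y :
  0 <= M -> Rabs (A t) <= KA -> Rabs (B t) <= KB ->
  Rabs (cut_field A B M t x - cut_field A B M t y) <=
    (3 * KA * M ^ 2 + 2 * KB * M) * Rabs (x - y).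
Proof.
  intros hM hA hB. unfold cut_field.
  assert (h1 := clip_abs M x hM). assert (h2 := clip_abs M y hM).
  assert (h3 := clip_lipschitz (- M) M x y).
  set (p := clip (- M) M x) in *. set (q := clip (- M) M y) in *.
  replace (_ - _) with ((A t * (p ^ 2 + p * q + q ^ 2) + B t * (p + q)) * (p - q)) by ring.
  rewrite Rabs_mult.
  assert (h4 : Rabs (A t * (p ^ 2 + p * q + q ^ 2) + B t * (p + q)) <=
               3 * KA * M ^ 2 + 2 * KB * M).
  { apply Rle_trans with (1 := Rabs_triang _ _). rewrite !Rabs_mult.
    assert (Rabs (p ^ 2 + p * q + q ^ 2) <= 3 * M ^ 2).
    { apply Rabs_le_between in h1. apply Rabs_le_between in h2. apply Rabs_le. nra. }
    assert (Rabs (p + q) <= 2 * M) by (apply Rle_trans with (1 := Rabs_triang _ _); lra).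
    generalize (Rabs_pos (A t)) (Rabs_pos (B t)) (Rabs_pos (p ^ 2 + p * q + q ^ 2))
      (Rabs_pos (p + q)); intros.
    assert (Rabs (A t) * Rabs (p ^ 2 + p * q + q ^ 2) <= KA * (3 * M ^ 2))
      by (apply Rmult_le_compat; auto).
    assert (Rabs (B t) * Rabs (p + q) <= KB * (2 * M)) by (apply Rmult_le_compat; auto).
    lra. }
  apply Rmult_le_compat; auto; apply Rabs_pos.
Qed.

Lemma cts_cut_field A B M x :
  cts A -> cts B -> cts x -> cts (fun t => cut_field A B M t (x t)).
Proof.
  intros hA hB hx. unfold cut_field.
  assert (cts (fun t => clip (- M) M (x t))).
  { intros t. apply (continuous_comp (fun s => x (clip 0 T s))); [apply hx|].
    apply continuous_clip. }
  auto with cts.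
Qed.

Lemma cut_sol_exists A B M x0 :
  cts A -> cts B -> 0 < M -> exists v, cut_sol A B M v /\ v 0 = x0.
Proof.
  intros hA hB hM.
  destruct (cts_bounded A hA) as [KA [hKA bA]]. destruct (cts_bounded B hB) as [KB [hKB bB]].
  destruct (picard_lindelof (cut_field A B M) (KA * M ^ 3 + KB * M ^ 2)
    (3 * KA * M ^ 2 + 2 * KB * M) x0) as [v [h0 hv]].
  - assert (0 < KB * M) by (apply Rmult_lt_0_compat; auto).
    assert (0 <= KA * M ^ 2) by (apply Rmult_le_pos; [lra|apply pow2_ge_0]). lra.
  - intros x hx. apply cts_cut_field; auto.
  - intros t x ht. unfold cut_field. apply Rle_trans with (1 := Rabs_triang _ _).
    rewrite !Rabs_mult, <- !RPow_abs. assert (hc := clip_abs M x ltac:(lra)).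
    apply Rplus_le_compat; apply Rmult_le_compat; auto using Rabs_pos;
      try (apply pow_le, Rabs_pos); apply pow_incr; auto using Rabs_pos.
  - intros t x y ht. apply cut_field_lipschitz; auto; lra.
  - exists v; auto.
Qed.

Lemma sqr_le_abs z z0 K : 0 <= K -> z ^ 2 <= z0 ^ 2 * K -> Rabs z <= Rabs z0 * sqrt K.
Proof.
  intros hK h. rewrite <- (sqrt_pow2 (Rabs z)), <- (sqrt_pow2 (Rabs z0)) by apply Rabs_pos.
  rewrite <- sqrt_mult by (auto; apply pow2_ge_0).
  apply sqrt_le_1; rewrite ?pow2_abs; auto using pow2_ge_0.
  apply Rmult_le_pos; auto using pow2_ge_0.
Qed.

(** A perturbation of B enters the difference of two cut-off solutions as a forcing term;
    one constant C serves all perturbed coefficients B'. *)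
Lemma cut_sol_gronwall A B M :
  cts A -> cts B -> 0 < M -> exists C, 1 <= C /\
  forall B' eps u v, 0 <= eps ->
    (on_I t, Rabs (B t - B' t) * M ^ 2 <= eps) ->
    cut_sol A B M u -> cut_sol A B' M v ->
    forall s t, 0 <= s <= T -> 0 <= t <= T ->
    Rabs (u t - v t) <= C * (Rabs (u s - v s) + eps).
Proof.
  intros hA hB hM.
  destruct (cts_bounded A hA) as [KA [hKA bA]]. destruct (cts_bounded B hB) as [KB [hKB bB]].
  set (L := 3 * KA * M ^ 2 + 2 * KB * M).
  assert (hL : 0 <= L).
  { assert (0 < KB * M) by (apply Rmult_lt_0_compat; auto).
    assert (0 <= KA * M ^ 2) by (apply Rmult_le_pos; [lra|apply pow2_ge_0]). unfold L; lra. }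
  set (K := exp ((2 * L + 1) * T)).
  assert (hK : 1 <= K).
  { assert (0 < (2 * L + 1) * T) by (apply Rmult_lt_0_compat; lra).
    generalize (exp_ineq1_le ((2 * L + 1) * T)); unfold K; lra. }
  exists (sqrt K). split.
  { rewrite <- sqrt_1. apply sqrt_le_1; lra. }
  intros B' eps u v he hBB hu hv s t hs ht.
  rewrite Rmult_comm.
  rewrite <- (Rabs_pos_eq (Rabs (u s - v s) + eps)) by (generalize (Rabs_pos (u s - v s)); lra).
  apply sqr_le_abs; [lra|].
  apply Rle_trans with (((u s - v s) ^ 2 + eps ^ 2) * K).
  - apply (gronwall (fun r => u r - v r)
      (fun r => cut_field A B M r (u r) - cut_field A B' M r (v r)) L eps); auto.
    + intros r hr. apply is_derive_Rminus; [apply hu|apply hv]; auto.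
    + intros r hr.
      replace (cut_field A B M r (u r) - cut_field A B' M r (v r)) with
        ((cut_field A B M r (u r) - cut_field A B M r (v r)) +
         (B r - B' r) * clip (- M) M (v r) ^ 2) by (unfold cut_field; ring).
      apply Rle_trans with (1 := Rabs_triang _ _). apply Rplus_le_compat.
      * apply cut_field_lipschitz; auto; lra.
      * apply Rle_trans with (2 := hBB r hr). rewrite Rabs_mult.
        apply Rmult_le_compat_l; [apply Rabs_pos|]. rewrite <- RPow_abs.
        apply pow_incr; split; [apply Rabs_pos|apply clip_abs; lra].
  - apply Rmult_le_compat_r; [lra|]. rewrite <- (pow2_abs (u s - v s)).
    generalize (Rabs_pos (u s - v s)); intros. nra.
Qed.

(** The zero function is a cut-off solution, and by uniqueness no other one meets it. *)
Lemma cut_sol_pos A B M v :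
  cts A -> cts B -> 0 < M -> cut_sol A B M v -> 0 < v 0 ->
  on_I t, 0 < v t.
Proof.
  intros hA hB hM hv h0 t ht.
  assert (hne : on_I s, v s <> 0).
  { intros s hs e. destruct (cut_sol_gronwall A B M hA hB hM) as [C [hC h]].
    specialize (h B 0 v (fun _ => 0) ltac:(lra)).
    assert (h1 : Rabs (v 0 - 0) <= C * (Rabs (v s - 0) + 0)).
    { apply h; auto; try lra; [|apply cut_sol_zero; lra].
      intros r _. rewrite Rminus_diag, Rabs_R0; lra. }
    rewrite e, Rminus_diag, Rabs_R0, Rminus_0_r, Rabs_pos_eq in h1; lra. }
  generalize (cts_sign v (cts_derive v _ hv) hne t ht). nra.
Qed.

(** With the cut-off one unit above the bound of u, cut-off solutions that start close
    to u stay below it, so that they are solutions. *)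
Lemma sol_near A B u :
  cts A -> cts B -> sol A B u -> exists d C, 0 < d /\ 0 < C /\
  forall x, Rabs (x - u 0) <= d -> exists v, sol A B v /\ v 0 = x /\
    on_I t, Rabs (v t - u t) <= C * Rabs (x - u 0) /\
                             Rabs (v t - u t) <= 1.
Proof.
  intros hA hB hu.
  destruct (cts_bounded u (sol_cts A B u hu)) as [K [hK bK]].
  set (M := K + 1). assert (hM : 0 < M) by (unfold M; lra).
  destruct (cut_sol_gronwall A B M hA hB hM) as [C [hC hG]].
  exists (/ C), C. assert (hC' : 0 < / C) by (apply Rinv_0_lt_compat; lra).
  split; [auto|split; [lra|]]. intros x hx.
  destruct (cut_sol_exists A B M x hA hB hM) as [v [hv h0]].
  assert (hb : on_I t, Rabs (v t - u t) <= C * Rabs (x - u 0)).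
  { intros t ht. rewrite <- h0, <- (Rplus_0_r (Rabs (v 0 - u 0))).
    apply (hG B 0 v u); auto; try lra.
    - intros r _. rewrite Rminus_diag, Rabs_R0; lra.
    - apply sol_cut_sol; auto. intros r hr. generalize (bK r hr); unfold M; lra. }
  assert (hb1 : on_I t, Rabs (v t - u t) <= 1).
  { intros t ht. apply Rle_trans with (1 := hb t ht).
    apply Rmult_le_compat_l with (r := C) in hx; [|lra].
    rewrite Rinv_r in hx by lra. exact hx. }
  exists v. split; [|auto]. apply (cut_sol_sol A B M); auto.
  intros t ht. replace (v t) with ((v t - u t) + u t) by ring.
  apply Rle_trans with (1 := Rabs_triang _ _).
  generalize (hb1 t ht) (bK t ht); unfold M; lra.
Qed.

Lemma sol_inverse A B v t :
  cts A -> cts B -> sol A B v -> v 0 <> 0 -> 0 <= t <= T ->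
  prim (fun s => A s * v s + B s) t = / v 0 - / v t.
Proof.
  intros hA hB hv h0 ht. assert (hc : cts v) by eauto with cts.
  assert (hne := sol_nonzero A B v hA hB hv h0).
  rewrite (prim_ftc (fun s => - / v s) (fun s => A s * v s + B s) t); auto with cts; [ring|].
  intros r hr. eapply is_derive_eq.
  - apply @is_derive_opp, is_derive_Rinv; [apply hv, hr|apply hne, hr].
  - unfold opp; simpl. field. apply hne, hr.
Qed.

(** * The family of equations with B shifted by multiples of f *)

Variable f : R -> R.
Hypothesis hf : cts f.
Hypothesis hfpos : on_I t, 0 < f t.

Definition shift (B : R -> R) (l t : R) : R := B t + l * f t.

Lemma cts_shift B l : cts B -> cts (shift B l).
Proof. intros hB. unfold shift. auto with cts. Qed.

Hint Resolve cts_shift hf : cts.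

Lemma J_f_pos : 0 < J f.
Proof. apply J_pos; auto. intros; apply hfpos; lra. Qed.

Lemma J_shift B l : cts B -> J (shift B l) = J B + l * J f.
Proof. intros hB. unfold shift. rewrite J_plus, J_scal; auto with cts. Qed.

Lemma shift_bound KB Kf B l L t :
  Rabs (B t) <= KB -> Rabs (f t) <= Kf -> Rabs l <= L ->
  Rabs (shift B l t) <= KB + L * Kf.
Proof.
  intros h1 h2 h3. unfold shift. apply Rle_trans with (1 := Rabs_triang _ _).
  rewrite Rabs_mult. apply Rplus_le_compat; auto.
  apply Rmult_le_compat; auto; apply Rabs_pos.
Qed.

(** The final value of a cut-off solution depends continuously on the parameter l. *)
Lemma cut_sol_shooting A B M x l1 l2 :
  cts A -> cts B -> 0 < M -> l1 <= l2 ->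
  (forall v, cut_sol A (shift B l1) M v -> v 0 = x -> v T <= x) ->
  (forall v, cut_sol A (shift B l2) M v -> v 0 = x -> x <= v T) ->
  exists l v, l1 <= l <= l2 /\ cut_sol A (shift B l) M v /\ v 0 = x /\ v T = x.
Proof.
  intros hA hB hM hl h1 h2.
  assert (hex : forall l, exists v, cut_sol A (shift B (clip l1 l2 l)) M v /\ v 0 = x).
  { intros l. apply cut_sol_exists; auto with cts. }
  set (V := fun l => proj1_sig (constructive_indefinite_description _ (hex l))).
  assert (hV : forall l, cut_sol A (shift B (clip l1 l2 l)) M (V l) /\ V l 0 = x).
  { intros l. exact (proj2_sig (constructive_indefinite_description _ (hex l))). }
  clearbody V.
  destruct (cts_bounded f hf) as [Kf [hKf bf]].
  assert (hcont : continuity (fun l => V l T - x)).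
  { intros l. apply continuity_pt_filterlim.
    apply (continuous_minus (V := R_NormedModule) (fun l => V l T) (fun _ => x));
      [|apply continuous_const].
    destruct (hV l) as [hVl hVl0].
    destruct (cut_sol_gronwall A (shift B (clip l1 l2 l)) M) as [C [hC hG]]; auto with cts.
    apply continuity_pt_filterlim. intros eps he.
    assert (hCM : 0 < C * (Kf * M ^ 2)).
    { apply Rmult_lt_0_compat; [lra|apply Rmult_lt_0_compat; [lra|apply pow_lt; auto]]. }
    exists (eps / (C * (Kf * M ^ 2))). split; [apply Rdiv_lt_0_compat; auto|].
    simpl; unfold Rdist. intros l' [_ hl'].
    destruct (hV l') as [hVl' hVl'0].
    rewrite Rabs_minus_sym.
    apply Rle_lt_trans with (C * (Rabs (V l 0 - V l' 0) + Rabs (l' - l) * (Kf * M ^ 2))).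
    - apply (hG (shift B (clip l1 l2 l'))); auto; try lra.
      + repeat apply Rmult_le_pos; try apply Rabs_pos; try lra; apply pow_le; lra.
      + intros t ht. rewrite <- Rmult_assoc. apply Rmult_le_compat_r; [apply pow_le; lra|].
        unfold shift. replace (_ - _) with ((clip l1 l2 l - clip l1 l2 l') * f t) by ring.
        rewrite Rabs_mult, (Rabs_minus_sym l' l).
        apply Rmult_le_compat; auto using Rabs_pos, clip_lipschitz.
    - rewrite hVl0, hVl'0, Rminus_diag, Rabs_R0, Rplus_0_l.
      apply Rmult_lt_compat_r with (r := C * (Kf * M ^ 2)) in hl'; auto.
      unfold Rdiv in hl'. rewrite Rmult_assoc, Rinv_l, Rmult_1_r in hl' by lra. lra. }
  destruct (IVT_cor _ l1 l2 hcont hl) as [l [hl12 e]].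
  - assert (V l1 T - x <= 0).
    { destruct (hV l1) as [a b]. rewrite clip_id in a by lra. generalize (h1 _ a b); lra. }
    assert (0 <= V l2 T - x).
    { destruct (hV l2) as [a b]. rewrite clip_id in a by lra. generalize (h2 _ a b); lra. }
    nra.
  - destruct (hV l) as [a b]. rewrite clip_id in a by lra.
    exists l, (V l). split; [lra|split; [auto|split; [auto|lra]]].
Qed.

Lemma J_affine_bound A B v KA KB M :
  cts A -> cts B -> cts v -> 0 <= KA ->
  (on_I t, Rabs (A t) <= KA) ->
  (on_I t, Rabs (B t) <= KB) ->
  (on_I t, Rabs (v t) <= M) ->
  Rabs (J (fun t => A t * v t + B t)) <= T * (KA * M + KB).
Proof.
  intros. apply J_abs_le; auto with cts. intros t ht.
  apply Rle_trans with (1 := Rabs_triang _ _). rewrite Rabs_mult.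
  apply Rplus_le_compat; auto. apply Rmult_le_compat; auto using Rabs_pos.
Qed.

Lemma J_affine_shift A B v l :
  cts A -> cts B -> cts v ->
  J (fun t => A t * v t + shift B l t) = J (fun t => A t * v t + B t) + l * J f.
Proof.
  intros. rewrite <- J_scal, <- J_plus; auto with cts.
  apply J_ext. intros; unfold shift; ring.
Qed.

(** Raising the parameter makes solutions cross u upwards only; a solution that
    starts and ends below u therefore stays below it, and cannot blow up.  This is
    what makes the set of initial values of closed solutions of the family an
    interval. *)
Lemma closed_below_pos A B u x :
  cts A -> cts B -> sol A B u -> u T = u 0 -> 0 < x < u 0 ->
  exists l v, sol A (shift B l) v /\ v 0 = x /\ v T = x /\
    on_I t, 0 < v t < u t.
Proof.
  intros hA hB hu huT hx.
  assert (hup := sol_pos A B u hA hB hu ltac:(lra)).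
  destruct (cts_bounded u (sol_cts A B u hu)) as [M [hM bu]].
  destruct (cts_bounded A hA) as [KA [hKA bA]]. destruct (cts_bounded B hB) as [KB [hKB bB]].
  assert (hJf := J_f_pos).
  assert (huM : on_I t, 0 < u t <= M).
  { intros t ht. generalize (hup t ht) (bu t ht) (Rle_abs (u t)); lra. }
  assert (hcross : forall l v t, cut_sol A (shift B l) M v -> 0 <= t <= T ->
    u t - v t = 0 ->
    (A t * u t ^ 3 + B t * u t ^ 2) - cut_field A (shift B l) M t (v t) =
    - (l * (f t * u t ^ 2))).
  { intros l v t hv ht e. replace (v t) with (u t) by lra.
    unfold cut_field, shift. rewrite clip_id by (generalize (huM t ht); lra). ring. }
  assert (hfu : on_I t, 0 < f t * u t ^ 2).
  { intros t ht. apply Rmult_lt_0_compat; [apply hfpos, ht|apply pow_lt, huM, ht]. }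
  assert (hd : forall l v, cut_sol A (shift B l) M v -> on_I t,
    is_derive (fun r => u r - v r) t
      ((A t * u t ^ 3 + B t * u t ^ 2) - cut_field A (shift B l) M t (v t))).
  { intros l v hv t ht. apply is_derive_Rminus; [apply hu|apply hv]; auto. }
  (* For positive l solutions can cross u upwards only, for negative l downwards only. *)
  assert (hup_l : forall l v, 0 < l -> cut_sol A (shift B l) M v -> v T < u 0 ->
    on_I t, v t < u t).
  { intros l v hl hv hvT t ht. enough (0 < u t - v t) by lra.
    apply (positive_of_decreasing_at_zeros _ _ (hd l v hv)); auto; [|lra].
    intros s hs e. rewrite (hcross l v s hv hs e). generalize (hfu s hs); nra. }
  assert (hdown_l : forall l v, l < 0 -> cut_sol A (shift B l) M v -> v 0 < u 0 ->
    on_I t, v t < u t).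
  { intros l v hl hv hv0 t ht. enough (0 < u t - v t) by lra.
    replace t with (T - (T - t)) by ring.
    apply (positive_of_decreasing_at_zeros (fun r => u (T - r) - v (T - r))
      (fun r => - ((A (T - r) * u (T - r) ^ 3 + B (T - r) * u (T - r) ^ 2)
               - cut_field A (shift B l) M (T - r) (v (T - r))))); try lra.
    - intros r hr. assert (h := hd l v hv (T - r) ltac:(lra)).
      apply is_derive_eq with (-1 * ((A (T - r) * u (T - r) ^ 3 + B (T - r) * u (T - r) ^ 2)
               - cut_field A (shift B l) M (T - r) (v (T - r)))); [|ring].
      apply (is_derive_comp (fun s => u s - v s) (fun r => T - r)); auto.
      auto_derive; auto; ring.
    - intros s hs e. rewrite (hcross l v (T - s) hv ltac:(lra) e).
      generalize (hfu (T - s) ltac:(lra)); nra.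
    - rewrite Rminus_diag. lra. }
  assert (hvp : forall l v, cut_sol A (shift B l) M v -> v 0 = x ->
    on_I t, 0 < v t).
  { intros l v hv h0. apply (cut_sol_pos A (shift B l) M); auto with cts. lra. }
  assert (hgen : forall l v, cut_sol A (shift B l) M v -> v 0 = x ->
    (on_I t, v t < u t) ->
    sol A (shift B l) v /\
    Rabs (/ x - / v T - l * J f) <= T * (KA * M + KB)).
  { intros l v hv h0 hlt.
    assert (hvM : on_I t, Rabs (v t) <= M).
    { intros t ht. generalize (hlt t ht) (hvp l v hv h0 t ht) (huM t ht); intros.
      rewrite Rabs_pos_eq; lra. }
    assert (hs : sol A (shift B l) v) by (apply cut_sol_sol with M; auto).
    assert (hvc : cts v) by eauto with cts.
    split; auto. rewrite <- h0.
    rewrite <- (sol_inverse A (shift B l) v T) by (auto with cts; lra).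
    fold (J (fun s => A s * v s + shift B l s)). rewrite J_affine_shift by auto.
    replace (_ + l * J f - l * J f) with (J (fun t => A t * v t + B t)) by ring.
    apply J_affine_bound; auto; lra. }
  assert (hix : 0 < / x) by (apply Rinv_0_lt_compat; lra).
  set (c := T * (KA * M + KB)) in *.
  assert (hc : 0 < c).
  { unfold c. apply Rmult_lt_0_compat; [lra|]. generalize (Rmult_lt_0_compat KA M hKA hM); lra. }
  (* Parameters L and -L for which 1/x - 1/v(T), at distance at most c from l (int f),
     forces v(T) beyond x on either side. *)
  set (L := (c + / x) / J f).
  assert (hL : 0 < L) by (apply Rdiv_lt_0_compat; lra).
  assert (hLJ : L * J f = c + / x) by (unfold L; field; lra).
  destruct (cut_sol_shooting A B M x (- L) L) as (l & v & hl & hv & hv0 & hvT); auto; try lra.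
  - intros v hv h0.
    destruct (hgen (- L) v hv h0 (hdown_l (- L) v ltac:(lra) hv ltac:(lra))) as [_ hb].
    apply Rabs_le_between in hb.
    assert (h : / x <= / v T) by lra.
    apply Rinv_le_contravar in h; auto. rewrite !Rinv_inv in h; auto.
  - intros v hv h0. destruct (Rle_or_lt x (v T)) as [|hlt]; auto. exfalso.
    destruct (hgen L v hv h0 (hup_l L v ltac:(lra) hv ltac:(lra))) as [_ hb].
    apply Rabs_le_between in hb.
    assert (0 < / v T) by (apply Rinv_0_lt_compat; eapply hvp; eauto; lra). lra.
  - assert (hlt : on_I t, v t < u t).
    { destruct (Rtotal_order l 0) as [h|[h|h]].
      - apply (hdown_l l); auto; lra.
      - assert (hne : on_I t, u t - v t <> 0).
        { intros t ht e.
          destruct (cut_sol_gronwall A B M hA hB hM) as [C [hC hG]].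
          assert (h1 : Rabs (u 0 - v 0) <= C * (Rabs (u t - v t) + 0)).
          { apply (hG (shift B l)); auto; try lra.
            - intros r _. unfold shift. rewrite h.
              replace (B r - _) with 0 by ring. rewrite Rabs_R0; lra.
            - apply sol_cut_sol; auto. }
          rewrite e, Rabs_R0, Rplus_0_l, Rmult_0_r in h1.
          rewrite Rabs_pos_eq in h1; lra. }
        intros t ht.
        generalize (cts_sign _ (cts_derive _ _ (hd l v hv)) hne t ht). simpl. nra.
      - apply (hup_l l); auto; lra. }
    exists l, v. destruct (hgen l v hv hv0 hlt) as [hs _].
    split; [auto|split; [auto|split; [auto|]]]. split; [eapply hvp; eauto|auto].
Qed.

Lemma sol_shift_opp A B l v :
  sol A (shift (fun s => - B s) l) v -> sol A (shift B (- l)) (fun t => - v t).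
Proof.
  intros hv. apply (sol_ext A (fun t => - shift (fun s => - B s) l t)); auto.
  - intros; unfold shift; ring.
  - apply sol_opp, hv.
Qed.

(** Since B has mean 0, the difference 1/v(0) - 1/v(T) is l (int f) up to a term of the size
    of v(0); the parameters 1 and -1 therefore push small solutions to opposite sides. *)
Lemma closed_small_pos A B :
  cts A -> cts B -> J B = 0 -> exists d, 0 < d /\ forall x, 0 < x <= d ->
  exists l v, sol A (shift B l) v /\ v 0 = x /\ v T = x /\
    on_I t, Rabs (v t) <= 1.
Proof.
  intros hA hB hJB.
  destruct (cts_bounded A hA) as [KA [hKA bA]]. destruct (cts_bounded B hB) as [KB [hKB bB]].
  destruct (cts_bounded f hf) as [Kf [hKf bf]].
  assert (hJf := J_f_pos).
  set (L := 3 * KA * 1 ^ 2 + 2 * (KB + 1 * Kf) * 1).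
  set (K := exp ((2 * L + 1) * T)). assert (hK : 0 < K) by apply exp_pos.
  set (C := sqrt K). assert (hC : 0 < C) by (apply sqrt_lt_R0; auto).
  assert (hsmall : forall l v, -1 <= l <= 1 -> cut_sol A (shift B l) 1 v ->
    on_I t, Rabs (v t) <= Rabs (v 0) * C).
  { intros l v hl hv t ht. apply sqr_le_abs; [lra|].
    replace (v 0 ^ 2) with (v 0 ^ 2 + 0 ^ 2) by ring.
    apply (gronwall v (fun r => cut_field A (shift B l) 1 r (v r)) L 0); auto; try lra.
    - unfold L; lra.
    - intros r hr. rewrite Rplus_0_r, <- (Rminus_0_r (cut_field _ _ _ _ _)).
      rewrite <- (Rminus_0_r (v r)) at 2.
      replace 0 with (cut_field A (shift B l) 1 r 0) at 1
        by (unfold cut_field; rewrite clip_id by lra; ring).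
      apply cut_field_lipschitz; auto; [lra|]. apply shift_bound; auto. apply Rabs_le; lra. }
  (* For |x| <= 1/D solutions stay below the cut-off 1, and int A v is at most int f. *)
  set (D := C * (1 + T * KA / J f)).
  assert (hTK : 0 < T * KA / J f).
  { apply Rdiv_lt_0_compat; auto. apply Rmult_lt_0_compat; auto. }
  assert (hD : 0 < D) by (apply Rmult_lt_0_compat; lra).
  exists (/ D). split; [apply Rinv_0_lt_compat; auto|]. intros x hx.
  assert (hxD : x * C * (1 + T * KA / J f) <= 1).
  { rewrite Rmult_assoc. fold D. apply Rle_trans with (/ D * D); [nra|].
    rewrite Rinv_l; lra. }
  assert (hxC : 0 < x * C) by (apply Rmult_lt_0_compat; lra).
  assert (hxC1 : x * C <= 1) by nra.
  assert (hxCT : T * (KA * (x * C)) <= J f).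
  { assert (x * C * (T * KA / J f) <= 1) by nra.
    apply Rmult_le_compat_r with (r := J f) in H; [|lra].
    replace (x * C * (T * KA / J f) * J f) with (T * (KA * (x * C))) in H by (field; lra).
    lra. }
  assert (hgen : forall l v, -1 <= l <= 1 -> cut_sol A (shift B l) 1 v -> v 0 = x ->
    sol A (shift B l) v /\ (on_I t, Rabs (v t) <= 1) /\ 0 < v T /\
    Rabs (/ x - / v T - l * J f) <= J f).
  { intros l v hl hv h0. assert (hb := hsmall l v hl hv). rewrite h0 in hb.
    rewrite (Rabs_pos_eq x) in hb by lra.
    assert (hv1 : on_I t, Rabs (v t) <= 1).
    { intros t ht; generalize (hb t ht); lra. }
    assert (hs : sol A (shift B l) v) by (apply cut_sol_sol with 1; auto).
    assert (hvc : cts v) by eauto with cts.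
    split; [auto|split; [auto|split]].
    - apply (cut_sol_pos A (shift B l) 1); auto with cts; lra.
    - rewrite <- h0. rewrite <- (sol_inverse A (shift B l) v T) by (auto with cts; lra).
      fold (J (fun s => A s * v s + shift B l s)).
      rewrite J_plus, J_shift, hJB by auto with cts.
      replace (_ + (0 + l * J f) - l * J f) with (J (fun t => A t * v t)) by ring.
      apply Rle_trans with (2 := hxCT). apply J_abs_le; auto with cts.
      intros t ht. rewrite Rabs_mult. apply Rmult_le_compat; auto using Rabs_pos. }
  assert (hix : 0 < / x) by (apply Rinv_0_lt_compat; lra).
  destruct (cut_sol_shooting A B 1 x (-1) 1) as (l & v & hl & hv & hv0 & hvT); auto; try lra.
  - intros v hv h0. destruct (hgen (-1) v ltac:(lra) hv h0) as (_ & _ & hp & hb).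
    apply Rabs_le_between in hb. assert (h : / x <= / v T) by lra.
    apply Rinv_le_contravar in h; auto. rewrite !Rinv_inv in h; auto.
  - intros v hv h0. destruct (hgen 1 v ltac:(lra) hv h0) as (_ & _ & hp & hb).
    apply Rabs_le_between in hb. assert (h : / v T <= / x) by lra.
    apply Rinv_le_contravar in h; [|apply Rinv_0_lt_compat; auto].
    rewrite !Rinv_inv in h; auto.
  - exists l, v. destruct (hgen l v hl hv hv0) as (hs & h1 & _). auto.
Qed.

(** * Closed members of the family *)

(** For a nonzero closed solution the mean condition is automatic (it integrates
    (-1/v)'); for the zero solution, closed at every parameter, it selects the
    parameter at which the curve of closed solutions passes through 0. *)
Definition cycle (A B : R -> R) (l : R) (v : R -> R) : Prop :=
  sol A (shift B l) v /\ v T = v 0 /\ J (fun t => A t * v t + shift B l t) = 0.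

Lemma cycle_of_closed A B l v :
  cts A -> cts B -> sol A (shift B l) v -> v T = v 0 -> v 0 <> 0 -> cycle A B l v.
Proof.
  intros hA hB hv e h0. split; [auto|split; [auto|]].
  unfold J. rewrite sol_inverse; auto with cts; [|lra]. rewrite e; ring.
Qed.

Lemma sol_zero A B : sol A B (fun _ => 0).
Proof.
  intros t ht. eapply is_derive_eq; [apply @is_derive_const|]. unfold zero; simpl; ring.
Qed.

Lemma cycle_zero A B l : J (shift B l) = 0 -> cycle A B l (fun _ => 0).
Proof.
  intros e. split; [apply sol_zero|split; [reflexivity|]].
  transitivity (J (shift B l)); [apply J_ext; intros; ring|exact e].
Qed.

Lemma cycle_rebase A B l l0 v : cycle A B l v -> cycle A (shift B l0) (l - l0) v.
Proof.
  assert (e : forall t, shift B l t = shift (shift B l0) (l - l0) t)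
    by (intros; unfold shift; ring).
  intros (hv & hT' & hm). split; [|split; auto].
  - apply (sol_ext A (shift B l)); auto.
  - transitivity (J (fun t => A t * v t + shift B l t)); [|exact hm].
    apply J_ext. intros. rewrite e; ring.
Qed.

Lemma cycle_base A B l0 v : cycle A B l0 v -> sol A (shift B l0) v /\ v T = v 0.
Proof. intros (h1 & h2 & _); auto. Qed.

Lemma inverse_gap x y : x <> 0 -> y <> 0 -> x - y = - (y * x * (/ x - / y)).
Proof. intros; field; auto. Qed.

Lemma inverse_gap_estimate x y : y <> 0 -> Rabs (x - y) < Rabs y / 2 ->
  x <> 0 /\ / x - / y = - ((x - y) * / (x * y)) /\ 0 < x * y /\
  Rabs (/ x - / y) <= 2 / y ^ 2 * Rabs (x - y).
Proof.
  intros hy h.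
  assert (hxy : 0 < x * y /\ y ^ 2 <= 2 * (x * y)).
  { unfold Rabs in h. repeat destruct Rcase_abs in h; split; nra. }
  assert (hx : x <> 0) by (intros e; rewrite e in hxy; lra).
  assert (e : / x - / y = - ((x - y) * / (x * y))) by (field; auto).
  assert (hy2 : 0 < y ^ 2) by (apply pow2_gt_0; auto).
  split; [auto|split; [auto|split; [lra|]]].
  rewrite e, Rabs_Ropp, Rabs_mult, Rmult_comm. apply Rmult_le_compat_r; [apply Rabs_pos|].
  rewrite Rabs_pos_eq by (left; apply Rinv_0_lt_compat; lra).
  replace (2 / y ^ 2) with (/ (y ^ 2 / 2)) by (field; auto).
  apply Rinv_le_contravar; lra.
Qed.

Lemma inverse_gap_small y h : y <> 0 -> 0 < h ->
  exists d, 0 < d /\ forall x, 0 < Rabs (x - y) < d ->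
  x <> 0 /\ / x - / y = - ((x - y) * / (x * y)) /\ 0 < x * y /\
  0 < Rabs (/ x - / y) < h.
Proof.
  intros h0 hh.
  assert (hr : 0 < Rabs y / 2) by (generalize (Rabs_pos_lt _ h0); lra).
  assert (hy2 : 0 < y ^ 2) by (apply pow2_gt_0; auto).
  exists (Rmin (Rabs y / 2) (h * (y ^ 2 / 2))).
  split; [apply Rmin_pos; auto; apply Rmult_lt_0_compat; lra|]. intros x [hx0 hx].
  assert (h1 := Rmin_l (Rabs y / 2) (h * (y ^ 2 / 2))).
  assert (h2 := Rmin_r (Rabs y / 2) (h * (y ^ 2 / 2))).
  destruct (inverse_gap_estimate x y h0 ltac:(lra)) as (hx' & e & hp & hle).
  split; [auto|split; [auto|split; [auto|split]]].
  - apply Rabs_pos_lt. rewrite e. intros e2.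
    assert (e3 : (x - y) * / (x * y) = 0) by lra.
    apply Rmult_integral in e3. destruct e3 as [e3|e3].
    + rewrite e3, Rabs_R0 in hx0; lra.
    + generalize (Rinv_0_lt_compat _ hp); lra.
  - apply Rle_lt_trans with (1 := hle).
    apply Rlt_le_trans with (2 / y ^ 2 * (h * (y ^ 2 / 2))).
    + apply Rmult_lt_compat_l; [apply Rdiv_lt_0_compat|]; lra.
    + right; field; auto.
Qed.

Lemma one_minus_exp_sign x : x <> 0 -> 0 < x * (1 - exp (- x)).
Proof.
  intros h. destruct (Rdichotomy x 0 h) as [hx|hx].
  - assert (exp 0 < exp (- x)) by (apply exp_increasing; lra). rewrite exp_0 in *. nra.
  - assert (exp (- x) < exp 0) by (apply exp_increasing; lra). rewrite exp_0 in *. nra.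
Qed.

Lemma opposite_sign_of_small_error a b e : Rabs e <= Rabs a / 2 -> b = a + e -> a <> 0 ->
  0 < a * b.
Proof.
  intros he -> h. unfold Rabs in *. repeat destruct Rcase_abs; nra.
Qed.

(** The logarithm of the derivative of the Poincare map at a nonzero closed solution u:
    the integral of 3 A u^2 + 2 B u, where A u^2 + B u = u'/u has mean 0. *)
Definition log_multiplier (A u : R -> R) : R := J (fun t => A t * u t ^ 2).

Definition growth (A u : R -> R) (t : R) : R := exp (prim (fun s => A s * u s ^ 2) t).

(** Minus the second-order coefficient, in the variable 1/x, of the displacement at a
    closed solution u where log_multiplier vanishes. *)
Definition curvature (A u : R -> R) : R := J (fun t => A t * u t ^ 3 * growth A u t).

Lemma growth_pos A u t : 0 < growth A u t.
Proof. apply exp_pos. Qed.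

Lemma growth_neq_0 A u t : growth A u t <> 0.
Proof. generalize (growth_pos A u t); lra. Qed.

Lemma growth_0 A u : growth A u 0 = 1.
Proof. unfold growth. rewrite prim_0. apply exp_0. Qed.

Lemma growth_T A u : log_multiplier A u = 0 -> growth A u T = 1.
Proof. unfold log_multiplier, J, growth. intros ->. apply exp_0. Qed.

Lemma cts_growth A u : cts A -> cts u -> cts (growth A u).
Proof. intros hA hu. unfold growth. auto 15 with cts. Qed.

Lemma cts_inv_growth A u : cts A -> cts u -> cts (fun t => / growth A u t).
Proof. intros hA hu. apply cts_inv; [apply cts_growth; auto|intros; apply growth_neq_0]. Qed.

Hint Resolve cts_growth cts_inv_growth : cts.

Lemma growth_derive A u t : cts A -> cts u -> 0 <= t <= T ->
  is_derive (growth A u) t (A t * u t ^ 2 * growth A u t).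
Proof.
  intros hA hu ht. assert (h : is_derive (prim (fun s => A s * u s ^ 2)) t (A t * u t ^ 2))
    by (apply (prim_derive (fun s => A s * u s ^ 2)); auto with cts).
  unfold growth. set (a := prim (fun s => A s * u s ^ 2)) in *.
  auto_derive; [eexists; exact h|]. rewrite_derive h. ring.
Qed.

Section Pair.

Variables A B : R -> R.
Hypothesis hA : cts A.
Hypothesis hB : cts B.

(** In the variable 1/x the difference of two solutions obeys a linear equation in which
    B only enters through the difference of the parameters. *)
Lemma inverse_difference u l v t :
  sol A B u -> sol A (shift B l) v -> u 0 <> 0 -> v 0 <> 0 -> 0 <= t <= T ->
  is_derive (fun s => / v s - / u s) t
    (A t * u t * v t * (/ v t - / u t) - l * f t).
Proof.
  intros hu hv hu0 hv0 ht.
  assert (hun := sol_nonzero A B u hA hB hu hu0 t ht).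
  assert (hvn := sol_nonzero A (shift B l) v hA (cts_shift B l hB) hv hv0 t ht).
  eapply is_derive_eq.
  - exact (is_derive_Rminus _ _ t _ _ (is_derive_Rinv v t _ (hv t ht) hvn)
      (is_derive_Rinv u t _ (hu t ht) hun)).
  - unfold shift. field; auto.
Qed.

Lemma inverse_difference_formula u l v t :
  sol A B u -> sol A (shift B l) v -> u 0 <> 0 -> v 0 <> 0 -> 0 <= t <= T ->
  (/ v t - / u t) * exp (- prim (fun s => A s * u s * v s) t) =
  (/ v 0 - / u 0) - l * prim (fun s => f s * exp (- prim (fun s => A s * u s * v s) s)) t.
Proof.
  intros hu hv hu0 hv0 ht.
  assert (hcu : cts u) by eauto with cts. assert (hcv : cts v) by eauto with cts.
  set (a := prim (fun s => A s * u s * v s)).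
  assert (hca : cts a) by (unfold a; auto 15 with cts).
  assert (h := linear_solution (fun s => / v s - / u s) (fun s => A s * u s * v s)
    (fun s => - l * f s)).
  cbv beta in h. fold a in h. rewrite h; auto with cts.
  - rewrite (prim_ext (fun s => - l * f s * exp (- a s))
      (fun s => - l * (f s * exp (- a s)))) by (intros; ring).
    rewrite prim_scal by auto with cts. ring.
  - intros s hs. eapply is_derive_eq; [apply (inverse_difference u l v); auto|ring].
Qed.

(** Multiplied by the integrating factor the difference of the inverses is monotone in time,
    with final value fixed by periodicity; so it stays of the size of its initial value, and
    so does l, which is proportional to its variation. *)
Lemma cycle_pair_bounds M :
  exists C, 0 < C /\ forall u l v,
    sol A B u -> u T = u 0 -> u 0 <> 0 -> cycle A B l v -> v 0 <> 0 ->
    (on_I t, Rabs (u t) <= M) ->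
    (on_I t, Rabs (v t) <= M) ->
    Rabs l <= C * Rabs (/ v 0 - / u 0) /\
    on_I t, Rabs (/ v t - / u t) <= C * Rabs (/ v 0 - / u 0).
Proof.
  destruct (cts_bounded A hA) as [KA [hKA bA]].
  assert (hJf := J_f_pos).
  set (K := T * (KA * M * M)). assert (hE := exp_pos K).
  assert (hE' : exp K * exp (- K) = 1) by (rewrite <- exp_plus, Rplus_opp_r, exp_0; auto).
  set (C1 := (1 + exp K) * exp K / J f).
  assert (hC1 : 0 < C1).
  { apply Rdiv_lt_0_compat; auto. apply Rmult_lt_0_compat; lra. }
  exists (C1 + (2 + exp K) * exp K). split.
  { assert (0 < (2 + exp K) * exp K) by (apply Rmult_lt_0_compat; lra). lra. }
  intros u l v hu huT hu0 (hv & hvT & _) hv0 bu bv.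
  assert (hcu : cts u) by eauto with cts. assert (hcv : cts v) by eauto with cts.
  set (a := prim (fun s => A s * u s * v s)).
  assert (hform := fun t => inverse_difference_formula u l v t hu hv hu0 hv0).
  fold a in hform.
  set (phi := prim (fun s => f s * exp (- a s))) in *.
  assert (ha : on_I t, Rabs (a t) <= K).
  { intros t ht. apply prim_abs_le; auto with cts. intros r hr.
    rewrite !Rabs_mult. repeat apply Rmult_le_compat; auto using Rabs_pos.
    apply Rmult_le_pos; apply Rabs_pos. }
  assert (hexp : forall x, Rabs x <= K -> exp (- K) <= exp x <= exp K).
  { intros x hx. apply Rabs_le_between in hx.
    split; apply exp_le_exp; lra. }
  assert (hcp : cts (fun s => f s * exp (- a s))) by (unfold a; auto 15 with cts).
  assert (hphi : on_I t, 0 <= phi t <= phi T).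
  { assert (hd : forall s t, 0 <= s -> s <= t -> t <= T -> phi s <= phi t).
    { intros s t h1 h2 h3.
      apply (derive_nonneg_incr phi (fun s => f s * exp (- a s))); auto.
      - intros r hr. apply (prim_derive (fun s => f s * exp (- a s))); auto; lra.
      - intros r hr. apply Rmult_le_pos; [left; apply hfpos; lra|left; apply exp_pos]. }
    intros t ht. split; [|apply hd; lra].
    rewrite <- (prim_0 (fun s => f s * exp (- a s))). apply hd; lra. }
  assert (hphiT : exp (- K) * J f <= phi T).
  { rewrite <- J_scal by auto.
    assert (0 <= J (fun t => f t * exp (- a t) - exp (- K) * f t)).
    { apply J_nonneg; auto with cts. intros r hr.
      assert (h1 := hexp (- a r)). rewrite Rabs_Ropp in h1. specialize (h1 (ha r hr)).
      generalize (hfpos r hr). nra. }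
    rewrite J_minus in H by auto with cts. unfold phi. unfold J at 1 in H. lra. }
  set (d0 := / v 0 - / u 0) in *.
  assert (hlphi : l * phi T = d0 * (1 - exp (- a T))).
  { specialize (hform T ltac:(lra)). rewrite hvT, huT in hform. fold d0 in hform. lra. }
  assert (haT := hexp (- a T)). rewrite Rabs_Ropp in haT. specialize (haT (ha T ltac:(lra))).
  assert (hlphi' : Rabs l * phi T <= Rabs d0 * (1 + exp K)).
  { rewrite <- (Rabs_pos_eq (phi T)) by (apply hphi; lra).
    rewrite <- Rabs_mult, hlphi, Rabs_mult. apply Rmult_le_compat_l; [apply Rabs_pos|].
    apply Rabs_le. generalize (exp_pos (- a T)); lra. }
  assert (hd0 := Rabs_pos d0).
  assert (hl : Rabs l <= C1 * Rabs d0).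
  { assert (h1 : Rabs l * (exp (- K) * J f) <= Rabs d0 * (1 + exp K)).
    { apply Rle_trans with (2 := hlphi'). apply Rmult_le_compat_l; auto. apply Rabs_pos. }
    apply Rmult_le_compat_r with (r := exp K / J f) in h1;
      [|left; apply Rdiv_lt_0_compat; auto].
    replace (Rabs l * (exp (- K) * J f) * (exp K / J f)) with
      (Rabs l * (exp K * exp (- K))) in h1 by (field; lra).
    rewrite hE', Rmult_1_r in h1. unfold C1.
    replace ((1 + exp K) * exp K / J f * Rabs d0) with
      (Rabs d0 * (1 + exp K) * (exp K / J f)) by (field; lra). exact h1. }
  assert (0 < (2 + exp K) * exp K) by (apply Rmult_lt_0_compat; lra).
  split; [nra|]. intros t ht.
  apply Rle_trans with ((2 + exp K) * exp K * Rabs d0); [|nra].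
  assert (hg : Rabs ((/ v t - / u t) * exp (- a t)) <= (2 + exp K) * Rabs d0).
  { rewrite hform by auto. fold phi. apply Rle_trans with (1 := Rabs_triang _ _).
    rewrite Rabs_Ropp, Rabs_mult.
    assert (Rabs l * Rabs (phi t) <= Rabs l * phi T).
    { apply Rmult_le_compat_l; [apply Rabs_pos|]. rewrite Rabs_pos_eq; apply hphi; lra. }
    lra. }
  rewrite Rabs_mult, (Rabs_pos_eq (exp (- a t))) in hg by (left; apply exp_pos).
  assert (h1 := hexp (- a t)). rewrite Rabs_Ropp in h1. specialize (h1 (ha t ht)).
  assert (h2 : Rabs (/ v t - / u t) * exp (- K) <= (2 + exp K) * Rabs d0).
  { apply Rle_trans with (2 := hg). apply Rmult_le_compat_l; [apply Rabs_pos|lra]. }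
  apply Rmult_le_compat_r with (r := exp K) in h2; [|lra].
  rewrite Rmult_assoc, (Rmult_comm (exp (- K))), hE' in h2. lra.
Qed.

Ltac factorwise :=
  repeat first [assumption | apply Rabs_pos | apply Rle_refl | apply Rmult_le_compat | apply Rmult_le_pos
               | solve [auto]].

(** Dividing by growth A u removes the linear part of the equation of 1/v - 1/u; what
    remains is quadratic in the difference, up to the forcing by l, and integrates to the
    second-order coefficient. *)
Lemma inverse_displacement_expansion u M C :
  sol A B u -> u T = u 0 -> u 0 <> 0 -> log_multiplier A u = 0 ->
  (on_I t, Rabs (u t) <= M) -> 0 < C ->
  exists C', 0 < C' /\ forall l v,
    sol A (shift B l) v -> v 0 <> 0 ->
    (on_I t, Rabs (v t) <= M) ->
    (on_I t, Rabs (/ v t - / u t) <= C * Rabs (/ v 0 - / u 0)) ->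
    Rabs ((/ v T - / u T) - (/ v 0 - / u 0) + l * J (fun t => f t / growth A u t)
          + (/ v 0 - / u 0) ^ 2 * curvature A u)
    <= C' * (Rabs (/ v 0 - / u 0) ^ 3 + Rabs l * Rabs (/ v 0 - / u 0)).
Proof.
  intros hu huT hu0 hsing bu hC.
  destruct (cts_bounded A hA) as [KA [hKA bA]].
  destruct (cts_bounded f hf) as [Kf [hKf bf]].
  assert (hM : 0 < M).
  { apply Rlt_le_trans with (2 := bu 0 ltac:(lra)). apply Rabs_pos_lt; auto. }
  assert (hcu : cts u) by eauto with cts.
  set (E := growth A u). assert (hEne : forall t, E t <> 0) by apply growth_neq_0.
  assert (hcE : cts E) by (apply cts_growth; auto).
  assert (hcEi : cts (fun t => / E t)) by (apply cts_inv; auto).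
  assert (hET : E T = 1) by (apply growth_T; auto).
  assert (hE0 : E 0 = 1) by apply growth_0.
  set (X := exp (T * (KA * M ^ 2))). assert (hX : 0 < X) by apply exp_pos.
  assert (hE : on_I t, 0 < E t <= X /\ / E t <= X).
  { intros t ht. assert (h : Rabs (prim (fun s => A s * u s ^ 2) t) <= T * (KA * M ^ 2)).
    { apply prim_abs_le; auto with cts. intros r hr. rewrite Rabs_mult, <- RPow_abs.
      apply Rmult_le_compat; auto using Rabs_pos; [apply pow_le, Rabs_pos|].
      apply pow_incr; auto using Rabs_pos. }
    apply Rabs_le_between in h. unfold E, growth.
    rewrite <- exp_Ropp. split; [split; [apply exp_pos|]|]; apply exp_le_exp; lra. }
  (* C1 comes from the bound on the derivative r of d/E, and C2 from the one on the error
     integrand w, both below. *)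
  set (C1 := (KA * M ^ 3 * C ^ 2 + Kf) * X).
  set (C2 := KA * M ^ 2 * (M ^ 2 * C ^ 3 * X + M * X * (T * C1 * (C * X + 1)))).
  assert (hM2 := pow_lt M 2 hM). assert (hM3 := pow_lt M 3 hM).
  assert (hC_2 := pow_lt C 2 hC). assert (hC_3 := pow_lt C 3 hC).
  assert (hKM3 : 0 < KA * M ^ 3 * C ^ 2)
    by (apply Rmult_lt_0_compat; [apply Rmult_lt_0_compat|]; auto).
  assert (hC1 : 0 < C1) by (apply Rmult_lt_0_compat; lra).
  assert (hCX : 0 < C * X) by (apply Rmult_lt_0_compat; auto).
  assert (hC2 : 0 < C2).
  { unfold C2. repeat (apply Rmult_lt_0_compat || apply Rplus_lt_0_compat); auto; lra. }
  exists (T * C2). split; [apply Rmult_lt_0_compat; auto|].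
  intros l v hv hv0 bv bd.
  assert (hcv : cts v) by eauto with cts.
  assert (hun := sol_nonzero A B u hA hB hu hu0).
  assert (hvn := sol_nonzero A (shift B l) v hA (cts_shift B l hB) hv hv0).
  set (d := fun t => / v t - / u t) in *.
  change (/ v T - / u T) with (d T). change (/ v 0 - / u 0) with (d 0) in *.
  change (on_I t, Rabs (d t) <= C * Rabs (d 0)) in bd.
  assert (hcd : cts d) by (unfold d; apply cts_minus; apply cts_inv; auto).
  assert (hgap : on_I t, Rabs (v t - u t) <= M ^ 2 * (C * Rabs (d 0))).
  { intros t ht. rewrite inverse_gap by auto. rewrite Rabs_Ropp, Rabs_mult.
    change (/ v t - / u t) with (d t).
    apply Rmult_le_compat; auto using Rabs_pos.
    rewrite Rabs_mult. simpl. rewrite Rmult_1_r. apply Rmult_le_compat; auto using Rabs_pos. }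
  set (e := Rabs (d 0)) in *. assert (he : 0 <= e) by apply Rabs_pos.
  set (r := fun t => (A t * u t * (v t - u t) * d t - l * f t) / E t).
  assert (hcr : cts r) by (unfold r, Rdiv; auto 15 with cts).
  assert (hdE : on_I t, is_derive (fun s => d s * / E s) t (r t)).
  { intros t ht. eapply is_derive_eq.
    - apply is_derive_Rmult; [apply (inverse_difference u l v); auto|].
      apply is_derive_Rinv; [apply growth_derive|]; auto.
    - fold E. unfold r, d. field. repeat split; auto. }
  assert (hr : on_I t, Rabs (r t) <= C1 * (e ^ 2 + Rabs l)).
  { intros t ht. unfold r, Rdiv. rewrite Rabs_mult.
    rewrite (Rabs_pos_eq (/ E t)) by (left; apply Rinv_0_lt_compat, hE, ht).
    assert (h1 : Rabs (A t * u t * (v t - u t) * d t - l * f t) <=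
      KA * M * (M ^ 2 * (C * e)) * (C * e) + Rabs l * Kf).
    { apply Rle_trans with (1 := Rabs_triang _ _). rewrite Rabs_Ropp, !Rabs_mult.
      apply Rplus_le_compat;
        factorwise. }
    apply Rle_trans with ((KA * M * (M ^ 2 * (C * e)) * (C * e) + Rabs l * Kf) * X).
    - apply Rmult_le_compat; auto using Rabs_pos.
      + left; apply Rinv_0_lt_compat, hE, ht.
      + apply hE, ht.
    - unfold C1. assert (0 <= Kf * e ^ 2 * X + KA * M ^ 3 * C ^ 2 * Rabs l * X).
      { generalize (pow2_ge_0 e) (Rabs_pos l); intros.
        apply Rplus_le_le_0_compat; repeat apply Rmult_le_pos; lra. }
      lra. }
  assert (hdel : on_I t,
    Rabs (d t / E t - d 0) <= T * (C1 * (e ^ 2 + Rabs l))).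
  { intros t ht. replace (d t / E t - d 0) with (prim r t).
    - apply prim_abs_le; auto.
    - rewrite (prim_ftc (fun s => d s * / E s) r t) by auto. rewrite hE0. unfold Rdiv. lra. }
  assert (hJr : J r = d T - d 0).
  { rewrite (J_ftc (fun s => d s * / E s) r) by auto. rewrite hE0, hET. lra. }
  assert (hcf : cts (fun t => f t / E t)) by (unfold Rdiv; auto with cts).
  assert (hcq : cts (fun t => A t * u t ^ 3 * E t)) by auto 15 with cts.
  set (w := fun t => A t * u t * (v t - u t) * d t / E t + d 0 ^ 2 * (A t * u t ^ 3 * E t)).
  assert (hcw : cts w) by (unfold w, Rdiv; auto 15 with cts).
  replace (d T - d 0 + l * J (fun t => f t / E t) + d 0 ^ 2 * curvature A u)
    with (J w).
  2: { unfold curvature. fold E. rewrite <- hJr, <- !J_scal, <- !J_plus by auto with cts.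
       apply J_ext. intros t ht. unfold w, r. field. auto. }
  rewrite Rmult_assoc. apply J_abs_le; auto. intros t ht.
  assert (hdt : d t = - ((v t - u t) * / (u t * v t))).
  { unfold d. field. auto. }
  replace (w t) with (A t * u t ^ 2 *
    (- (v t - u t) * (d t * d t * / E t) +
     - (u t * E t * ((d t / E t - d 0) * (d t / E t + d 0))))).
  2: { unfold w. assert (hg : v t - u t = - (u t * v t * d t)) by (rewrite hdt; field; auto).
       replace (A t * u t * (v t - u t) * d t) with (A t * u t * - (u t * v t * d t) * d t)
         by (rewrite <- hg; ring).
       field. auto. }
  rewrite Rabs_mult, Rabs_mult, <- RPow_abs.
  apply Rle_trans with (KA * M ^ 2 *
    (M ^ 2 * (C * e) * (C * e * (C * e) * X) +
     M * X * (T * (C1 * (e ^ 2 + Rabs l)) * (C * e * X + e)))).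
  - apply Rmult_le_compat; auto using Rabs_pos.
    + apply Rmult_le_pos; [apply Rabs_pos|apply pow_le, Rabs_pos].
    + apply Rmult_le_compat; auto using Rabs_pos; [apply pow_le, Rabs_pos|].
      apply pow_incr; auto using Rabs_pos.
    + assert (hEi : Rabs (/ E t) <= X).
      { rewrite Rabs_pos_eq; [apply hE, ht|left; apply Rinv_0_lt_compat, hE, ht]. }
      assert (hEE : Rabs (E t) <= X) by (rewrite Rabs_pos_eq; generalize (hE t ht); lra).
      apply Rle_trans with (1 := Rabs_triang _ _).
      rewrite Rabs_mult, !Rabs_Ropp, !Rabs_mult.
      assert (h1 : Rabs (d t / E t + d 0) <= C * e * X + e).
      { apply Rle_trans with (1 := Rabs_triang _ _). apply Rplus_le_compat; [|apply Rle_refl].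
        unfold Rdiv. rewrite Rabs_mult. apply Rmult_le_compat; auto using Rabs_pos. }
      assert (h2 := bd t ht). assert (h3 := hdel t ht). assert (h4 := hgap t ht).
      assert (h5 := bu t ht).
      apply Rplus_le_compat; factorwise.
  - assert (0 <= Rabs l) by apply Rabs_pos.
    assert (0 <= e ^ 3) by (apply pow_le; auto).
    assert (0 <= KA * M ^ 2 * (M ^ 2 * C ^ 3 * X) * (Rabs l * e)).
    { repeat apply Rmult_le_pos; lra. }
    unfold C2. nra.
Qed.

(** By the exact formula for periodic differences, l times a positive integral is the
    initial difference times 1 - exp(-a), where a = int A u v is close to log_multiplier:
    the parameter is strictly monotone in the initial value. *)
Lemma parameter_near_simple_cycle u M :
  sol A B u -> u T = u 0 -> u 0 <> 0 -> log_multiplier A u <> 0 ->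
  (on_I t, Rabs (u t) <= M) ->
  exists h, 0 < h /\ forall l v, cycle A B l v -> v 0 <> 0 ->
    (on_I t, Rabs (v t) <= M) ->
    0 < Rabs (/ v 0 - / u 0) < h ->
    0 < log_multiplier A u * l * (/ v 0 - / u 0).
Proof.
  intros hu huT hu0 hk bu. set (k := log_multiplier A u) in *.
  destruct (cts_bounded A hA) as [KA [hKA bA]].
  assert (hM : 0 < M).
  { apply Rlt_le_trans with (2 := bu 0 ltac:(lra)). apply Rabs_pos_lt; auto. }
  destruct (cycle_pair_bounds M) as [C [hC hpair]].
  set (D := T * (KA * M * (M * M * C))).
  assert (hD : 0 < D) by (unfold D; repeat apply Rmult_lt_0_compat; auto).
  assert (hk' : 0 < Rabs k) by (apply Rabs_pos_lt; auto).
  exists (Rabs k / (2 * D)). split; [apply Rdiv_lt_0_compat; lra|].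
  intros l v hcv hv0 bv hd. destruct (hpair u l v) as [_ bd]; auto.
  destruct hcv as (hv & hvT & _).
  assert (hcu : cts u) by eauto with cts. assert (hcv : cts v) by eauto with cts.
  assert (hun := sol_nonzero A B u hA hB hu hu0).
  assert (hvn := sol_nonzero A (shift B l) v hA (cts_shift B l hB) hv hv0).
  assert (hform := inverse_difference_formula u l v T hu hv hu0 hv0 ltac:(lra)).
  rewrite hvT, huT in hform.
  set (d0 := / v 0 - / u 0) in *.
  set (a := J (fun s => A s * u s * v s)). fold (J (fun s => A s * u s * v s)) in hform.
  fold a in hform.
  set (b := prim (fun s => A s * u s * v s)) in *.
  set (phi := prim (fun s => f s * exp (- b s)) T) in *.
  assert (hcb : cts b) by (unfold b; auto 15 with cts).
  assert (hphi : 0 < phi).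
  { apply (J_pos (fun s => f s * exp (- b s))); auto with cts.
    intros r hr. apply Rmult_lt_0_compat; [apply hfpos; lra|apply exp_pos]. }
  assert (hab : 0 < k * a).
  { apply (opposite_sign_of_small_error k a (a - k)); auto; [|ring].
    unfold a, k, log_multiplier. rewrite <- J_minus by auto with cts.
    apply Rle_trans with (D * Rabs d0).
    - unfold D. rewrite Rmult_assoc. apply J_abs_le; auto with cts. intros t ht.
      replace (A t * u t * v t - A t * u t ^ 2) with (A t * u t * (v t - u t)) by ring.
      rewrite (inverse_gap (v t)), !Rabs_mult, Rabs_Ropp, !Rabs_mult by auto.
      apply Rle_trans with (KA * M * (M * M * (C * Rabs d0))); [factorwise|right; ring].
    - destruct hd as [_ hd]. apply Rmult_lt_compat_l with (r := D) in hd; auto.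
      replace (D * (Rabs k / (2 * D))) with (Rabs k / 2) in hd by (field; lra).
      unfold k, log_multiplier in hd. lra. }
  assert (ha0 : a <> 0) by (intros e; rewrite e, Rmult_0_r in hab; lra).
  assert (hs := one_minus_exp_sign a ha0).
  assert (hl : l * phi = d0 * (1 - exp (- a))) by lra.
  assert (hd2 : 0 < d0 ^ 2) by (rewrite <- pow2_abs; apply pow_lt; lra).
  assert (h1 : 0 < (k * l * d0) * (phi * a ^ 2)).
  { replace (k * l * d0 * (phi * a ^ 2)) with ((k * a) * (a * (l * phi) * d0)) by ring.
    rewrite hl. replace (a * (d0 * (1 - exp (- a))) * d0) with
      (d0 ^ 2 * (a * (1 - exp (- a)))) by ring.
    apply Rmult_lt_0_compat; [exact hab|apply Rmult_lt_0_compat; [exact hd2|exact hs]]. }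
  assert (0 < phi * a ^ 2) by (apply Rmult_lt_0_compat; auto; apply pow2_gt_0; auto).
  nra.
Qed.

(** For a periodic difference the expansion leaves the term in l and the quadratic term,
    which must have opposite signs: the parameter has a strict local extremum, of a type
    decided by the curvature. *)
Lemma parameter_near_singular_cycle u M :
  sol A B u -> u T = u 0 -> u 0 <> 0 -> log_multiplier A u = 0 -> curvature A u <> 0 ->
  (on_I t, Rabs (u t) <= M) ->
  exists h, 0 < h /\ forall l v, cycle A B l v -> v 0 <> 0 ->
    (on_I t, Rabs (v t) <= M) ->
    0 < Rabs (/ v 0 - / u 0) < h -> l * curvature A u < 0.
Proof.
  intros hu huT hu0 hk hQ bu.
  destruct (cycle_pair_bounds M) as [C [hC hpair]].
  destruct (inverse_displacement_expansion u M C hu huT hu0 hk bu hC) as [C' [hC' hexp]].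
  set (Q := curvature A u) in *. set (F := J (fun t => f t / growth A u t)) in *.
  assert (hcu : cts u) by eauto with cts.
  assert (hF : 0 < F).
  { apply J_pos; [unfold Rdiv; auto with cts|].
    intros t ht. apply Rdiv_lt_0_compat; [apply hfpos; lra|apply growth_pos]. }
  assert (hQ' : 0 < Rabs Q) by (apply Rabs_pos_lt; auto).
  exists (Rmin F (Rabs Q) / (2 * C')).
  assert (hm : 0 < Rmin F (Rabs Q)) by (apply Rmin_pos; auto).
  split; [apply Rdiv_lt_0_compat; lra|].
  intros l v hcv hv0 bv hd. destruct (hpair u l v) as [_ bd]; auto.
  destruct hcv as (hv & hvT & _).
  specialize (hexp l v hv hv0 bv bd). rewrite hvT, huT, Rminus_diag, Rplus_0_l in hexp.
  set (d0 := / v 0 - / u 0) in *. set (e := Rabs d0) in *.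
  assert (he : C' * e < Rmin F (Rabs Q) / 2).
  { destruct hd as [_ hd]. apply Rmult_lt_compat_l with (r := C') in hd; auto.
    replace (C' * (Rmin F (Rabs Q) / (2 * C'))) with (Rmin F (Rabs Q) / 2) in hd
      by (field; lra). exact hd. }
  assert (hmF := Rmin_l F (Rabs Q)). assert (hmQ := Rmin_r F (Rabs Q)).
  destruct (Rlt_or_le (l * Q) 0) as [|hlQ]; auto. exfalso.
  (* With equal signs the two main terms could not cancel. *)
  assert (hsum : Rabs (l * F + d0 ^ 2 * Q) = Rabs l * F + e ^ 2 * Rabs Q).
  { unfold e. rewrite pow2_abs. generalize (pow2_ge_0 d0); intros.
    unfold Rabs. repeat destruct Rcase_abs; nra. }
  rewrite hsum in hexp.
  assert (hl := Rabs_pos l).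
  assert (he2 : 0 < e ^ 2) by (apply pow_lt; lra).
  replace (C' * (e ^ 3 + Rabs l * e)) with (C' * e * e ^ 2 + C' * e * Rabs l) in hexp by ring.
  assert (C' * e * e ^ 2 <= Rabs Q / 2 * e ^ 2) by (apply Rmult_le_compat_r; lra).
  assert (C' * e * Rabs l <= F / 2 * Rabs l) by (apply Rmult_le_compat_r; lra).
  assert (0 < Rabs Q / 2 * e ^ 2) by (apply Rmult_lt_0_compat; lra).
  assert (0 <= F / 2 * Rabs l) by (apply Rmult_le_pos; lra). lra.
Qed.

(** The expansion for l = 0, which excludes zeros of multiplicity three of the
    displacement when the curvature is nonzero. *)
Lemma displacement_near_singular_cycle u M :
  sol A B u -> u T = u 0 -> u 0 <> 0 -> log_multiplier A u = 0 ->
  (on_I t, Rabs (u t) <= M) ->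
  exists C, 0 < C /\ forall v, sol A B v -> v 0 <> 0 ->
    (on_I t, Rabs (v t) <= M) ->
    Rabs (/ v T - / v 0 + (/ v 0 - / u 0) ^ 2 * curvature A u) <= C * Rabs (/ v 0 - / u 0) ^ 3.
Proof.
  intros hu huT hu0 hk bu.
  destruct (cts_bounded A hA) as [KA [hKA bA]].
  set (X := exp (T * (KA * M * M))). assert (hX : 0 < X) by apply exp_pos.
  destruct (inverse_displacement_expansion u M X hu huT hu0 hk bu hX) as [C [hC hexp]].
  exists C; split; auto. intros v hv hv0 bv.
  assert (hv' : sol A (shift B 0) v).
  { apply (sol_ext A B); auto. intros; unfold shift; ring. }
  specialize (hexp 0 v hv' hv0 bv).
  rewrite Rabs_R0, !Rmult_0_l, !Rplus_0_r, huT in hexp.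
  replace (/ v T - / u 0 - (/ v 0 - / u 0)) with (/ v T - / v 0) in hexp by ring.
  apply hexp. intros t ht.
  assert (hcu : cts u) by eauto with cts. assert (hcv : cts v) by eauto with cts.
  assert (h := inverse_difference_formula u 0 v t hu hv' hu0 hv0 ht).
  set (a := prim (fun s => A s * u s * v s) t) in h.
  replace (/ v t - / u t) with ((/ v t - / u t) * exp (- a) * exp a)
    by (rewrite Rmult_assoc, <- exp_plus, Rplus_opp_l, exp_0; ring).
  rewrite h, Rmult_0_l, Rminus_0_r, Rabs_mult, Rmult_comm.
  apply Rmult_le_compat_r; [apply Rabs_pos|].
  rewrite Rabs_pos_eq by (left; apply exp_pos). apply exp_le_exp.
  apply Rle_trans with (1 := Rle_abs a). apply prim_abs_le; auto with cts.
  intros r hr. rewrite !Rabs_mult. factorwise.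
Qed.

(** At the zero solution, where inverses are not available, l is read off from the
    mean condition l (int f) = - int A v by expanding v in powers of v(0). *)
Lemma parameter_near_zero M :
  J B = 0 -> 0 < M -> exists C, 0 < C /\ forall l v,
    cycle A B l v -> (on_I t, Rabs (v t) <= M) ->
    Rabs l <= C * Rabs (v 0) /\
    Rabs (l * J f + v 0 * J A) <= C * Rabs (v 0) ^ 2 /\
    (J A = 0 -> Rabs (l * J f + v 0 ^ 2 * J (fun t => A t * prim B t))
                <= C * Rabs (v 0) ^ 3).
Proof.
  intros hJB hM.
  destruct (cts_bounded A hA) as [KA [hKA bA]]. destruct (cts_bounded B hB) as [KB [hKB bB]].
  destruct (cts_bounded f hf) as [Kf [hKf bf]]. assert (hJf := J_f_pos).
  (* L bounds |l|, G the shifted coefficient, X the quotient v/v(0), and S0 the primitive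
     of A v + B + l f. *)
  set (L := T * (KA * M) / J f).
  assert (hL : 0 < L) by (apply Rdiv_lt_0_compat; auto; repeat apply Rmult_lt_0_compat; auto).
  set (G := KB + L * Kf). assert (hG : 0 < G) by (unfold G; nra).
  set (X := exp (T * (KA * M ^ 2 + G * M))). assert (hX : 0 < X) by apply exp_pos.
  set (S0 := T * (KA * M + G)).
  assert (hS0 : 0 < S0).
  { apply Rmult_lt_0_compat; auto. generalize (Rmult_lt_0_compat KA M hKA hM); lra. }
  set (C1 := T * (KA * X) / J f).
  assert (hC1 : 0 < C1) by (apply Rdiv_lt_0_compat; auto; repeat apply Rmult_lt_0_compat; auto).
  set (C2 := T * (KA * (X * S0))).
  assert (hC2 : 0 < C2) by (unfold C2; repeat first [assumption | apply Rmult_lt_0_compat]).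
  set (C3 := T * (KA * (T * (KA * X + C1 * Kf) + X * S0 * S0))).
  assert (hC3 : 0 < C3).
  { assert (0 < KA * X) by (apply Rmult_lt_0_compat; auto).
    assert (0 < C1 * Kf) by (apply Rmult_lt_0_compat; auto).
    assert (0 < X * S0 * S0) by (repeat first [assumption | apply Rmult_lt_0_compat]).
    assert (0 < T * (KA * X + C1 * Kf)) by (apply Rmult_lt_0_compat; lra).
    unfold C3. apply Rmult_lt_0_compat; auto. apply Rmult_lt_0_compat; auto. lra. }
  exists (C1 + C2 + C3). split; [lra|].
  intros l v (hv & hvT & hmean) bv. assert (hcv : cts v) by eauto with cts.
  set (x := v 0) in *. assert (hx := Rabs_pos x).
  assert (hlJ : l * J f = - J (fun t => A t * v t)).
  { rewrite J_plus, J_shift, hJB in hmean by auto with cts. lra. }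
  assert (hlb : forall K, (on_I t, Rabs (v t) <= K) ->
    Rabs l <= T * (KA * K) / J f).
  { intros K hK. apply Rmult_le_reg_r with (J f); auto.
    replace (T * (KA * K) / J f * J f) with (T * (KA * K)) by (field; lra).
    rewrite <- (Rabs_pos_eq (J f)) at 1 by lra. rewrite <- Rabs_mult, hlJ, Rabs_Ropp.
    apply J_abs_le; auto with cts. intros t ht. rewrite Rabs_mult. factorwise. }
  assert (hl : Rabs l <= L) by (apply hlb; auto).
  assert (bG : on_I t, Rabs (shift B l t) <= G)
    by (intros; apply shift_bound; auto).
  assert (hcs : cts (shift B l)) by auto with cts.
  assert (hvx : on_I t, Rabs (v t) <= X * Rabs x).
  { intros t ht. rewrite (sol_exp A (shift B l) v hA hcs hv t ht), Rabs_mult, Rmult_comm.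
    apply Rmult_le_compat_r; auto. rewrite Rabs_pos_eq by (left; apply exp_pos).
    apply exp_le_exp, Rle_trans with (1 := Rle_abs _).
    apply prim_abs_le; auto 15 with cts. intros r hr.
    apply Rle_trans with (1 := Rabs_triang _ _). rewrite !Rabs_mult, <- RPow_abs.
    assert (0 <= Rabs (v r) ^ 2) by (apply pow_le, Rabs_pos).
    assert (Rabs (v r) ^ 2 <= M ^ 2) by (apply pow_incr; auto using Rabs_pos).
    apply Rplus_le_compat; factorwise. }
  assert (hl1 : Rabs l <= C1 * Rabs x).
  { unfold C1. apply Rle_trans with (1 := hlb _ hvx). right; field; lra. }
  set (S := prim (fun s => A s * v s + shift B l s)).
  assert (hcS : cts S) by (unfold S; auto 15 with cts).
  assert (hS : on_I t, Rabs (S t) <= S0).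
  { intros t ht. apply prim_abs_le; auto with cts. intros r hr.
    apply Rle_trans with (1 := Rabs_triang _ _). rewrite Rabs_mult.
    apply Rplus_le_compat; factorwise. }
  assert (hvS : on_I t, v t - x = x * v t * S t).
  { intros t ht. destruct (Req_dec x 0) as [e|h0].
    - generalize (hvx t ht). rewrite e, Rabs_R0, Rmult_0_r.
      unfold Rabs. destruct Rcase_abs; intros; assert (v t = 0) as -> by lra; ring.
    - unfold S. rewrite (sol_inverse A (shift B l) v t) by auto.
      fold x. field. split; auto.
      apply (sol_nonzero A (shift B l)); auto. }
  assert (hgap : on_I t, Rabs (v t - x) <= X * S0 * Rabs x ^ 2).
  { intros t ht. rewrite hvS, !Rabs_mult by auto.
    apply Rle_trans with (Rabs x * (X * Rabs x) * S0); [factorwise|right; ring]. }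
  assert (hJ1 : Rabs (l * J f + x * J A) <= C2 * Rabs x ^ 2).
  { rewrite hlJ. replace (_ + _) with (- J (fun t => A t * v t - x * A t))
      by (rewrite J_minus, J_scal by auto with cts; ring).
    rewrite Rabs_Ropp. unfold C2. rewrite Rmult_assoc. apply J_abs_le; auto with cts.
    intros t ht. replace (A t * v t - x * A t) with (A t * (v t - x)) by ring.
    rewrite Rabs_mult, Rmult_assoc. apply Rmult_le_compat; auto using Rabs_pos. }
  assert (hx2 := pow_le _ 2 hx). assert (hx3 := pow_le _ 3 hx).
  split; [nra|split; [nra|]]. intros hJA.
  apply Rle_trans with (C3 * Rabs x ^ 3); [|nra].
  rewrite hlJ.
  replace (_ + _) with (- J (fun t => (A t * v t - x * A t) - x ^ 2 * (A t * prim B t))).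
  2: { rewrite !J_minus, !J_scal, hJA by auto 15 with cts. ring. }
  rewrite Rabs_Ropp. unfold C3. rewrite Rmult_assoc. apply J_abs_le; auto 15 with cts.
  intros t ht.
  assert (hSB : Rabs (S t - prim B t) <= T * (KA * X + C1 * Kf) * Rabs x).
  { unfold S. rewrite <- prim_minus by auto with cts.
    rewrite Rmult_assoc. apply prim_abs_le; auto with cts. intros r hr.
    replace (A r * v r + shift B l r - B r) with (A r * v r + l * f r) by (unfold shift; ring).
    apply Rle_trans with (1 := Rabs_triang _ _). rewrite !Rabs_mult.
    apply Rle_trans with (KA * (X * Rabs x) + C1 * Rabs x * Kf); [|right; ring].
    apply Rplus_le_compat; factorwise. }
  replace (A t * v t - x * A t - x ^ 2 * (A t * prim B t)) with
    (A t * (x ^ 2 * (S t - prim B t) + x * (v t - x) * S t)).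
  2: { assert (e : v t - x = x ^ 2 * S t + x * (v t - x) * S t)
         by (rewrite (hvS t ht) at 1; ring).
       transitivity (A t * (x ^ 2 * S t + x * (v t - x) * S t - x ^ 2 * prim B t));
         [ring|rewrite <- e; ring]. }
  rewrite Rabs_mult, (Rmult_assoc KA). apply Rmult_le_compat; auto using Rabs_pos.
  apply Rle_trans with (1 := Rabs_triang _ _). rewrite !Rabs_mult, <- RPow_abs.
  apply Rle_trans with (Rabs x ^ 2 * (T * (KA * X + C1 * Kf) * Rabs x) +
    Rabs x * (X * S0 * Rabs x ^ 2) * S0); [|right; ring].
  apply Rplus_le_compat; factorwise.
Qed.

End Pair.

(** * Convexity of the curve of coefficients and the sign of the second-order terms *)

(** If p A and p B have mean 0, the primitives of p B and -p A draw a closed curve of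
    velocity p (B, -A).  The condition says that its starting point lies strictly on the
    side of the tangents prescribed by s, as it does for a convex curve oriented by s. *)
Definition area_sign (A B : R -> R) (s : R) : Prop :=
  forall p, cts p -> (on_I t, 0 < p t) ->
  J (fun t => p t * A t) = 0 -> J (fun t => p t * B t) = 0 ->
  forall t, 0 < t < T ->
  s * (A t * prim (fun r => p r * B r) t - B t * prim (fun r => p r * A r) t) < 0.

Lemma J_neg g : cts g -> (forall r, 0 < r < T -> g r < 0) -> J g < 0.
Proof.
  intros hg h. enough (0 < - J g) by lra.
  replace (- J g) with (-1 * J g) by ring. rewrite <- J_scal by auto.
  apply J_pos; auto with cts. intros r hr; generalize (h r hr); lra.
Qed.

(** With E = growth A u, the curve (u/E, 1/E) is closed and has velocity p (B, -A), where
    p = u^2/E; twice the curvature is the integral of the cross product of position,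
    relative to the starting point, and velocity, weighted by E^2. *)
Lemma singular_coefficient_sign A B u s :
  cts A -> cts B -> area_sign A B s ->
  sol A B u -> u T = u 0 -> u 0 <> 0 -> log_multiplier A u = 0 ->
  s * curvature A u < 0.
Proof.
  intros hA hB harea hu huT hu0 hsing.
  assert (hcu : cts u) by eauto with cts.
  assert (hun := sol_nonzero A B u hA hB hu hu0).
  unfold curvature. set (E := growth A u).
  assert (hE : forall t, 0 < E t) by apply growth_pos.
  assert (hEne : forall t, E t <> 0) by apply growth_neq_0.
  assert (hcE : cts E) by (apply cts_growth; auto).
  assert (hcEi : cts (fun t => / E t)) by (apply cts_inv; auto).
  assert (hET : E T = 1) by (apply growth_T; auto).
  assert (hE0 : E 0 = 1) by apply growth_0.
  assert (hEd := fun t => growth_derive A u t hA hcu). fold E in hEd.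
  set (p := fun t => u t ^ 2 / E t).
  assert (hcp : cts p) by (unfold p, Rdiv; auto with cts).
  assert (hp : on_I t, 0 < p t).
  { intros t ht. apply Rdiv_lt_0_compat; auto. apply pow2_gt_0; auto. }
  assert (hPA : on_I t, prim (fun r => p r * A r) t = 1 - / E t).
  { intros t ht. rewrite (prim_ftc (fun s => - / E s) (fun r => p r * A r) t); auto with cts.
    - rewrite hE0. field; auto.
    - intros r hr. eapply is_derive_eq; [apply @is_derive_opp, is_derive_Rinv; auto|].
      unfold p, opp; simpl. field; auto. }
  set (PB := prim (fun r => p r * B r)).
  assert (hPB : on_I t, PB t = u t / E t - u 0).
  { intros t ht. unfold PB.
    rewrite (prim_ftc (fun s => u s * / E s) (fun r => p r * B r) t); auto with cts.
    - rewrite hE0. unfold Rdiv; lra.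
    - intros r hr. eapply is_derive_eq.
      + apply is_derive_Rmult; [apply hu; auto|apply is_derive_Rinv; auto].
      + unfold p. field; auto. }
  assert (hneg := harea p hcp hp). unfold J at 1 2 in hneg.
  rewrite hPA, hET in hneg by lra. fold PB in hneg. rewrite hPB, hET, huT in hneg by lra.
  specialize (hneg ltac:(lra) ltac:(lra)).
  set (w := fun t => u t ^ 2 * E t * (A t * PB t - B t * (1 - / E t))).
  assert (hcPB : cts PB) by (unfold PB; auto with cts).
  assert (hcw : cts w) by (unfold w; auto 15 with cts).
  (* w is the weighted cross product; it differs from twice the integrand of the curvature
     by the derivative of (PB - u) E. *)
  assert (hI : J w - 2 * J (fun t => A t * u t ^ 3 * E t) = 0).
  { rewrite <- J_scal, <- J_minus by auto 15 with cts.
    rewrite (J_ftc (fun t => (PB t - u t) * E t)); auto 15 with cts.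
    - rewrite hE0, hET, huT, !hPB, hE0, hET, huT by lra. field.
    - intros t ht. eapply is_derive_eq.
      + apply is_derive_Rmult; [apply is_derive_Rminus|apply hEd; auto].
        * apply (prim_derive (fun r => p r * B r)); auto with cts.
        * apply hu; auto.
      + unfold w, p. field; auto. }
  assert (hlt : J (fun t => s * w t) < 0).
  { apply J_neg; auto with cts. intros t ht. specialize (hneg t ht).
    rewrite hPA in hneg by lra. unfold w.
    assert (0 < u t ^ 2 * E t).
    { apply Rmult_lt_0_compat; auto. apply pow2_gt_0, hun; lra. }
    replace (s * _) with (u t ^ 2 * E t * (s * (A t * PB t - B t * (1 - / E t)))) by ring.
    nra. }
  rewrite J_scal in hlt by auto. nra.
Qed.

(** The case p = 1, where the weight is constant and the area is that of the curve drawn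
    by the primitives of A and B. *)
Lemma zero_coefficient_sign A B s :
  cts A -> cts B -> area_sign A B s -> J A = 0 -> J B = 0 ->
  s * J (fun t => A t * prim B t) < 0.
Proof.
  intros hA hB harea hJA hJB.
  assert (e : forall g, cts g -> forall t, prim (fun r => 1 * g r) t = prim g t)
    by (intros; apply prim_ext; intros; ring).
  assert (hneg := harea (fun _ => 1) (cts_const 1)). unfold J at 1 2 in hneg.
  rewrite !e in hneg by auto. specialize (hneg ltac:(intros; lra) hJA hJB).
  assert (h : J (fun t => s * (A t * prim B t - B t * prim A t)) < 0).
  { apply J_neg; auto 15 with cts. intros t ht. specialize (hneg t ht).
    rewrite !e in hneg by auto. exact hneg. }
  rewrite J_scal, J_minus in h by auto 15 with cts.
  assert (h2 : J (fun t => A t * prim B t + B t * prim A t) = 0).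
  { rewrite (J_ftc (fun t => prim A t * prim B t)); auto 15 with cts.
    - unfold J in hJA, hJB. rewrite hJA, hJB, !prim_0. ring.
    - intros t ht. eapply is_derive_eq; [apply is_derive_Rmult; apply prim_derive; auto|ring]. }
  rewrite J_plus in h2 by auto with cts. nra.
Qed.

(** * The parameter as a function of the initial value *)

Section Family.

Variables A B : R -> R.
Hypothesis hA : cts A.
Hypothesis hB : cts B.

Lemma cycle_at_zero l v : cycle A B l v -> v 0 = 0 ->
  (on_I t, v t = 0) /\ J (shift B l) = 0.
Proof.
  intros (hv & _ & hm) h0.
  assert (hz : on_I t, v t = 0).
  { apply (sol_unique A (shift B l) v (fun _ => 0) 0); auto with cts; [|lra].
    apply sol_zero. }
  split; auto. rewrite <- hm. apply J_ext. intros r hr. rewrite hz by auto. ring.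
Qed.

Lemma parameter_lipschitz l0 u M :
  cycle A B l0 u -> (on_I t, Rabs (u t) <= M) -> 0 < M ->
  exists C d, 0 < C /\ 0 < d /\ forall l v, cycle A B l v ->
    (on_I t, Rabs (v t) <= M) -> Rabs (v 0 - u 0) < d ->
    Rabs (l - l0) <= C * Rabs (v 0 - u 0).
Proof.
  intros hcu bu hM. destruct (cycle_base A B l0 u hcu) as [hu huT].
  assert (hB0 : cts (shift B l0)) by auto with cts.
  destruct (Req_dec (u 0) 0) as [h0|h0].
  - destruct (cycle_at_zero l0 u hcu h0) as [hz hJ].
    destruct (parameter_near_zero A (shift B l0) hA hB0 M hJ hM) as [C [hC h]].
    exists C, 1. split; [auto|split; [lra|]]. intros l v hv bv _.
    destruct (h (l - l0) v (cycle_rebase A B l l0 v hv) bv) as [h1 _].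
    rewrite h0, Rminus_0_r. exact h1.
  - destruct (cycle_pair_bounds A (shift B l0) hA hB0 M) as [C [hC h]].
    assert (hy2 : 0 < u 0 ^ 2) by (apply pow2_gt_0; auto).
    exists (C * (2 / u 0 ^ 2)), (Rabs (u 0) / 2).
    assert (0 < Rabs (u 0)) by (apply Rabs_pos_lt; auto).
    assert (0 < 2 / u 0 ^ 2) by (apply Rdiv_lt_0_compat; lra).
    split; [apply Rmult_lt_0_compat; auto|split; [lra|]]. intros l v hv bv hd.
    destruct (inverse_gap_estimate (v 0) (u 0) h0 hd) as (hv0 & _ & _ & hg).
    destruct (h u (l - l0) v hu huT h0 (cycle_rebase A B l l0 v hv) hv0 bu bv) as [h1 _].
    apply Rle_trans with (1 := h1). rewrite Rmult_assoc.
    apply Rmult_le_compat_l; [lra|exact hg].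
Qed.

Lemma cycle_parameter_unique l l' v v' :
  cycle A B l v -> cycle A B l' v' -> v 0 = v' 0 -> l = l'.
Proof.
  intros hv hv' e.
  destruct (cts_bounded v) as [M [hM bM]]; [apply (sol_cts A (shift B l)), hv|].
  destruct (cts_bounded v') as [M' [hM' bM']]; [apply (sol_cts A (shift B l')), hv'|].
  destruct (parameter_lipschitz l v (M + M')) as (C & d & hC & hd & h); auto; try lra.
  { intros t ht; generalize (bM t ht); lra. }
  specialize (h l' v' hv'). rewrite e, Rminus_diag, Rabs_R0, Rmult_0_r in h.
  assert (h1 : Rabs (l' - l) <= 0).
  { apply h; auto. intros t ht; generalize (bM' t ht); lra. }
  unfold Rabs in h1; destruct Rcase_abs in h1; lra.
Qed.

(** The choice of a closed solution for each initial value gives a continuous function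
    because the parameter is locally Lipschitz in the initial value. *)
Lemma parameter_function a b M :
  a < b -> 0 < M ->
  (forall x, a <= x <= b -> exists l v, cycle A B l v /\ v 0 = x /\
     on_I t, Rabs (v t) <= M) ->
  exists L, continuity L /\
  (forall x, a <= x <= b -> exists v, cycle A B (L x) v /\ v 0 = x /\
     on_I t, Rabs (v t) <= M) /\
  (forall l v, cycle A B l v -> a <= v 0 <= b -> L (v 0) = l).
Proof.
  intros hab hM hex.
  assert (hex' : forall x, exists l, exists v, cycle A B l v /\ v 0 = clip a b x /\
     on_I t, Rabs (v t) <= M).
  { intros x. apply hex, clip_range; lra. }
  set (L := fun x => proj1_sig (constructive_indefinite_description _ (hex' x))).
  assert (hL : forall x, exists v, cycle A B (L x) v /\ v 0 = clip a b x /\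
     on_I t, Rabs (v t) <= M).
  { intros x. exact (proj2_sig (constructive_indefinite_description _ (hex' x))). }
  clearbody L. exists L. split; [|split].
  - intros x. destruct (hL x) as (w & hw & e & bw).
    destruct (parameter_lipschitz (L x) w M hw bw hM) as (C & d & hC & hd & h).
    intros eps he. exists (Rmin d (eps / C)).
    split; [apply Rmin_pos; auto; apply Rdiv_lt_0_compat; auto|].
    simpl; unfold Rdist. intros y [_ hy].
    destruct (hL y) as (w' & hw' & e' & bw').
    assert (hyx : Rabs (w' 0 - w 0) <= Rabs (y - x)) by (rewrite e, e'; apply clip_lipschitz).
    assert (h1 := Rmin_l d (eps / C)). assert (h2 := Rmin_r d (eps / C)).
    specialize (h (L y) w' hw' bw' ltac:(lra)).
    apply Rle_lt_trans with (1 := h).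
    apply Rle_lt_trans with (C * Rabs (y - x)); [apply Rmult_le_compat_l; lra|].
    apply Rlt_le_trans with (C * (eps / C)); [apply Rmult_lt_compat_l; lra|].
    right; field; lra.
  - intros x hx. destruct (hL x) as (w & hw & e & bw). rewrite clip_id in e by auto.
    exists w; auto.
  - intros l' v' hv' hr. destruct (hL (v' 0)) as (w & hw & e & _).
    rewrite clip_id in e by auto. apply (cycle_parameter_unique _ _ w v'); auto.
Qed.

Variable s : R.
Hypothesis hs : s = 1 \/ s = -1.
Hypothesis harea : forall l, area_sign A (shift B l) s.

Lemma parameter_near_singular l0 u M :
  cycle A B l0 u -> u 0 <> 0 -> log_multiplier A u = 0 ->
  (on_I t, Rabs (u t) <= M) ->
  exists d, 0 < d /\ forall l v, cycle A B l v ->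
    (on_I t, Rabs (v t) <= M) -> 0 < Rabs (v 0 - u 0) < d ->
    0 < s * (l - l0).
Proof.
  intros hcu h0 hk bu. destruct (cycle_base A B l0 u hcu) as [hu huT].
  assert (hB0 : cts (shift B l0)) by auto with cts.
  assert (hQ := singular_coefficient_sign A (shift B l0) u s hA hB0 (harea l0) hu huT h0 hk).
  destruct (parameter_near_singular_cycle A (shift B l0) hA hB0 u M) as (h & hh & hloc); auto.
  { intros e. rewrite e in hQ. lra. }
  destruct (inverse_gap_small (u 0) h h0 hh) as (d & hd & hconv).
  exists d. split; [auto|].
  intros l v hv bv hvd. destruct (hconv (v 0) hvd) as (hv0 & _ & _ & hb).
  assert (h1 := hloc (l - l0) v (cycle_rebase A B l l0 v hv) hv0 bv hb).
  set (Q := curvature A u) in *. destruct hs as [->| ->]; nra.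
Qed.

Lemma parameter_near_center l0 M :
  J A = 0 -> J (shift B l0) = 0 -> 0 < M ->
  exists d, 0 < d /\ forall l v, cycle A B l v ->
    (on_I t, Rabs (v t) <= M) -> 0 < Rabs (v 0) < d ->
    0 < s * (l - l0).
Proof.
  intros hJA hJ hM. assert (hB0 : cts (shift B l0)) by auto with cts.
  assert (hJf := J_f_pos).
  destruct (parameter_near_zero A (shift B l0) hA hB0 M hJ hM) as [C [hC h]].
  set (Q := J (fun t => A t * prim (shift B l0) t)) in *.
  assert (hQ := zero_coefficient_sign A (shift B l0) s hA hB0 (harea l0) hJA hJ).
  fold Q in hQ.
  assert (hQ' : 0 < Rabs Q).
  { apply Rabs_pos_lt. intros e; rewrite e in hQ; lra. }
  exists (Rabs Q / (2 * C)). split; [apply Rdiv_lt_0_compat; lra|].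
  intros l v hv bv hd.
  destruct (h (l - l0) v (cycle_rebase A B l l0 v hv) bv) as (_ & _ & h3).
  specialize (h3 hJA). set (x := v 0) in *.
  assert (hx2 : 0 < Rabs x ^ 2) by (apply pow_lt; lra).
  assert (h4 : C * Rabs x ^ 3 <= Rabs Q / 2 * Rabs x ^ 2).
  { destruct hd as [_ hd]. apply Rmult_lt_compat_l with (r := C) in hd; auto.
    replace (C * (Rabs Q / (2 * C))) with (Rabs Q / 2) in hd by (field; lra).
    replace (C * Rabs x ^ 3) with (C * Rabs x * Rabs x ^ 2) by ring.
    apply Rmult_le_compat_r; lra. }
  assert (h5 : Rabs ((l - l0) * J f + x ^ 2 * Q) <= Rabs Q / 2 * Rabs x ^ 2) by lra.
  rewrite pow2_abs in h5, hx2. apply Rabs_le_between in h5.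
  assert (h6 : 0 < s * (l - l0) * J f); [|nra].
  destruct hs as [->| ->].
  - rewrite Rabs_left in h5 by lra. nra.
  - rewrite Rabs_pos_eq in h5 by lra. nra.
Qed.

(** Regular points of the parameter, and critical points, which are strict minima of s
    times the parameter. *)
Lemma parameter_local_behaviour l0 u M :
  cycle A B l0 u -> (on_I t, Rabs (u t) <= M) -> 0 < M ->
  exists d, 0 < d /\
  ((exists k, k <> 0 /\ forall l v, cycle A B l v ->
      (on_I t, Rabs (v t) <= M) -> 0 < Rabs (v 0 - u 0) < d ->
      0 < k * (l - l0) * (v 0 - u 0)) \/
   (forall l v, cycle A B l v ->
      (on_I t, Rabs (v t) <= M) -> 0 < Rabs (v 0 - u 0) < d ->
      0 < s * (l - l0))).
Proof.
  intros hcu bu hM. destruct (cycle_base A B l0 u hcu) as [hu huT].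
  assert (hB0 : cts (shift B l0)) by auto with cts.
  assert (hJf := J_f_pos).
  destruct (Req_dec (u 0) 0) as [h0|h0].
  - destruct (cycle_at_zero l0 u hcu h0) as [hz hJ].
    destruct (Req_dec (J A) 0) as [hJA|hJA].
    + destruct (parameter_near_center l0 M hJA hJ hM) as (d & hd & h).
      exists d. split; [auto|right]. rewrite h0. intros l v hv bv.
      rewrite Rminus_0_r. apply (h l v); auto.
    + destruct (parameter_near_zero A (shift B l0) hA hB0 M hJ hM) as [C [hC h]].
      assert (hJA' : 0 < Rabs (J A)) by (apply Rabs_pos_lt; auto).
      exists (Rabs (J A) / (2 * C)). split; [apply Rdiv_lt_0_compat; lra|left].
      exists (- J A). split; [lra|].
      intros l v hv bv hd. rewrite h0, Rminus_0_r in *.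
      destruct (h (l - l0) v (cycle_rebase A B l l0 v hv) bv) as (_ & h2 & _).
      set (x := v 0) in *.
      assert (h4 : C * Rabs x ^ 2 <= Rabs (J A) / 2 * Rabs x).
      { destruct hd as [? hd]. apply Rmult_lt_compat_l with (r := C) in hd; auto.
        replace (C * (Rabs (J A) / (2 * C))) with (Rabs (J A) / 2) in hd by (field; lra).
        replace (C * Rabs x ^ 2) with (C * Rabs x * Rabs x) by ring.
        apply Rmult_le_compat_r; lra. }
      assert (h5 : Rabs ((l - l0) * J f + x * J A) <= Rabs (J A * x) / 2)
        by (rewrite Rabs_mult; lra).
      assert (h6 : 0 < - (J A * x) * ((l - l0) * J f)).
      { apply (opposite_sign_of_small_error _ _ ((l - l0) * J f + x * J A)).
        - rewrite Rabs_Ropp. exact h5.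
        - ring.
        - intros e. assert (J A * x = 0) by lra. apply Rmult_integral in H.
          destruct H as [|H]; [auto|]. rewrite H, Rabs_R0 in hd. lra. }
      nra.
  - destruct (Req_dec (log_multiplier A u) 0) as [hk|hk].
    + destruct (parameter_near_singular l0 u M hcu h0 hk bu) as (d & hd & h).
      exists d; auto.
    + destruct (parameter_near_simple_cycle A (shift B l0) hA hB0 u M) as (h & hh & hloc); auto.
      destruct (inverse_gap_small (u 0) h h0 hh) as (d & hd & hconv).
      exists d. split; [auto|left].
      exists (- log_multiplier A u). split; [lra|].
      intros l v hv bv hvd. destruct (hconv (v 0) hvd) as (hv0 & e & hp & hb).
      assert (h1 := hloc (l - l0) v (cycle_rebase A B l l0 v hv) hv0 bv hb).
      rewrite e in h1. set (k := log_multiplier A u) in *.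
      assert (hi := Rinv_0_lt_compat _ hp).
      replace (k * (l - l0) * - ((v 0 - u 0) * / (v 0 * u 0))) with
        (- k * (l - l0) * (v 0 - u 0) * / (v 0 * u 0)) in h1 by ring.
      nra.
Qed.

(** All critical points of s times the parameter are strict local minima. *)
Lemma parameter_no_interior_max a b M :
  a < b -> 0 < M ->
  (forall x, a <= x <= b -> exists l v, cycle A B l v /\ v 0 = x /\
     on_I t, Rabs (v t) <= M) ->
  forall la va lb vb l v, cycle A B la va -> va 0 = a -> cycle A B lb vb -> vb 0 = b ->
  cycle A B l v -> a < v 0 < b -> s * l < Rmax (s * la) (s * lb).
Proof.
  intros hab hM hex la va lb vb l v hva ha hvb hb hv hx.
  destruct (parameter_function a b M hab hM hex) as (L & hLc & hL & hLeq).
  assert (hcont : forall x, continuity_pt (fun x => s * L x) x).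
  { intros x. apply (continuity_pt_scal L s x), hLc. }
  assert (hnomax : forall m, a < m < b -> ~ (forall x, a <= x <= b -> s * L x <= s * L m)).
  { intros m hm hmax. destruct (hL m ltac:(lra)) as (w & hw & e & bw).
    destruct (parameter_local_behaviour (L m) w M hw bw hM) as (d & hd & h).
    set (r := Rmin (d / 2) (Rmin (m - a) (b - m))).
    assert (hr : 0 < r /\ r < d /\ a <= m - r /\ m + r <= b).
    { unfold r, Rmin; repeat destruct Rle_dec; lra. }
    assert (hpt : forall g, g = r \/ g = - r -> exists v', cycle A B (L (m + g)) v' /\
      v' 0 - w 0 = g /\ (on_I t, Rabs (v' t) <= M) /\
      0 < Rabs (v' 0 - w 0) < d /\ s * L (m + g) <= s * L m).
    { intros g hg. destruct (hL (m + g) ltac:(destruct hg; lra)) as (v' & hv' & e' & bv').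
      exists v'.
      replace (v' 0 - w 0) with g by lra.
      split; [auto|split; [auto|split; [auto|split]]].
      - unfold Rabs; destruct Rcase_abs; lra.
      - apply hmax; lra. }
    destruct (hpt r ltac:(auto)) as (v1 & hv1 & e1 & b1 & d1 & m1).
    destruct (hpt (- r) ltac:(auto)) as (v2 & hv2 & e2 & b2 & d2 & m2).
    destruct h as [[k [hk h]]|h].
    - assert (h1 := h _ v1 hv1 b1 d1). assert (h2 := h _ v2 hv2 b2 d2).
      rewrite e1 in h1. rewrite e2 in h2.
      assert (g1 : 0 < k * (L (m + r) - L m)) by nra.
      assert (g2 : k * (L (m + - r) - L m) < 0) by nra.
      destruct hs as [e3|e3]; rewrite e3 in *; destruct (Rdichotomy k 0 hk); nra.
    - assert (h1 := h _ v1 hv1 b1 d1). lra. }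
  destruct (continuity_ab_maj (fun x => s * L x) a b ltac:(lra) ltac:(auto)) as (m & hmax & hmr).
  assert (ea : L a = la) by (rewrite <- ha; apply hLeq; auto; lra).
  assert (eb : L b = lb) by (rewrite <- hb; apply hLeq; auto; lra).
  assert (ex : L (v 0) = l) by (apply hLeq; auto; lra).
  destruct (Rlt_or_le (s * l) (Rmax (s * la) (s * lb))) as [|hle]; auto. exfalso.
  assert (h1 := Rmax_l (s * la) (s * lb)). assert (h2 := Rmax_r (s * la) (s * lb)).
  destruct (Req_dec m a) as [->|hna]; [|destruct (Req_dec m b) as [->|hnb]].
  - apply (hnomax (v 0) hx). intros x hx'. rewrite ex. generalize (hmax x hx'). rewrite ea. lra.
  - apply (hnomax (v 0) hx). intros x hx'. rewrite ex. generalize (hmax x hx'). rewrite eb. lra.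
  - apply (hnomax m); auto. lra.
Qed.

End Family.

(** Positive initial values are reached from the upper closed solution, negative ones
    from the lower one after the symmetry x -> -x, and 0 by the zero solution. *)
Lemma cycles_between A B la ua lb ub :
  cts A -> cts B -> cycle A B la ua -> cycle A B lb ub -> ua 0 < ub 0 ->
  exists M, 0 < M /\ forall x, ua 0 <= x <= ub 0 ->
  exists l v, cycle A B l v /\ v 0 = x /\ on_I t, Rabs (v t) <= M.
Proof.
  intros hA hB hca hcb hlt.
  destruct (cycle_base A B la ua hca) as [hua haT].
  destruct (cycle_base A B lb ub hcb) as [hub hbT].
  destruct (cts_bounded ua (sol_cts _ _ _ hua)) as [Ma [hMa ba]].
  destruct (cts_bounded ub (sol_cts _ _ _ hub)) as [Mb [hMb bb]].
  exists (Ma + Mb). split; [lra|]. intros x hx.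
  assert (hJf := J_f_pos).
  assert (hsh : forall l0 l t, shift (shift B l0) l t = shift B (l0 + l) t)
    by (intros; unfold shift; ring).
  destruct (Req_dec x (ua 0)) as [->|ha]; [|destruct (Req_dec x (ub 0)) as [->|hb]].
  - exists la, ua. split; [auto|split; [auto|]]. intros t ht; generalize (ba t ht); lra.
  - exists lb, ub. split; [auto|split; [auto|]]. intros t ht; generalize (bb t ht); lra.
  - destruct (Rtotal_order x 0) as [hn|[->|hp]].
    + destruct (closed_below_pos A (fun s => - shift B la s) (fun t => - ua t) (- x))
        as (l & v & hv & h0 & hT' & hb'); auto with cts.
      * apply sol_opp, hua.
      * rewrite haT; auto.
      * lra.
      * assert (hv' : sol A (shift B (la + - l)) (fun t => - v t)).
        { apply (sol_ext A (shift (shift B la) (- l))); auto.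
          apply sol_shift_opp, hv. }
        exists (la + - l), (fun t => - v t). split; [|split; [lra|]].
        -- apply cycle_of_closed; auto; lra.
        -- intros t ht. generalize (hb' t ht) (ba t ht). rewrite Rabs_Ropp.
           intros h1. rewrite (Rabs_left (ua t)), Rabs_pos_eq by lra. lra.
    + exists (- J B / J f), (fun _ => 0). split; [|split; [auto|]].
      * apply cycle_zero. rewrite J_shift by auto. field; lra.
      * intros; rewrite Rabs_R0; lra.
    + destruct (closed_below_pos A (shift B lb) ub x)
        as (l & v & hv & h0 & hT' & hb'); auto with cts; [lra|].
      assert (hv' : sol A (shift B (lb + l)) v).
      { apply (sol_ext A (shift (shift B lb) l)); auto. }
      exists (lb + l), v. split; [|split; [lra|]].
      * apply cycle_of_closed; auto; lra.
      * intros t ht. generalize (hb' t ht) (bb t ht). intros h1.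
        rewrite (Rabs_pos_eq (ub t)), Rabs_pos_eq by lra. lra.
Qed.

(** * Consequences of the Chebyshev property *)

Variable F : nat -> R -> R.
Hypothesis hET : ET_system (Ico 0 T) 2 F.
Hypothesis hFc : forall i, (i <= 2)%nat -> cts (F i).
Hypothesis hF0 : F 0%nat = f.

Definition comb (lam : nat -> R) : R -> R := lin_comb 2 F lam.

Lemma comb_eq lam t : comb lam t = lam 0%nat * F 0%nat t + lam 1%nat * F 1%nat t + lam 2%nat * F 2%nat t.
Proof. reflexivity. Qed.

Lemma cts_comb lam : cts (comb lam).
Proof.
  assert (h0 := hFc 0 ltac:(lia)). assert (h1 := hFc 1 ltac:(lia)).
  assert (h2 := hFc 2 ltac:(lia)).
  apply (cts_ext (fun t => lam 0%nat * F 0%nat t + lam 1%nat * F 1%nat t + lam 2%nat * F 2%nat t)).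
  - intros; reflexivity.
  - auto with cts.
Qed.

Hint Resolve cts_comb : cts.

(** Derivatives of all combinations of the system at once, chosen linearly in the
    coefficients. *)
Definition jets (G : (nat -> R) -> nat -> R -> R) : Prop :=
  (forall lam, derivatives_in (Ico 0 T) (comb lam) 2 (G lam)) /\
  (forall a b lam mu j t,
     G (fun i => a * lam i + b * mu i) j t = a * G lam j t + b * G mu j t).

Lemma jets_exist : exists G, jets G.
Proof.
  destruct hET as [_ [hC _]].
  destruct (hC 0%nat ltac:(lia)) as [g0 [[e0 d0] _]].
  destruct (hC 1%nat ltac:(lia)) as [g1 [[e1 d1] _]].
  destruct (hC 2%nat ltac:(lia)) as [g2 [[e2 d2] _]].
  exists (fun lam j t => lam 0%nat * g0 j t + lam 1%nat * g1 j t + lam 2%nat * g2 j t).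
  split; [split|].
  - intros t ht. rewrite comb_eq, e0, e1, e2 by auto. reflexivity.
  - intros j hj t ht.
    apply (Dadd _ (fun t => lam 0%nat * g0 (S j) t + lam 1%nat * g1 (S j) t)
      (fun t => lam 2%nat * g2 (S j) t) (fun t => lam 0%nat * g0 j t + lam 1%nat * g1 j t)
      (fun t => lam 2%nat * g2 j t)).
    + apply (Dadd _ (fun t => lam 0%nat * g0 (S j) t) (fun t => lam 1%nat * g1 (S j) t)
        (fun t => lam 0%nat * g0 j t) (fun t => lam 1%nat * g1 j t));
        apply Dmult_const; auto.
    + apply Dmult_const; auto.
  - intros; ring.
Qed.

Section Jets.

Variable G : (nat -> R) -> nat -> R -> R.
Hypothesis hG : jets G.

Lemma jet_0 lam t : 0 <= t < T -> G lam 0%nat t = comb lam t.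
Proof. intros ht. apply (proj1 hG lam); auto. Qed.

Lemma jet_derive lam j t : (j < 2)%nat -> 0 < t < T ->
  is_derive (G lam j) t (G lam (S j) t).
Proof.
  intros hj ht. apply (D_in_is_derive (Ico 0 T) (G lam j) (G lam (S j)) t (Rmin t (T - t))).
  - apply Rmin_pos; lra.
  - intros y hy. apply Rabs_def2 in hy.
    generalize (Rmin_l t (T - t)) (Rmin_r t (T - t)). unfold Ico; lra.
  - apply (proj1 hG lam); auto. unfold Ico; lra.
Qed.

Lemma comb_derive lam t : 0 < t < T -> is_derive (comb lam) t (G lam 1%nat t).
Proof.
  intros ht. apply is_derive_ext_loc with (G lam 0%nat).
  - assert (hd : 0 < Rmin t (T - t)) by (apply Rmin_pos; lra).
    exists (mkposreal _ hd). intros y hy.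
    assert (Rabs (y - t) < Rmin t (T - t)) as hy' by exact hy.
    apply Rabs_def2 in hy'. apply jet_0.
    generalize (Rmin_l t (T - t)) (Rmin_r t (T - t)). lra.
  - apply jet_derive; auto.
Qed.

Lemma comb_continuous lam t : 0 < t < T -> continuous (comb lam) t.
Proof.
  intros ht. apply @ex_derive_continuous. eexists; apply comb_derive, ht.
Qed.

Definition nonzero_coefs (lam : nat -> R) : Prop :=
  exists i, (i <= 2)%nat /\ lam i <> 0.

Lemma et_bound lam (l : list (R * nat)) :
  nonzero_coefs lam -> NoDup (map fst l) ->
  (forall t k, In (t, k) l -> 0 <= t < T /\ (pred k <= 2)%nat /\
     forall j, (j < k)%nat -> G lam j t = 0) ->
  (list_sum (map snd l) <= 2)%nat.
Proof.
  intros [i [hi hne]] hnd hl.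
  destruct hET as [hind [_ [_ hmax]]].
  assert (hnt : nontrivial (Ico 0 T) (comb lam)).
  { apply NNPP; intros h.
    apply hne, (hind lam); auto. intros t ht. apply NNPP; intros h'. apply h. exists t; auto. }
  destruct (Nat.le_gt_cases (list_sum (map snd l)) 2) as [|hgt]; auto. exfalso.
  apply (hmax (comb lam)); auto.
  - exists lam. reflexivity.
  - exists l. split; [auto|split; [|lia]].
    intros t k hin. destruct (hl t k hin) as (ht & hk & hz).
    split; [exact ht|]. exists (G lam). split; auto.
    destruct (proj1 hG lam) as [e d]. split; auto.
    intros j hj; apply d; lia.
Qed.

Lemma et_three_zeros lam t1 t2 t3 :
  nonzero_coefs lam -> 0 <= t1 < T -> 0 <= t2 < T -> 0 <= t3 < T ->
  t1 <> t2 -> t1 <> t3 -> t2 <> t3 ->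
  comb lam t1 = 0 -> comb lam t2 = 0 -> comb lam t3 = 0 -> False.
Proof.
  intros hne h1 h2 h3 n12 n13 n23 z1 z2 z3.
  assert (h := et_bound lam ((t1, 1) :: (t2, 1) :: (t3, 1) :: nil)%nat hne).
  simpl in h. apply (Nat.nle_succ_diag_l 2), h.
  - repeat constructor; simpl; intuition.
  - intros t k hin.
    destruct hin as [e|[e|[e|[]]]]; injection e as <- <-; (split; [auto|split; [simpl; lia|]]);
      intros j hj; replace j with 0%nat by lia; rewrite jet_0; auto.
Qed.

Lemma et_double_zero lam t s :
  nonzero_coefs lam -> 0 <= t < T -> 0 <= s < T -> t <> s ->
  G lam 0%nat t = 0 -> G lam 1%nat t = 0 -> comb lam s <> 0.
Proof.
  intros hne ht hs n z0 z1 zs.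
  assert (h := et_bound lam ((t, 2) :: (s, 1) :: nil)%nat hne).
  simpl in h. apply (Nat.nle_succ_diag_l 2), h.
  - repeat constructor; simpl; intuition.
  - intros r k hin.
    destruct hin as [e|[e|[]]]; injection e as <- <-; (split; [auto|split; [simpl; lia|]]);
      intros j hj.
    + destruct j as [|[|j]]; auto; lia.
    + replace j with 0%nat by lia; rewrite jet_0; auto.
Qed.

Lemma et_triple_zero lam t :
  nonzero_coefs lam -> 0 <= t < T -> G lam 0%nat t = 0 -> G lam 1%nat t = 0 ->
  G lam 2%nat t <> 0.
Proof.
  intros hne ht z0 z1 z2.
  assert (h := et_bound lam ((t, 3) :: nil)%nat hne).
  simpl in h. apply (Nat.nle_succ_diag_l 2), h.
  - repeat constructor; simpl; intuition.
  - intros r k [e|[]]; injection e as <- <-; (split; [auto|split; [simpl; lia|]]).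
    intros [|[|[|j]]] hj; auto; lia.
Qed.

Lemma comb_sign lam a b : 0 < a -> a <= b -> b < T ->
  (forall t, a <= t <= b -> comb lam t <> 0) -> 0 < comb lam a * comb lam b.
Proof.
  intros h0 hab hT' hne. apply ivt_sign; auto.
  intros t ht. apply comb_continuous; lra.
Qed.

Lemma sign_near_increasing_zero (g : R -> R) t d r : is_derive g t d -> 0 < d -> g t = 0 -> 0 < r ->
  exists h, 0 < h <= r /\ forall s, (t < s < t + h -> 0 < g s) /\ (t - h < s < t -> g s < 0).
Proof.
  intros hd hp e hr. apply is_derive_Reals in hd. destruct (hd d hp) as [m hm].
  assert (hmp := cond_pos m).
  assert (h1 := Rmin_l m r). assert (h2 := Rmin_r m r).
  exists (Rmin m r). split; [split; [apply Rmin_pos; auto|auto]|].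
  intros s. specialize (hm (s - t)). rewrite e, Rminus_0_r in hm.
  replace (t + (s - t)) with s in hm by ring.
  split; intros hs.
  - assert (h : Rabs (g s / (s - t) - d) < d).
    { apply hm; [lra|]. rewrite Rabs_pos_eq; lra. }
    apply Rabs_def2 in h. destruct (Rlt_or_le 0 (g s)) as [|hle]; auto. exfalso.
    assert (hi : 0 < / (s - t)) by (apply Rinv_0_lt_compat; lra).
    unfold Rdiv in h. nra.
  - assert (h : Rabs (g s / (s - t) - d) < d).
    { apply hm; [lra|]. rewrite Rabs_left; lra. }
    apply Rabs_def2 in h. destruct (Rlt_or_le (g s) 0) as [|hle]; auto. exfalso.
    assert (hi : / (s - t) < 0) by (apply Rinv_lt_0_compat; lra).
    unfold Rdiv in h. nra.
Qed.

(** The double zero is a strict minimum, and there is no other zero. *)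
Lemma double_zero_no_sign_change lam t :
  nonzero_coefs lam -> 0 < t < T -> G lam 0%nat t = 0 -> G lam 1%nat t = 0 ->
  0 < G lam 2%nat t -> forall s, 0 < s < T -> 0 <= comb lam s.
Proof.
  intros hne ht z0 z1 hp s hs.
  destruct (Rlt_or_le (comb lam s) 0) as [hneg|]; auto. exfalso.
  assert (hno : forall r, 0 <= r < T -> r <> t -> comb lam r <> 0).
  { intros r hr hrt. apply (et_double_zero lam t r); auto. lra. }
  assert (hst : s <> t).
  { intros ->. rewrite jet_0 in z0 by lra. lra. }
  assert (hz : comb lam t = 0) by (rewrite <- jet_0 by lra; auto).
  destruct (Rdichotomy s t hst) as [hlt|hgt].
  - destruct (sign_near_increasing_zero (G lam 1%nat) t (G lam 2%nat t) (t - s))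
      as [h [hh hsign]]; auto; [apply jet_derive; auto|lra|].
    set (r := t - h / 2).
    destruct (mvt (comb lam) (G lam 1%nat) r t) as [c [hc e]].
    + intros q hq. apply comb_derive. unfold r in hq; lra.
    + unfold r; lra.
    + assert (G lam 1%nat c <= 0).
      { destruct (Req_dec c t) as [->|hct]; [lra|].
        left. apply (hsign c). unfold r in hc; lra. }
      assert (hr : 0 <= comb lam r) by (unfold r in *; nra).
      assert (h3 : 0 < comb lam s * comb lam r); [|nra].
      apply comb_sign; try (unfold r; lra).
      intros q hq. apply hno; unfold r in hq; lra.
  - destruct (sign_near_increasing_zero (G lam 1%nat) t (G lam 2%nat t) (s - t))
      as [h [hh hsign]]; auto; [apply jet_derive; auto|lra|].
    set (r := t + h / 2).
    destruct (mvt (comb lam) (G lam 1%nat) t r) as [c [hc e]].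
    + intros q hq. apply comb_derive. unfold r in hq; lra.
    + unfold r; lra.
    + assert (0 <= G lam 1%nat c).
      { destruct (Req_dec c t) as [->|hct]; [lra|].
        left. apply (hsign c). unfold r in hc; lra. }
      assert (hr : 0 <= comb lam r) by (unfold r in *; nra).
      assert (h3 : 0 < comb lam r * comb lam s); [|nra].
      apply comb_sign; try (unfold r; lra).
      intros q hq. apply hno; unfold r in hq; lra.
Qed.

Lemma J_zero_nonneg g : cts g -> (forall t, 0 < t < T -> 0 <= g t) -> J g = 0 ->
  forall t, 0 < t < T -> g t = 0.
Proof.
  intros hg hp hJ t ht.
  assert (hmono : forall a b, 0 <= a -> a <= b -> b <= T -> prim g a <= prim g b).
  { intros a b h0 hab hb. enough (0 <= RInt (fun s => g (clip 0 T s)) a b).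
    - assert (hs : prim g a + RInt (fun s => g (clip 0 T s)) a b = prim g b); [|lra].
      apply (RInt_Chasles (V := R_CompleteNormedModule));
        apply @ex_RInt_continuous; intros z _; auto.
    - apply RInt_ge_0; [lra| |].
      + apply @ex_RInt_continuous; intros z _; auto.
      + intros r hr. rewrite clip_id by lra. apply hp; lra. }
  assert (hz : on_I r, prim g r = 0).
  { intros r hr. assert (h1 := hmono 0 r). assert (h2 := hmono r T).
    unfold J in hJ. rewrite prim_0 in h1. lra. }
  assert (h1 : is_derive (prim g) t (g t)) by (apply prim_derive; auto; lra).
  assert (h2 : is_derive (prim g) t 0).
  { apply is_derive_ext_loc with (fun _ => 0); [|apply @is_derive_const].
    assert (hd : 0 < Rmin t (T - t)) by (apply Rmin_pos; lra).
    exists (mkposreal _ hd). intros y hy.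
    assert (Rabs (y - t) < Rmin t (T - t)) as hy' by exact hy.
    apply Rabs_def2 in hy'. symmetry; apply hz.
    generalize (Rmin_l t (T - t)) (Rmin_r t (T - t)). lra. }
  rewrite <- (is_derive_unique _ _ _ h1). apply is_derive_unique, h2.
Qed.

(** ** Two independent coefficients *)

Definition lin2 (a b : R) (al be : nat -> R) (i : nat) : R := a * al i + b * be i.

Lemma comb_lin2 a b al be t : comb (lin2 a b al be) t = a * comb al t + b * comb be t.
Proof. rewrite !comb_eq. unfold lin2. ring. Qed.

Lemma jet_lin2 a b al be j t :
  G (lin2 a b al be) j t = a * G al j t + b * G be j t.
Proof. apply (proj2 hG). Qed.

(** Independence of the two functions from each other and from f, the coefficients
    of f being (1, 0, 0). *)
Definition independent (al be : nat -> R) : Prop :=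
  al 1%nat * be 2%nat - al 2%nat * be 1%nat <> 0.

Lemma lin2_nonzero a b al be :
  independent al be -> a <> 0 \/ b <> 0 -> nonzero_coefs (lin2 a b al be).
Proof.
  intros hd hab. destruct (Req_dec (lin2 a b al be 1) 0) as [e1|]; [|exists 1%nat; auto].
  destruct (Req_dec (lin2 a b al be 2) 0) as [e2|]; [|exists 2%nat; auto].
  exfalso. unfold lin2 in *.
  assert (ha : a * (al 1%nat * be 2%nat - al 2%nat * be 1%nat) = 0).
  { replace (_ * _) with
      ((a * al 1%nat + b * be 1%nat) * be 2%nat - (a * al 2%nat + b * be 2%nat) * be 1%nat)
      by ring. rewrite e1, e2; ring. }
  assert (hb : b * (al 1%nat * be 2%nat - al 2%nat * be 1%nat) = 0).
  { replace (_ * _) with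
      ((a * al 2%nat + b * be 2%nat) * al 1%nat - (a * al 1%nat + b * be 1%nat) * al 2%nat)
      by ring. rewrite e1, e2; ring. }
  apply Rmult_integral in ha. apply Rmult_integral in hb. unfold independent in hd. tauto.
Qed.

(** The origin is strictly surrounded by the curve with coordinates A and B. *)
Definition both_signs (al be : nat -> R) : Prop :=
  forall a b, a <> 0 \/ b <> 0 ->
  (exists r, 0 < r < T /\ a * comb al r + b * comb be r < 0) /\
  (exists r, 0 < r < T /\ 0 < a * comb al r + b * comb be r).

(** A combination of one sign and of weighted mean 0 would vanish identically. *)
Lemma both_signs_of_mean_zero al be p :
  independent al be -> cts p -> (on_I t, 0 < p t) ->
  J (fun t => p t * comb al t) = 0 -> J (fun t => p t * comb be t) = 0 ->
  both_signs al be.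
Proof.
  intros hd hcp hp hJa hJb.
  assert (hpos : forall a b, a <> 0 \/ b <> 0 ->
    exists r, 0 < r < T /\ 0 < a * comb al r + b * comb be r).
  { intros a b hab. apply NNPP; intros hn.
    set (g := fun t => - (p t * (a * comb al t + b * comb be t))).
    assert (hcg : cts g) by (unfold g; auto 15 with cts).
    assert (hz : forall t, 0 < t < T -> g t = 0).
    { apply J_zero_nonneg; auto.
      - intros t ht. destruct (Rlt_or_le 0 (a * comb al t + b * comb be t)) as [h|h].
        + exfalso; apply hn; exists t; auto.
        + unfold g. generalize (hp t ltac:(lra)). nra.
      - unfold g. rewrite (J_ext _ (fun t => - a * (p t * comb al t) + - b * (p t * comb be t)))
          by (intros; ring).
        rewrite J_plus, !J_scal, hJa, hJb by auto 15 with cts. ring. }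
    assert (hz' : forall t, 0 < t < T -> comb (lin2 a b al be) t = 0).
    { intros t ht. rewrite comb_lin2. specialize (hz t ht). unfold g in hz.
      assert (h : p t * (a * comb al t + b * comb be t) = 0) by lra.
      apply Rmult_integral in h. destruct h as [h|h]; auto.
      generalize (hp t ltac:(lra)). lra. }
    apply (et_three_zeros (lin2 a b al be) (T / 4) (T / 3) (T / 2)); try lra;
      try (apply hz'; lra). apply lin2_nonzero; auto. }
  intros a b hab. split; [|apply hpos; auto].
  destruct (hpos (- a) (- b)) as [r [hr h]]; [|exists r; split; [auto|lra]].
  destruct hab; [left|right]; lra.
Qed.

Definition wronskian (al be : nat -> R) (t : R) : R :=
  comb al t * G be 1%nat t - comb be t * G al 1%nat t.

(** If it vanished, some nontrivial combination would have a double zero at t, hence no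
    other zero, and would keep its sign. *)
Lemma wronskian_nonzero al be t :
  independent al be -> both_signs al be -> 0 < t < T -> wronskian al be t <> 0.
Proof.
  intros hd hbs ht hw. unfold wronskian in hw.
  assert (hab : exists a b, (a <> 0 \/ b <> 0) /\ a * comb al t + b * comb be t = 0 /\
    a * G al 1%nat t + b * G be 1%nat t = 0).
  { destruct (Req_dec (comb al t) 0) as [e1|n1]; [destruct (Req_dec (comb be t) 0) as [e2|n2]|].
    - destruct (Req_dec (G al 1%nat t) 0) as [e3|n3].
      + exists 1, 0. rewrite e1, e2, e3. split; [left; lra|lra].
      + exists (G be 1%nat t), (- G al 1%nat t). rewrite e1, e2. split; [right; lra|lra].
    - exists (comb be t), (- comb al t). split; [left; auto|lra].
    - exists (comb be t), (- comb al t). split; [right; lra|lra]. }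
  destruct hab as (a & b & hne & z0 & z1).
  assert (hdz : forall a b, a <> 0 \/ b <> 0 -> a * comb al t + b * comb be t = 0 ->
    a * G al 1%nat t + b * G be 1%nat t = 0 -> G (lin2 a b al be) 2%nat t <= 0).
  { clear a b hne z0 z1. intros a b hne z0 z1.
    destruct (Rlt_or_le 0 (G (lin2 a b al be) 2%nat t)) as [h|]; auto. exfalso.
    destruct (hbs a b hne) as [[r [hr hneg]] _].
    assert (h1 := double_zero_no_sign_change (lin2 a b al be) t).
    rewrite jet_0, comb_lin2, jet_lin2 in h1 by lra.
    specialize (h1 (lin2_nonzero a b al be hd hne) ht z0 z1 h r hr).
    rewrite comb_lin2 in h1. lra. }
  assert (h1 := hdz a b hne z0 z1).
  assert (h2 := hdz (- a) (- b)). rewrite !jet_lin2 in *.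
  assert (h3 := et_triple_zero (lin2 a b al be) t (lin2_nonzero a b al be hd hne)).
  rewrite jet_0, comb_lin2, !jet_lin2 in h3 by lra.
  apply (h3 ltac:(lra) z0 z1).
  assert (- a <> 0 \/ - b <> 0) by (destruct hne; [left|right]; lra).
  specialize (h2 H ltac:(lra) ltac:(lra)). lra.
Qed.

Lemma wronskian_sign al be t1 t2 :
  independent al be -> both_signs al be -> 0 < t1 < T -> 0 < t2 < T ->
  0 < wronskian al be t1 * wronskian al be t2.
Proof.
  intros hd hbs.
  assert (h : forall t1 t2, 0 < t1 -> t1 <= t2 -> t2 < T ->
    0 < wronskian al be t1 * wronskian al be t2).
  { intros r1 r2 h1 h2 h3. apply ivt_sign; auto.
    - intros t ht. unfold wronskian.
      assert (hcG : forall lam, continuous (G lam 1%nat) t).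
      { intros lam. apply @ex_derive_continuous. eexists; apply jet_derive; [lia|lra]. }
      apply (continuous_minus (V := R_NormedModule));
        apply (continuous_mult (K := R_AbsRing)); auto; apply comb_continuous; lra.
    - intros t ht. apply wronskian_nonzero; auto; lra. }
  intros ht1 ht2. destruct (Rle_or_lt t1 t2); [|rewrite Rmult_comm]; apply h; lra.
Qed.

(** The integrand p (A(t) B - B(t) A) of the cross product has a simple zero at t,
    at most one other zero, and mean 0, which decides the sign of its primitive at t. *)
Lemma area_sign_of_wronskian al be s t0 :
  independent al be -> 0 < t0 < T -> s * s = 1 ->
  (both_signs al be -> 0 < s * wronskian al be t0) ->
  area_sign (comb al) (comb be) s.
Proof.
  intros hd ht0 hss hw p hcp hp hJa hJb t ht.
  assert (hbs := both_signs_of_mean_zero al be p hd hcp hp hJa hJb).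
  assert (hwt : 0 < s * wronskian al be t).
  { generalize (hw hbs) (wronskian_sign al be t0 t hd hbs ht0 ht). nra. }
  set (lam := lin2 (s * - comb be t) (s * comb al t) al be).
  assert (hs0 : s <> 0) by (intros e; rewrite e in hss; lra).
  assert (hne : nonzero_coefs lam).
  { apply lin2_nonzero; auto. unfold wronskian in hwt.
    destruct (Req_dec (comb be t) 0) as [e1|n1];
      [destruct (Req_dec (comb al t) 0) as [e2|n2]|].
    - rewrite e1, e2 in hwt. lra.
    - right. apply Rmult_integral_contrapositive; auto.
    - left. apply Rmult_integral_contrapositive; split; auto; lra. }
  assert (hz : comb lam t = 0) by (unfold lam; rewrite comb_lin2; ring).
  assert (hslope : 0 < G lam 1%nat t).
  { unfold lam. rewrite jet_lin2. unfold wronskian in hwt. lra. }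
  assert (hclam := cts_comb lam).
  assert (hprim : forall r, prim (fun q => p q * comb lam q) r =
    s * (comb al t * prim (fun r => p r * comb be r) r -
         comb be t * prim (fun r => p r * comb al r) r)).
  { intros r. rewrite (prim_ext _ (fun q => s * comb al t * (p q * comb be q) -
      s * comb be t * (p q * comb al q))).
    - rewrite prim_minus, !prim_scal by auto 15 with cts. ring.
    - intros q _. unfold lam. rewrite comb_lin2. ring. }
  rewrite <- hprim.
  assert (hJ : prim (fun q => p q * comb lam q) T = 0).
  { rewrite hprim. unfold J in hJa, hJb. rewrite hJa, hJb. ring. }
  set (r0 := Rmin t (T - t)).
  assert (hr0 : 0 < r0 /\ r0 <= t /\ r0 <= T - t).
  { unfold r0, Rmin; destruct Rle_dec; lra. }
  destruct (sign_near_increasing_zero (comb lam) t (G lam 1%nat t) r0)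
    as [h [hh hsign]]; auto; [apply comb_derive; auto|lra|].
  destruct (classic (exists z, 0 <= z < t /\ comb lam z = 0)) as [[z [hzt hz0]]|hno].
  - assert (hright : forall r, t < r < T -> 0 < comb lam r).
    { intros r hr. destruct (Rlt_or_le r (t + h)) as [hlt|hle]; [apply hsign; lra|].
      assert (h1 : 0 < comb lam (t + h / 2) * comb lam r).
      { apply comb_sign; try lra. intros q hq e.
        apply (et_three_zeros lam z t q); auto; lra. }
      assert (h2 : 0 < comb lam (t + h / 2)) by (apply hsign; lra). nra. }
    rewrite <- hJ. apply RInt_clip_pos; try lra; auto with cts.
    intros r hr. apply Rmult_lt_0_compat; [apply hp; lra|apply hright; auto].
  - assert (hleft : forall r, 0 < r < t -> comb lam r < 0).
    { intros r hr. destruct (Rlt_or_le (t - h) r) as [hlt|hle]; [apply hsign; lra|].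
      assert (h1 : 0 < comb lam r * comb lam (t - h / 2)).
      { apply comb_sign; try lra. intros q hq e.
        apply hno; exists q; split; auto; lra. }
      assert (h2 : comb lam (t - h / 2) < 0) by (apply hsign; lra). nra. }
    enough (0 < prim (fun q => -1 * (p q * comb lam q)) t)
      by (rewrite prim_scal in H by auto with cts; lra).
    rewrite <- (prim_0 (fun q => -1 * (p q * comb lam q))).
    apply RInt_clip_pos; try lra; auto with cts.
    intros r hr. generalize (hleft r hr) (hp r ltac:(lra)). nra.
Qed.

(** Adding multiples of f moves the curve of coefficients along a line; the parameters
    for which the origin is surrounded form an interval, on which the orientation
    cannot change. *)
Lemma area_sign_family al be :
  independent al be -> exists s, (s = 1 \/ s = -1) /\
  forall l, area_sign (comb al) (shift (comb be) l) s.
Proof.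
  intros hd.
  set (e0 := fun i => match i with O => 1 | _ => 0 end : R).
  assert (hdl : forall l, independent al (lin2 1 l be e0)).
  { intros l. unfold independent, lin2; simpl. intros e; apply hd. rewrite <- e; ring. }
  assert (he0 : forall t, comb e0 t = f t).
  { intros t. rewrite comb_eq, hF0. simpl. ring. }
  assert (heq : forall l t, comb (lin2 1 l be e0) t = shift (comb be) l t).
  { intros l t. rewrite comb_lin2, he0. unfold shift; ring. }
  assert (harea : forall l s, area_sign (comb al) (comb (lin2 1 l be e0)) s ->
    area_sign (comb al) (shift (comb be) l) s).
  { intros l s h p hcp hp hJa hJb t ht.
    assert (e : forall t, prim (fun r => p r * comb (lin2 1 l be e0) r) t =
                          prim (fun r => p r * shift (comb be) l r) t)
      by (intros; apply prim_ext; intros; rewrite heq; auto).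
    unfold area_sign, J in *. rewrite <- heq, <- e. apply h; auto. rewrite e; auto. }
  set (w := fun l => wronskian al (lin2 1 l be e0) (T / 2)).
  assert (hT2 : 0 < T / 2 < T) by lra.
  assert (haff : forall l, w l = w 0 + l * (w 1 - w 0)).
  { intros l. unfold w, wronskian. rewrite !comb_lin2, !jet_lin2. ring. }
  assert (hconv : forall l1 l2 l, l1 <= l <= l2 ->
    both_signs al (lin2 1 l1 be e0) -> both_signs al (lin2 1 l2 be e0) ->
    both_signs al (lin2 1 l be e0)).
  { intros l1 l2 l hl n1 n2 a b hab.
    destruct (n1 a b hab) as [[r1 [hr1 s1]] [r2 [hr2 s2]]].
    destruct (n2 a b hab) as [[r3 [hr3 s3]] [r4 [hr4 s4]]].
    rewrite heq in s1, s2, s3, s4. unfold shift in *.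
    assert (hf1 := hfpos r1 ltac:(lra)). assert (hf2 := hfpos r2 ltac:(lra)).
    assert (hf3 := hfpos r3 ltac:(lra)). assert (hf4 := hfpos r4 ltac:(lra)).
    destruct (Rle_or_lt 0 b) as [hb|hb].
    - split; [exists r3|exists r2]; split; auto; rewrite heq; unfold shift.
      + assert (0 <= b * ((l2 - l) * f r3)) by (apply Rmult_le_pos; [lra|apply Rmult_le_pos; lra]).
        lra.
      + assert (0 <= b * ((l - l1) * f r2)) by (apply Rmult_le_pos; [lra|apply Rmult_le_pos; lra]).
        lra.
    - split; [exists r1|exists r4]; split; auto; rewrite heq; unfold shift.
      + assert (0 <= - b * ((l - l1) * f r1)) by (apply Rmult_le_pos; [lra|apply Rmult_le_pos; lra]).
        lra.
      + assert (0 <= - b * ((l2 - l) * f r4)) by (apply Rmult_le_pos; [lra|apply Rmult_le_pos; lra]).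
        lra. }
  assert (hsame : forall l1 l2, l1 <= l2 -> both_signs al (lin2 1 l1 be e0) ->
    both_signs al (lin2 1 l2 be e0) -> 0 < w l1 * w l2).
  { intros l1 l2 hl n1 n2. apply ivt_sign; auto.
    - intros l _. apply continuous_ext with (fun l => w 0 + l * (w 1 - w 0));
        [intros; symmetry; apply haff|].
      apply (continuous_plus (V := R_NormedModule)); [apply continuous_const|].
      apply (continuous_mult (K := R_AbsRing)); [apply continuous_id|apply continuous_const].
    - intros l hr. apply wronskian_nonzero; auto. apply (hconv l1 l2); auto. }
  destruct (classic (exists l, both_signs al (lin2 1 l be e0))) as [[l1 n1]|hno].
  - assert (hw1 : w l1 <> 0) by (apply wronskian_nonzero; auto).
    assert (hsame' : forall l, both_signs al (lin2 1 l be e0) -> 0 < w l1 * w l).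
    { intros l n. destruct (Rle_or_lt l1 l); [auto|].
      rewrite Rmult_comm. apply hsame; auto; lra. }
    destruct (Rdichotomy (w l1) 0 hw1) as [hneg|hpos].
    + exists (-1). split; auto. intros l. apply harea.
      apply (area_sign_of_wronskian al _ (-1) (T / 2)); auto; [ring|].
      intros n. generalize (hsame' l n). unfold w in *. nra.
    + exists 1. split; auto. intros l. apply harea.
      apply (area_sign_of_wronskian al _ 1 (T / 2)); auto; [ring|].
      intros n. generalize (hsame' l n). unfold w in *. nra.
  - exists 1. split; auto. intros l. apply harea.
    apply (area_sign_of_wronskian al _ 1 (T / 2)); auto; [ring|].
    intros n. exfalso; apply hno; exists l; auto.
Qed.

End Jets.

(** * Multiplicities of closed solutions *)

Lemma poincare_displacement A B A' B' u v k :
  cts A -> cts B ->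
  (on_I t, A t = A' t) -> (on_I t, B t = B' t) ->
  sol A B u -> u T = u 0 ->
  k = prim (fun t => A t * (v t ^ 2 + v t * u t + u t ^ 2) + B t * (v t + u t)) T ->
  sol A B v -> poincare T A' B' (v 0) - v 0 = (v 0 - u 0) * (exp k - 1).
Proof.
  intros hA hB eA eB hu huT hk hv.
  rewrite (poincare_eq A B A' B' v) by auto.
  assert (h := sol_difference A B v u hA hB hv hu T ltac:(lra)). rewrite <- hk, huT in h.
  replace (v T - v 0) with ((v T - u 0) - (v 0 - u 0)) by ring. rewrite h. ring.
Qed.

Section Multiplicity.

Variables A B A' B' : R -> R.
Hypothesis hA : cts A.
Hypothesis hB : cts B.
Hypothesis eA : on_I t, A t = A' t.
Hypothesis eB : on_I t, B t = B' t.

Lemma sol_in_dom v : sol A B v -> poincare_dom T A' B' (v 0).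
Proof. intros hv. exists v. split; auto. apply (sol_solution A B); auto. Qed.

Lemma closed_mean_zero u : sol A B u -> u T = u 0 -> u 0 <> 0 ->
  J (fun t => A t * u t ^ 2 + B t * u t) = 0.
Proof.
  intros hu huT hu0. assert (h := sol_exp A B u hA hB hu T ltac:(lra)).
  rewrite huT in h. apply exp_inv. rewrite exp_0.
  apply Rmult_eq_reg_l with (u 0); auto. unfold J. lra.
Qed.

(** The displacement of x is (x - u(0)) (exp y - 1), with y tending to log_multiplier A u;
    at a double zero it is o(x - u(0)). *)
Lemma singular_of_double_zero u k :
  sol A B u -> u T = u 0 -> u 0 <> 0 -> (2 <= k)%nat ->
  zero_mult_ge (poincare_dom T A' B') (fun y => poincare T A' B' y - y) (u 0) k ->
  log_multiplier A u = 0.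
Proof.
  intros hu huT hu0 hk [_ [g [[e0 hd] hz]]].
  set (q := log_multiplier A u).
  assert (hcu : cts u) by eauto with cts.
  destruct (cts_bounded u hcu) as [M [hM bu]].
  destruct (cts_bounded A hA) as [KA [hKA bA]]. destruct (cts_bounded B hB) as [KB [hKB bB]].
  destruct (sol_near A B u hA hB hu) as (d & C & hdp & hC & hnear).
  set (D := T * (C * (KA * (3 * M + 1) + KB))).
  assert (hD : 0 < D).
  { unfold D. assert (0 < KA * (3 * M + 1)) by (apply Rmult_lt_0_compat; lra).
    apply Rmult_lt_0_compat; auto. apply Rmult_lt_0_compat; lra. }
  assert (hpt : forall x, Rabs (x - u 0) <= d -> exists y, Rabs (y - q) <= D * Rabs (x - u 0) /\
    poincare_dom T A' B' x /\ poincare T A' B' x - x = (x - u 0) * (exp y - 1)).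
  { intros x hx. destruct (hnear x hx) as (v & hv & h0 & hb).
    assert (hcv : cts v) by eauto with cts.
    exists (J (fun t => A t * (v t ^ 2 + v t * u t + u t ^ 2) + B t * (v t + u t))).
    split; [|split].
    - assert (hm := closed_mean_zero u hu huT hu0).
      replace q with (q + 2 * J (fun t => A t * u t ^ 2 + B t * u t)) by lra.
      unfold q, log_multiplier. rewrite <- J_scal, <- J_plus, <- J_minus by auto 15 with cts.
      unfold D. rewrite Rmult_assoc. apply J_abs_le; auto 15 with cts.
      intros t ht. replace (_ - _) with
        ((v t - u t) * (A t * ((v t - u t) + 3 * u t) + B t)) by ring.
      destruct (hb t ht) as [hb1 hb2].
      rewrite Rabs_mult.
      replace (C * (KA * (3 * M + 1) + KB) * Rabs (x - u 0)) with
        (C * Rabs (x - u 0) * (KA * (3 * M + 1) + KB)) by ring.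
      apply Rmult_le_compat; auto using Rabs_pos.
      apply Rle_trans with (1 := Rabs_triang _ _). rewrite Rabs_mult.
      apply Rplus_le_compat; auto. apply Rmult_le_compat; auto using Rabs_pos.
      apply Rle_trans with (1 := Rabs_triang _ _). rewrite Rabs_mult, (Rabs_pos_eq 3) by lra.
      generalize (bu t ht). lra.
    - rewrite <- h0. apply sol_in_dom; auto.
    - rewrite <- h0. apply (poincare_displacement A B A' B' u v); auto. }
  destruct (Req_dec q 0) as [|hq]; auto. exfalso.
  assert (hq' := Rabs_pos_lt q hq).
  set (eps := Rmin (Rabs q / 2) (1 - exp (- (Rabs q / 2)))).
  assert (heps : 0 < eps).
  { apply Rmin_pos; [lra|]. assert (exp (- (Rabs q / 2)) < exp 0) by (apply exp_increasing; lra).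
    rewrite exp_0 in *. lra. }
  destruct (hd 0%nat ltac:(lia) (u 0) (sol_in_dom u hu) eps heps) as [a [ha hlim]].
  simpl in hlim; unfold Rdist in hlim.
  set (h := Rmin (a / 2) (Rmin d (Rabs q / (2 * D)))).
  assert (hqD : 0 < Rabs q / (2 * D)) by (apply Rdiv_lt_0_compat; lra).
  assert (hh : 0 < h /\ h < a /\ h <= d /\ h <= Rabs q / (2 * D)).
  { unfold h, Rmin; repeat destruct Rle_dec; lra. }
  destruct (hpt (u 0 + h)) as (y & hy & hdom & hP).
  { replace (u 0 + h - u 0) with h by ring. rewrite Rabs_pos_eq; lra. }
  replace (u 0 + h - u 0) with h in * by ring.
  specialize (hlim (u 0 + h)). replace (u 0 + h - u 0) with h in hlim by ring.
  rewrite (e0 (u 0 + h) hdom), hP, (hz 0%nat ltac:(lia)), (hz 1%nat ltac:(lia)) in hlim.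
  rewrite (Rabs_pos_eq h) in hy, hlim by lra.
  assert (hlt : Rabs (exp y - 1) < eps).
  { replace (exp y - 1) with ((h * (exp y - 1) - 0) / h - 0) by (field; lra).
    apply hlim. split; [split; [exact hdom|lra]|lra]. }
  assert (hyq : Rabs (y - q) <= Rabs q / 2).
  { apply Rle_trans with (1 := hy). apply Rle_trans with (D * (Rabs q / (2 * D))).
    - apply Rmult_le_compat_l; lra.
    - right; field; lra. }
  assert (he1 := Rmin_l (Rabs q / 2) (1 - exp (- (Rabs q / 2)))).
  assert (he2 := Rmin_r (Rabs q / 2) (1 - exp (- (Rabs q / 2)))).
  fold eps in he1, he2. apply Rabs_def2 in hlt. apply Rabs_le_between in hyq.
  destruct (Rdichotomy q 0 hq) as [hn|hp].
  - rewrite (Rabs_left q) in * by lra.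
    assert (exp y <= exp (- (- q / 2))) by (apply exp_le_exp; lra). lra.
  - rewrite (Rabs_pos_eq q) in * by lra. generalize (exp_ineq1_le y). lra.
Qed.

(** At a triple zero the displacement is o((x - u(0))^2), which leaves no room for a
    quadratic term in its expansion. *)
Lemma coefficient_zero_of_triple_zero u k :
  sol A B u -> u T = u 0 -> u 0 <> 0 -> (3 <= k)%nat ->
  log_multiplier A u = 0 ->
  zero_mult_ge (poincare_dom T A' B') (fun y => poincare T A' B' y - y) (u 0) k ->
  curvature A u = 0.
Proof.
  intros hu huT hu0 hk hsing [_ [g [[e0 hd] hz]]].
  set (Q := curvature A u). set (x0 := u 0) in *.
  destruct (cts_bounded u (sol_cts A B u hu)) as [M [hM bu]].
  destruct (sol_near A B u hA hB hu) as (d & C & hdp & hC & hnear). fold x0 in hnear.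
  destruct (displacement_near_singular_cycle A B hA hB u (M + 1) hu huT hu0 hsing)
    as (C' & hC' & hdisp).
  { intros t ht; generalize (bu t ht); lra. }
  fold Q in hdisp. fold x0 in hdisp.
  destruct (Req_dec Q 0) as [|hQ]; auto. exfalso.
  assert (hQ' := Rabs_pos_lt Q hQ). assert (hx0 := Rabs_pos_lt x0 hu0).
  assert (hx2 : 0 < x0 ^ 2) by (apply pow2_gt_0; auto).
  assert (hdom : forall x, Rabs (x - x0) <= d -> poincare_dom T A' B' x).
  { intros x hx. destruct (hnear x hx) as (v & hv & h0 & _). rewrite <- h0.
    apply sol_in_dom; auto. }
  assert (hdom0 : poincare_dom T A' B' x0) by (apply sol_in_dom; auto).
  set (eps := Rabs Q / (32 * x0 ^ 2)).
  assert (heps : 0 < eps) by (apply Rdiv_lt_0_compat; lra).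
  destruct (hd 1%nat ltac:(lia) x0 hdom0 eps heps) as [a [ha hlim]].
  simpl in hlim; unfold Rdist in hlim.
  rewrite (hz 1%nat ltac:(lia)), (hz 2%nat ltac:(lia)) in hlim.
  (* The step h0 keeps x0 + h0 in the domain and, together with its image, within a factor
     2 of x0; the last bound makes the cubic error smaller than the quadratic term. *)
  set (h0 := Rmin (a / 2) (Rmin (d / 2) (Rmin (Rabs x0 / 2)
         (Rmin (Rabs x0 / (2 * C)) (Rabs Q * x0 ^ 2 / (8 * C')))))).
  assert (hp1 : 0 < Rabs x0 / (2 * C)) by (apply Rdiv_lt_0_compat; lra).
  assert (hp2 : 0 < Rabs Q * x0 ^ 2 / (8 * C')).
  { apply Rdiv_lt_0_compat; [apply Rmult_lt_0_compat|]; lra. }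
  assert (hh : 0 < h0 /\ h0 < a /\ h0 <= d / 2 /\ h0 <= Rabs x0 / 2 /\
    h0 <= Rabs x0 / (2 * C) /\ h0 <= Rabs Q * x0 ^ 2 / (8 * C')).
  { unfold h0, Rmin; repeat destruct Rle_dec; lra. }
  clearbody h0. destruct hh as (hh0 & hha & hhd & hhx & hhC & hhQ).
  (* The mean value theorem turns g1 = o(x - x0) into a quadratic bound on P - id. *)
  assert (hquad : Rabs (poincare T A' B' (x0 + h0) - (x0 + h0)) <= eps * h0 ^ 2).
  { destruct (mvt (g 0%nat) (g 1%nat) x0 (x0 + h0)) as [c [hc e]]; [|lra|].
    - intros r hr. apply (D_in_is_derive (poincare_dom T A' B') _ _ r (d / 2)); [lra| |].
      + intros y hy. apply hdom. apply Rabs_def2 in hy. apply Rabs_le; lra.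
      + apply hd; [lia|]. apply hdom. apply Rabs_le; lra.
    - rewrite (hz 0%nat ltac:(lia)), Rminus_0_r in e.
      rewrite <- (e0 (x0 + h0)) by (apply hdom, Rabs_le; lra). rewrite e.
      replace (x0 + h0 - x0) with h0 by ring. rewrite Rabs_mult, (Rabs_pos_eq h0) by lra.
      replace (eps * h0 ^ 2) with (eps * h0 * h0) by ring.
      apply Rmult_le_compat_r; [lra|].
      destruct (Req_dec c x0) as [->|hcx].
      + rewrite (hz 1%nat ltac:(lia)), Rabs_R0. apply Rmult_le_pos; lra.
      + assert (hcp : 0 < c - x0) by lra.
        specialize (hlim c). rewrite (Rabs_pos_eq (c - x0)), !Rminus_0_r in hlim by lra.
        assert (h1 : Rabs (g 1%nat c / (c - x0)) < eps).
        { apply hlim. split; [split; [apply hdom, Rabs_le; lra|lra]|lra]. }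
        unfold Rdiv in h1. rewrite Rabs_mult, (Rabs_pos_eq (/ (c - x0))) in h1
          by (left; apply Rinv_0_lt_compat; auto).
        apply Rmult_lt_compat_r with (r := c - x0) in h1; auto.
        rewrite Rmult_assoc, Rinv_l, Rmult_1_r in h1 by lra.
        apply Rlt_le, Rlt_le_trans with (1 := h1). apply Rmult_le_compat_l; lra. }
  destruct (hnear (x0 + h0)) as (v & hv & hv0 & hb).
  { replace (x0 + h0 - x0) with h0 by ring. apply Rabs_le; lra. }
  replace (x0 + h0 - x0) with h0 in hb by ring. rewrite (Rabs_pos_eq h0) in hb by lra.
  rewrite <- hv0 in hquad. rewrite (poincare_eq A B A' B' v) in hquad by auto.
  rewrite hv0 in hquad.
  assert (hvT : Rabs (v T - x0) <= Rabs x0 / 2).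
  { destruct (hb T ltac:(lra)) as [h1 _]. rewrite huT in h1. apply Rle_trans with (1 := h1).
    apply Rle_trans with (C * (Rabs x0 / (2 * C))); [apply Rmult_le_compat_l; lra|].
    right; field; lra. }
  specialize (hdisp v hv). rewrite hv0 in hdisp.
  set (x := x0 + h0) in *. set (P := v T) in *.
  assert (hxx : x ^ 2 <= 4 * x0 ^ 2 /\ x0 ^ 2 <= 2 * (x * x0) /\ x0 ^ 2 <= 4 * (P * x)).
  { unfold x. assert (h0 <= Rabs x0 / 2) by lra.
    unfold Rabs in hhx, hvT. repeat destruct Rcase_abs in hhx; repeat destruct Rcase_abs in hvT;
      (split; [|split]); nra. }
  destruct hxx as (hx4 & hxx0 & hPx).
  assert (hxne : x <> 0) by (intros e; rewrite e in hxx0; lra).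
  assert (hPne : P <> 0) by (intros e; rewrite e in hPx; lra).
  specialize (hdisp hxne).
  assert (hd1 : Rabs (/ P - / x + (/ x - / x0) ^ 2 * Q) <= C' * Rabs (/ x - / x0) ^ 3).
  { apply hdisp. intros t ht. replace (v t) with ((v t - u t) + u t) by ring.
    apply Rle_trans with (1 := Rabs_triang _ _). generalize (bu t ht) (hb t ht); lra. }
  set (w := h0 / (x * x0)).
  assert (hxx0' : 0 < x * x0) by lra.
  assert (hw : / x - / x0 = - w) by (unfold w, x; field; auto).
  assert (hwp : 0 < w) by (apply Rdiv_lt_0_compat; auto).
  rewrite hw, Rabs_Ropp, (Rabs_pos_eq w) in hd1 by lra.
  replace ((- w) ^ 2) with (w ^ 2) in hd1 by ring.
  assert (hPd : Rabs (/ P - / x) <= Rabs Q / 2 * w ^ 2).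
  { replace (/ P - / x) with (- ((P - x) * / (P * x))) by (field; auto).
    rewrite Rabs_Ropp, Rabs_mult, (Rabs_pos_eq (/ (P * x)))
      by (left; apply Rinv_0_lt_compat; lra).
    apply Rle_trans with (eps * h0 ^ 2 * (4 / x0 ^ 2)).
    - apply Rmult_le_compat; auto using Rabs_pos; [left; apply Rinv_0_lt_compat; lra|].
      replace (4 / x0 ^ 2) with (/ (x0 ^ 2 / 4)) by (field; auto).
      apply Rinv_le_contravar; lra.
    - unfold eps, w. replace (Rabs Q / 2 * (h0 / (x * x0)) ^ 2) with
        (Rabs Q * h0 ^ 2 * (/ (2 * x0 ^ 2)) * (/ x ^ 2)) by (field; auto).
      replace (Rabs Q / (32 * x0 ^ 2) * h0 ^ 2 * (4 / x0 ^ 2)) with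
        (Rabs Q * h0 ^ 2 * (/ (2 * x0 ^ 2)) * (/ (4 * x0 ^ 2))) by (field; auto).
      apply Rmult_le_compat_l.
      + apply Rmult_le_pos; [apply Rmult_le_pos; [lra|apply pow2_ge_0]|].
        left; apply Rinv_0_lt_compat; lra.
      + apply Rinv_le_contravar; auto. apply pow2_gt_0; auto. }
  assert (hw2 : 0 < w ^ 2) by (apply pow_lt; auto).
  assert (hCw : C' * w ^ 3 <= Rabs Q / 4 * w ^ 2).
  { replace (C' * w ^ 3) with (C' * w * w ^ 2) by ring. apply Rmult_le_compat_r; [lra|].
    apply Rle_trans with (C' * (2 / x0 ^ 2 * h0)).
    - apply Rmult_le_compat_l; [lra|]. unfold w, Rdiv. rewrite Rmult_comm.
      apply Rmult_le_compat_r; [lra|].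
      replace (2 * / x0 ^ 2) with (/ (x0 ^ 2 / 2)) by (field; auto).
      apply Rinv_le_contravar; lra.
    - apply Rle_trans with (C' * (2 / x0 ^ 2 * (Rabs Q * x0 ^ 2 / (8 * C')))).
      + apply Rmult_le_compat_l; [lra|]. apply Rmult_le_compat_l; auto.
        left; apply Rdiv_lt_0_compat; lra.
      + right; field; split; auto; lra. }
  assert (htri : Rabs (w ^ 2 * Q) <= Rabs (/ P - / x + w ^ 2 * Q) + Rabs (/ P - / x)).
  { replace (w ^ 2 * Q) with ((/ P - / x + w ^ 2 * Q) + - (/ P - / x)) at 1 by ring.
    rewrite <- (Rabs_Ropp (/ P - / x)). apply Rabs_triang. }
  rewrite Rabs_mult, (Rabs_pos_eq (w ^ 2)) in htri by lra.
  nra.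
Qed.

End Multiplicity.

(** * Coefficients dependent modulo f *)

Lemma J_nonzero g : cts g -> (on_I t, g t <> 0) -> J g <> 0.
Proof.
  intros hg h0 e.
  assert (h : 0 < J (fun t => g 0 * g t)).
  { apply J_pos; auto with cts. intros t ht. apply cts_sign; auto; lra. }
  rewrite J_scal, e in h by auto. lra.
Qed.

Definition isolated_cycle (A B v : R -> R) : Prop :=
  sol A B v /\ v T = v 0 /\ v 0 <> 0 /\
  exists eps, 0 < eps /\ forall y, sol A B y -> y T = y 0 ->
    (on_I t, Rabs (y t - v t) < eps) ->
    on_I t, y t = v t.

(** Along x' = a(t) x^2 (x + c) its derivative is a(t).  The squares under the logarithms
    make it valid on all sides of 0 and -c. *)
Definition first_integral (c y : R) : R :=
  if Req_dec_T c 0 then - / (2 * y ^ 2)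
  else - / (c * y) - ln (y ^ 2) / (2 * c ^ 2) + ln ((y + c) ^ 2) / (2 * c ^ 2).

Lemma first_integral_derive c y : y <> 0 -> y + c <> 0 ->
  is_derive (first_integral c) y (/ (y ^ 2 * (y + c))).
Proof.
  intros hy hyc. unfold first_integral. destruct (Req_dec_T c 0) as [->|hc].
  - auto_derive; [rewrite Rmult_1_r; repeat split; nra|]. field. rewrite Rplus_0_r in hyc. auto.
  - assert (0 < y ^ 2) by (apply pow2_gt_0; auto).
    assert (0 < (y + c) ^ 2) by (apply pow2_gt_0; auto).
    auto_derive.
    + repeat split; try (simpl in *; lra). apply Rmult_integral_contrapositive; auto.
    + field. repeat split; auto.
Qed.

Lemma separable_integral c v dv :
  (on_I t, is_derive v t (dv t)) -> cts dv ->
  (on_I t, v t <> 0) -> (on_I t, v t + c <> 0) ->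
  J (fun t => dv t / (v t ^ 2 * (v t + c))) = first_integral c (v T) - first_integral c (v 0).
Proof.
  intros hv hdv h0 hc.
  assert (hcv := cts_derive v dv hv).
  assert (hne : on_I t, v t ^ 2 * (v t + c) <> 0).
  { intros t ht. apply Rmult_integral_contrapositive; split; auto. apply pow_nonzero; auto. }
  apply (J_ftc (fun t => first_integral c (v t))).
  - intros t ht. apply (is_derive_comp (first_integral c) v); auto.
    apply first_integral_derive; auto.
  - apply cts_div; auto 15 with cts.
Qed.

Lemma first_integral_injective c x y :
  0 < x * y -> 0 < (x + c) * (y + c) -> first_integral c x = first_integral c y -> x = y.
Proof.
  enough (h : forall x y, x < y -> 0 < x * y -> 0 < (x + c) * (y + c) ->
    first_integral c x <> first_integral c y).
  { intros h1 h2 e. destruct (Rtotal_order x y) as [hl|[?|hl]]; auto; exfalso.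
    - apply (h x y); auto.
    - apply (h y x); auto; lra. }
  clear x y. intros x y hxy h1 h2 e.
  assert (hne : forall z, x <= z <= y -> z <> 0 /\ z + c <> 0).
  { intros z hz. split; nra. }
  destruct (mvt (first_integral c) (fun z => / (z ^ 2 * (z + c))) x y) as [z [hz e2]]; auto.
  - intros r hr. apply first_integral_derive; apply hne; auto.
  - destruct (hne z hz) as [n1 n2].
    assert (h : / (z ^ 2 * (z + c)) <> 0).
    { apply Rinv_neq_0_compat, Rmult_integral_contrapositive; split; auto.
      apply pow_nonzero; auto. }
    assert (e3 : / (z ^ 2 * (z + c)) * (y - x) = 0) by lra.
    apply Rmult_integral in e3. destruct e3; [contradiction|lra].
Qed.

Section Dependent.

Variables A B : R -> R.
Hypothesis hA : cts A.
Hypothesis hB : cts B.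

(** The difference of 1/u and 1/v is periodic, and A u v is its logarithmic derivative. *)
Lemma two_cycles_weight u v :
  sol A B u -> sol A B v -> u T = u 0 -> v T = v 0 -> u 0 <> 0 -> v 0 <> 0 -> u 0 <> v 0 ->
  J (fun t => A t * u t * v t) = 0.
Proof.
  intros hu hv huT hvT hu0 hv0 hne.
  assert (hv' : sol A (shift B 0) v).
  { apply (sol_ext A B); auto. intros; unfold shift; ring. }
  assert (h := inverse_difference_formula A B hA hB u 0 v T hu hv' hu0 hv0 ltac:(lra)).
  rewrite huT, hvT, Rmult_0_l, Rminus_0_r in h.
  assert (hd : / v 0 - / u 0 <> 0).
  { intros e. apply hne. rewrite <- (Rinv_inv (u 0)), <- (Rinv_inv (v 0)).
    f_equal. lra. }
  apply exp_inv. rewrite exp_0. unfold J. set (a := prim _ T) in *.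
  assert (h1 : exp (- a) = 1) by (apply Rmult_eq_reg_l with (/ v 0 - / u 0); lra).
  rewrite <- (Rinv_inv (exp a)), <- exp_Ropp, h1. apply Rinv_1.
Qed.

Lemma weight_nonzero a u v :
  a <> 0 -> (on_I t, A t = a * f t) -> sol A B u -> sol A B v ->
  u 0 <> 0 -> v 0 <> 0 -> J (fun t => A t * u t * v t) <> 0.
Proof.
  intros ha eA hu hv hu0 hv0.
  assert (hcu : cts u) by eauto with cts. assert (hcv : cts v) by eauto with cts.
  apply J_nonzero; auto with cts. intros t ht.
  apply Rmult_integral_contrapositive; split.
  - apply Rmult_integral_contrapositive; split.
    + rewrite eA by auto. apply Rmult_integral_contrapositive; split; auto.
      generalize (hfpos t ht); lra.
    + apply (sol_nonzero A B); auto.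
  - apply (sol_nonzero A B); auto.
Qed.

(** The exceptional initial value bad leaves room for the constant solution of the
    separable case. *)
Lemma not_isolated u bad :
  isolated_cycle A B u ->
  (exists d, 0 < d /\ forall v, sol A B v -> v 0 <> u 0 -> v 0 <> bad ->
    Rabs (v 0 - u 0) < d -> v T = v 0) -> False.
Proof.
  intros (hu & huT & hu0 & eps & heps & hiso) (d & hd & hcl).
  destruct (sol_near A B u hA hB hu) as (r & C & hr & hC & hnear).
  assert (hpt : exists h, 0 < h /\ h <= r /\ h < d /\ C * h < eps /\ u 0 + h <> bad).
  { assert (he : 0 < eps / (2 * C)) by (apply Rdiv_lt_0_compat; lra).
    set (h := Rmin r (Rmin (d / 2) (eps / (2 * C)))).
    assert (hh : 0 < h /\ h <= r /\ h <= d / 2 /\ h <= eps / (2 * C)).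
    { unfold h, Rmin; repeat destruct Rle_dec; lra. }
    assert (hCh : C * h <= eps / 2).
    { apply Rle_trans with (C * (eps / (2 * C))); [apply Rmult_le_compat_l; lra|].
      right; field; lra. }
    clearbody h.
    destruct (Req_dec (u 0 + h) bad) as [e|n].
    - exists (h / 2). repeat split; lra.
    - exists h. repeat split; lra. }
  destruct hpt as (h & h1 & h2 & h3 & h4 & h5).
  destruct (hnear (u 0 + h)) as (v & hv & hv0 & hb).
  { replace (u 0 + h - u 0) with h by ring. rewrite Rabs_pos_eq; lra. }
  replace (u 0 + h - u 0) with h in hb by ring. rewrite (Rabs_pos_eq h) in hb by lra.
  assert (e : v 0 = u 0); [|lra].
  apply (hiso v); auto; try lra.
  - apply hcl; auto; rewrite hv0; [lra|auto|].
    replace (u 0 + h - u 0) with h by ring. rewrite Rabs_pos_eq; lra.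
  - intros t ht. destruct (hb t ht). lra.
Qed.

(** If A vanishes, 1/x is a primitive of -B: either no nonzero solution is closed,
    or all are. *)
Lemma no_isolated_cycle_without_cubic u :
  (on_I t, A t = 0) -> ~ isolated_cycle A B u.
Proof.
  intros eA hu. apply (not_isolated u 0 hu).
  assert (hinv : forall v, sol A B v -> v 0 <> 0 -> J B = / v 0 - / v T).
  { intros v hv h0. rewrite <- (sol_inverse A B v T) by (auto; lra).
    apply J_ext. intros r hr. rewrite eA by auto. ring. }
  destruct hu as (hu & huT & hu0 & _).
  exists 1. split; [lra|]. intros v hv _ hv0 _.
  assert (h1 := hinv u hu hu0). assert (h2 := hinv v hv hv0).
  rewrite huT in h1. rewrite <- (Rinv_inv (v T)), <- (Rinv_inv (v 0)). f_equal. lra.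
Qed.

(** With B = c A + b f the equation reads x' = x^2 (A (x + c) + b f), which is linear in
    x + c when x^2 is treated as a coefficient. *)
Lemma shifted_solution c b u t :
  (on_I t, B t = c * A t + b * f t) -> sol A B u -> 0 <= t <= T ->
  (u t + c) * exp (- prim (fun s => A s * u s ^ 2) t) =
  (u 0 + c) + b * prim (fun s => f s * u s ^ 2 * exp (- prim (fun s => A s * u s ^ 2) s)) t.
Proof.
  intros eB hu ht. assert (hcu : cts u) by eauto with cts.
  set (a := prim (fun s => A s * u s ^ 2)).
  assert (hca : cts a) by (unfold a; auto 15 with cts).
  assert (h := linear_solution (fun s => u s + c) (fun s => A s * u s ^ 2)
    (fun s => b * (f s * u s ^ 2))).
  cbv beta in h. fold a in h. rewrite h; auto 15 with cts.
  - rewrite (prim_ext _ (fun s => b * (f s * u s ^ 2 * exp (- a s)))) by (intros; ring).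
    rewrite prim_scal by auto 15 with cts. ring.
  - intros s hs. eapply is_derive_eq.
    + apply @is_derive_plus; [apply hu; auto|apply @is_derive_const].
    + unfold plus, zero; simpl. rewrite eB by auto. ring.
Qed.

Section Affine.

Variables c b : R.
Hypothesis eB : on_I t, B t = c * A t + b * f t.

Lemma crossing_weight_pos u t1 t2 : sol A B u -> u 0 <> 0 -> 0 <= t1 -> t1 < t2 -> t2 <= T ->
  prim (fun s => f s * u s ^ 2 * exp (- prim (fun s => A s * u s ^ 2) s)) t1 <
  prim (fun s => f s * u s ^ 2 * exp (- prim (fun s => A s * u s ^ 2) s)) t2.
Proof.
  intros hu hu0 h0 h1 h2. assert (hcu : cts u) by eauto with cts.
  assert (hca : cts (prim (fun s => A s * u s ^ 2))) by auto 15 with cts.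
  apply RInt_clip_pos; auto 15 with cts. intros r hr.
  apply Rmult_lt_0_compat; [apply Rmult_lt_0_compat|apply exp_pos].
  - apply hfpos; lra.
  - apply pow2_gt_0, (sol_nonzero A B); auto; lra.
Qed.

Lemma affine_not_singular u : b <> 0 -> sol A B u -> u T = u 0 -> u 0 <> 0 ->
  log_multiplier A u <> 0.
Proof.
  intros hb hu huT hu0 e. assert (h := shifted_solution c b u T eB hu ltac:(lra)).
  unfold log_multiplier, J in e. rewrite e, huT, Ropp_0, exp_0 in h.
  assert (hp := crossing_weight_pos u 0 T hu hu0 ltac:(lra) hT ltac:(lra)).
  rewrite prim_0 in hp. clear e. set (w := prim _ T) in *.
  assert (h2 : b * w = 0) by lra. apply Rmult_integral in h2. destruct h2; [contradiction|lra].
Qed.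

(** By the preceding formula the line x = -c is crossed in one direction only, which a
    closed solution cannot do. *)
Lemma affine_no_crossing u : b <> 0 -> sol A B u -> u T = u 0 -> u 0 <> 0 ->
  on_I t, u t + c <> 0.
Proof.
  intros hb hu huT hu0 t ht e.
  assert (h1 := shifted_solution c b u t eB hu ht).
  assert (h2 := shifted_solution c b u T eB hu ltac:(lra)).
  rewrite e, Rmult_0_l in h1. rewrite huT in h2.
  assert (hE := exp_pos (- prim (fun s => A s * u s ^ 2) T)).
  set (E := exp (- prim (fun s => A s * u s ^ 2) T)) in *.
  set (w := prim (fun s => f s * u s ^ 2 * exp (- prim (fun s => A s * u s ^ 2) s))) in *.
  assert (p0 : w 0 = 0) by (unfold w; apply prim_0).
  assert (p1 : 0 <= w t).
  { destruct (Req_dec t 0) as [->|]; [lra|].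
    assert (w 0 < w t); [apply crossing_weight_pos; auto; lra|lra]. }
  assert (p2 : w t <= w T).
  { destruct (Req_dec t T) as [->|]; [lra|].
    left; apply crossing_weight_pos; auto; lra. }
  assert (p3 : 0 < w T).
  { assert (w 0 < w T); [apply crossing_weight_pos; auto; lra|lra]. }
  assert (hw0 : u 0 + c = - (b * w t)) by lra.
  assert (h3 : (u 0 + c) * E * (u 0 + c) = - (b ^ 2 * (w t * (w T - w t)))).
  { rewrite h2, hw0. ring. }
  assert (h4 : 0 <= b ^ 2 * (w t * (w T - w t))).
  { apply Rmult_le_pos; [apply pow2_ge_0|apply Rmult_le_pos; lra]. }
  assert (h5 : u 0 + c = 0).
  { destruct (Req_dec (u 0 + c) 0); auto.
    assert (0 < (u 0 + c) ^ 2) by (apply pow2_gt_0; auto). nra. }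
  assert (h6 : b * w t = 0) by lra. apply Rmult_integral in h6.
  destruct h6 as [|h6]; [contradiction|].
  rewrite h5 in h2. assert (h7 : b * w T = 0) by lra.
  apply Rmult_integral in h7. destruct h7; [contradiction|lra].
Qed.

(** Separating variables shows that f / (u + c) has the same mean for all closed solutions,
    but for two distinct ones these functions never agree. *)
Lemma affine_unique_cycle u v : b <> 0 ->
  sol A B u -> sol A B v -> u T = u 0 -> v T = v 0 -> u 0 <> 0 -> v 0 <> 0 -> u 0 = v 0.
Proof.
  intros hb.
  assert (hint : forall x, sol A B x -> x T = x 0 -> x 0 <> 0 ->
    J A + b * J (fun t => f t * / (x t + c)) = 0 /\ cts (fun t => f t * / (x t + c))).
  { intros x hx hxT hx0. assert (hcx : cts x) by eauto with cts.
    assert (hxn := sol_nonzero A B x hA hB hx hx0).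
    assert (hwn := affine_no_crossing x hb hx hxT hx0).
    assert (hcw : cts (fun t => f t * / (x t + c))).
    { apply cts_mult; auto. apply cts_inv; auto with cts. }
    split; auto. rewrite <- J_scal, <- J_plus by auto with cts.
    assert (h := separable_integral c x _ hx). rewrite hxT, Rminus_diag in h.
    rewrite <- h; auto with cts.
    apply J_ext. intros t ht. rewrite eB by auto. field. auto. }
  intros hu hv huT hvT hu0 hv0.
  destruct (hint u hu huT hu0) as [iu cu]. destruct (hint v hv hvT hv0) as [iv cv].
  destruct (Req_dec (u 0) (v 0)) as [|hne]; auto. exfalso.
  assert (hd : J (fun t => f t * / (u t + c) - f t * / (v t + c)) = 0).
  { rewrite J_minus by auto.
    assert (h : b * (J (fun t => f t * / (u t + c)) - J (fun t => f t * / (v t + c))) = 0) by lra.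
    apply Rmult_integral in h. destruct h; [contradiction|auto]. }
  apply J_nonzero in hd; auto with cts. intros t ht e.
  assert (hwu := affine_no_crossing u hb hu huT hu0 t ht).
  assert (hwv := affine_no_crossing v hb hv hvT hv0 t ht).
  assert (hft := hfpos t ht).
  apply hne. apply (sol_unique A B u v t); auto; [|lra].
  assert (e2 : / (u t + c) = / (v t + c)) by (apply Rmult_eq_reg_l with (f t); lra).
  assert (u t + c = v t + c); [|lra].
  rewrite <- (Rinv_inv (u t + c)), e2, Rinv_inv. reflexivity.
Qed.

(** For b = 0 the variables separate: unless A has mean 0, in which case all
    solutions are closed, only the constant -c is closed. *)
Lemma separable_isolated_cycle u : b = 0 -> isolated_cycle A B u ->
  J A <> 0 /\ on_I t, u t = - c.
Proof.
  intros hb hiso. destruct (hiso) as (hu & huT & hu0 & _).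
  assert (hconst : sol A B (fun _ => - c)).
  { intros t ht. eapply is_derive_eq; [apply @is_derive_const|].
    rewrite eB, hb by auto. unfold zero; simpl; ring. }
  assert (hw : forall v, sol A B v -> v 0 <> - c -> on_I t, v t + c <> 0).
  { intros v hv hne t ht e. apply hne.
    apply (sol_unique A B v (fun _ => - c) t); auto; lra. }
  assert (hint : forall v, sol A B v -> v 0 <> 0 -> v 0 <> - c ->
    J A = first_integral c (v T) - first_integral c (v 0)).
  { intros v hv h0 hne. assert (hcv : cts v) by eauto with cts.
    assert (hvn := sol_nonzero A B v hA hB hv h0).
    rewrite <- (separable_integral c v _ hv); auto with cts.
    apply J_ext. intros t ht. rewrite eB, hb by auto. field. split; auto. }
  assert (hJ : J A <> 0).
  { intros e. apply (not_isolated u (- c) hiso).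
    exists (Rabs (u 0)). split; [apply Rabs_pos_lt; auto|].
    intros v hv _ hne hd.
    assert (hv0 : v 0 <> 0).
    { intros e0. rewrite e0, Rminus_0_l, Rabs_Ropp in hd. lra. }
    assert (hcv : cts v) by eauto with cts.
    apply (first_integral_injective c).
    - rewrite Rmult_comm. apply cts_sign; auto; [|lra]. apply (sol_nonzero A B); auto.
    - rewrite Rmult_comm. apply (cts_sign (fun t => v t + c)); auto with cts; lra.
    - assert (h := hint v hv hv0 hne). lra. }
  split; auto.
  destruct (Req_dec (u 0) (- c)) as [e|hne].
  - apply (sol_unique A B u (fun _ => - c) 0); auto; lra.
  - exfalso. apply hJ. rewrite (hint u hu hu0 hne), huT. ring.
Qed.

End Affine.

End Dependent.

(** * Counting limit cycles *)

Lemma sol_shift_0 A B v : sol A B v -> sol A (shift B 0) v.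
Proof. apply sol_ext; auto. intros; unfold shift; ring. Qed.

Lemma limit_cycle_isolated A B A' B' x0 k :
  cts A -> cts B ->
  (on_I t, A t = A' t) -> (on_I t, B t = B' t) ->
  nonzero_limit_cycle_mult_ge T A' B' x0 k ->
  exists v, isolated_cycle A B v /\ v 0 = x0 /\
    zero_mult_ge (poincare_dom T A' B') (fun y => poincare T A' B' y - y) (v 0) k.
Proof.
  intros hA hB eA eB [(x & ((hx & hxT) & eps & heps & hiso) & (t0 & ht0 & hne) & hx0) hm].
  destruct (solution_sol A B A' B' x hA hB eA eB hx) as [v [hv e]].
  exists v. rewrite (e 0) by lra. rewrite hx0. split; [|split; auto].
  split; [auto|split; [rewrite !e by lra; auto|split]].
  - intros h0. apply hne. rewrite <- e by exact ht0.
    rewrite (sol_exp A B v hA hB hv t0 ht0), h0. ring.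
  - exists eps. split; auto. intros y hy hyT hclose t ht. rewrite e by auto.
    apply hiso; auto.
    + split; auto. apply (sol_solution A B); auto.
    + intros r hr. rewrite <- e by exact hr. auto.
Qed.

Lemma multiplicity_cases (P : R -> nat -> Prop) (l : list (R * nat)) :
  NoDup (map fst l) -> (forall t k, In (t, k) l -> P t k) -> (3 <= list_sum (map snd l))%nat ->
  (exists x k, P x k /\ (3 <= k)%nat) \/
  (exists x y j k, P x j /\ P y k /\ x <> y /\ (2 <= j)%nat) \/
  (exists x y z i j k, P x i /\ P y j /\ P z k /\ x <> y /\ x <> z /\ y <> z).
Proof.
  assert (hpos : forall l : list (R * nat), (1 <= list_sum (map snd l))%nat ->
    exists y k, In (y, k) l).
  { intros [|[y k] l']; simpl; [lia|]. intros _; exists y, k; auto. }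
  assert (hne : forall x (l : list (R * nat)) y k,
    ~ In x (map fst l) -> In (y, k) l -> x <> y).
  { intros x l' y k hx hin ->. apply hx. apply in_map_iff. exists (y, k); auto. }
  assert (htwo : forall l : list (R * nat), NoDup (map fst l) ->
    (2 <= list_sum (map snd l))%nat ->
    (exists y k, In (y, k) l /\ (2 <= k)%nat) \/
    (exists y z j k, In (y, j) l /\ In (z, k) l /\ y <> z)).
  { induction l0 as [|[y k] l' IH]; simpl; [lia|]. intros hnd hs.
    inversion hnd as [|? ? hnot hnd']; subst.
    destruct k as [|[|k]].
    - destruct (IH hnd' ltac:(lia)) as [(y' & k' & h1 & h2)|(y' & z & j' & k' & h1 & h2 & h3)].
      + left; exists y', k'; auto.
      + right; exists y', z, j', k'; auto.
    - destruct (hpos l' ltac:(lia)) as (z & j & hz).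
      right; exists y, z, 1%nat, j. split; auto. split; auto. eapply hne; eauto.
    - left; exists y, (S (S k)). split; auto. lia. }
  induction l as [|[x k] l IH]; simpl; [lia|]. intros hnd hP hs.
  inversion hnd as [|? ? hnot hnd']; subst.
  assert (hx : P x k) by (apply hP; auto).
  destruct k as [|[|[|k]]].
  - apply IH; auto.
  - destruct (htwo l hnd' ltac:(lia)) as [(y & j & h1 & h2)|(y & z & i & j & h1 & h2 & h3)].
    + right; left. exists y, x, j, 1%nat. repeat split; auto.
      intros e. apply (hne x l y j hnot h1). auto.
    + right; right. exists x, y, z, 1%nat, i, j. repeat split; auto; eapply hne; eauto.
  - destruct (hpos l ltac:(lia)) as (y & j & hy).
    right; left. exists x, y, 2%nat, j. repeat split; auto. eapply hne; eauto.
  - left. exists x, (S (S (S k))). split; auto. lia.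
Qed.

Section Independent.

Variables al be : nat -> R.
Hypothesis hind : independent al be.
Notation A := (comb al).
Notation B := (comb be).

Lemma closed_cycle_0 u : sol A B u -> u T = u 0 -> u 0 <> 0 -> cycle A B 0 u.
Proof.
  intros hu huT hu0. apply cycle_of_closed; auto with cts. apply sol_shift_0, hu.
Qed.

Lemma orientation : exists s, (s = 1 \/ s = -1) /\ forall l, area_sign A (shift B l) s.
Proof.
  destruct jets_exist as [G hG]. exact (area_sign_family G hG al be hind).
Qed.

Lemma no_three_ordered_cycles u1 u2 u3 :
  sol A B u1 -> u1 T = u1 0 -> u1 0 <> 0 -> sol A B u2 -> u2 T = u2 0 -> u2 0 <> 0 ->
  sol A B u3 -> u3 T = u3 0 -> u3 0 <> 0 -> u1 0 < u2 0 < u3 0 -> False.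
Proof.
  intros h1 e1 n1 h2 e2 n2 h3 e3 n3 hlt.
  destruct orientation as (s & hs & harea).
  assert (c1 := closed_cycle_0 u1 h1 e1 n1). assert (c2 := closed_cycle_0 u2 h2 e2 n2).
  assert (c3 := closed_cycle_0 u3 h3 e3 n3).
  destruct (cycles_between A B 0 u1 0 u3) as (M & hM & hex); auto with cts; [lra|].
  assert (h := parameter_no_interior_max A B (cts_comb al) (cts_comb be) s hs harea
    (u1 0) (u3 0) M ltac:(lra) hM hex 0 u1 0 u3 0 u2 c1 eq_refl c3 eq_refl c2 hlt).
  rewrite Rmult_0_r, Rmax_left in h; lra.
Qed.

Lemma no_three_cycles u1 u2 u3 :
  sol A B u1 -> u1 T = u1 0 -> u1 0 <> 0 -> sol A B u2 -> u2 T = u2 0 -> u2 0 <> 0 ->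
  sol A B u3 -> u3 T = u3 0 -> u3 0 <> 0 ->
  u1 0 <> u2 0 -> u1 0 <> u3 0 -> u2 0 <> u3 0 -> False.
Proof.
  intros h1 e1 n1 h2 e2 n2 h3 e3 n3 d12 d13 d23.
  destruct (Rdichotomy _ _ d12); destruct (Rdichotomy _ _ d13); destruct (Rdichotomy _ _ d23);
    first [ apply (no_three_ordered_cycles u1 u2 u3); auto; lra
          | apply (no_three_ordered_cycles u1 u3 u2); auto; lra
          | apply (no_three_ordered_cycles u2 u1 u3); auto; lra
          | apply (no_three_ordered_cycles u2 u3 u1); auto; lra
          | apply (no_three_ordered_cycles u3 u1 u2); auto; lra
          | apply (no_three_ordered_cycles u3 u2 u1); auto; lra ].
Qed.

(** Near a singular closed solution s times the parameter is positive; between two closed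
    solutions at the parameter 0 it is negative. *)
Lemma no_other_cycle_than_singular u v :
  sol A B u -> u T = u 0 -> u 0 <> 0 -> sol A B v -> v T = v 0 -> v 0 <> 0 ->
  u 0 <> v 0 -> log_multiplier A u <> 0.
Proof.
  intros hu huT hu0 hv hvT hv0 hne hsing.
  destruct orientation as (s & hs & harea).
  assert (cu := closed_cycle_0 u hu huT hu0). assert (cv := closed_cycle_0 v hv hvT hv0).
  assert (hbetween : exists a b M, a < b /\ 0 < M /\
    (forall x, a <= x <= b -> exists l w, cycle A B l w /\ w 0 = x /\
       on_I t, Rabs (w t) <= M) /\
    ((a = u 0 /\ b = v 0) \/ (a = v 0 /\ b = u 0))).
  { destruct (Rdichotomy _ _ hne) as [h|h].
    - destruct (cycles_between A B 0 u 0 v (cts_comb al) (cts_comb be) cu cv h) as (M & hM & hex).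
      exists (u 0), (v 0), M. split; [auto|split; [auto|split; [auto|left; auto]]].
    - destruct (cycles_between A B 0 v 0 u (cts_comb al) (cts_comb be) cv cu h) as (M & hM & hex).
      exists (v 0), (u 0), M. split; [auto|split; [auto|split; [auto|right; auto]]]. }
  destruct hbetween as (a & b & M & hab & hM & hex & hends).
  destruct (cts_bounded u (sol_cts A B u hu)) as [Mu [hMu bu]].
  destruct (parameter_near_singular A B (cts_comb al) (cts_comb be) s hs harea 0 u (Mu + M) cu
    hu0 hsing) as (d & hd & hnear).
  { intros t ht; generalize (bu t ht); lra. }
  assert (hpt : exists x, a < x < b /\ 0 < Rabs (x - u 0) < d).
  { set (r := Rmin (d / 2) ((b - a) / 2)).
    assert (hr : 0 < r /\ r < d /\ r < b - a) by (unfold r, Rmin; destruct Rle_dec; lra).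
    destruct hends as [[e1 e2]|[e1 e2]].
    - exists (u 0 + r). replace (u 0 + r - u 0) with r by ring.
      rewrite Rabs_pos_eq; lra.
    - exists (u 0 - r). replace (u 0 - r - u 0) with (- r) by ring.
      rewrite Rabs_Ropp, Rabs_pos_eq; lra. }
  destruct hpt as (x & hx & hxd).
  destruct (hex x ltac:(lra)) as (l & w & hw & hw0 & bw).
  assert (h1 : 0 < s * (l - 0)).
  { apply (hnear l w hw); [|rewrite hw0; auto]. intros t ht; generalize (bw t ht); lra. }
  assert (h2 : s * l < Rmax (s * 0) (s * 0)).
  { destruct hends as [[e1 e2]|[e1 e2]].
    - apply (parameter_no_interior_max A B (cts_comb al) (cts_comb be) s hs harea a b M hab hM
        hex 0 u 0 v l w); auto. lra.
    - apply (parameter_no_interior_max A B (cts_comb al) (cts_comb be) s hs harea a b M hab hM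
        hex 0 v 0 u l w); auto. lra. }
  rewrite Rmult_0_r, Rmax_left in h2; lra.
Qed.

Lemma singular_coefficient_nonzero u :
  sol A B u -> u T = u 0 -> u 0 <> 0 -> log_multiplier A u = 0 ->
  curvature A u <> 0.
Proof.
  intros hu huT hu0 hsing e.
  destruct orientation as (s & hs & harea).
  assert (hcB : cts (shift B 0)) by auto with cts.
  assert (h := singular_coefficient_sign A (shift B 0) u s (cts_comb al) hcB (harea 0)
    (sol_shift_0 A B u hu) huT hu0 hsing).
  rewrite e in h. lra.
Qed.

End Independent.

(** Either A is a multiple of f or B - c A is a multiple of f for some c.  If the multiple is
    nonzero, it is a function of one sign in the span of A and B, which excludes a second
    and a singular closed solution; otherwise variables separate. *)
Lemma dependent_cycles al be :
  ~ independent al be ->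
  (forall u v, isolated_cycle (comb al) (comb be) u -> isolated_cycle (comb al) (comb be) v ->
     u 0 = v 0) /\
  (forall u, isolated_cycle (comb al) (comb be) u ->
     log_multiplier (comb al) u <> 0).
Proof.
  intros hdep. unfold independent in hdep. apply NNPP in hdep.
  assert (hA := cts_comb al). assert (hB := cts_comb be).
  destruct (classic (al 1%nat = 0 /\ al 2%nat = 0)) as [[z1 z2]|hnz].
  - assert (eA : on_I t, comb al t = al 0%nat * f t).
    { intros t _. rewrite comb_eq, hF0, z1, z2. ring. }
    destruct (Req_dec (al 0%nat) 0) as [z0|n0].
    + assert (hno := no_isolated_cycle_without_cubic (comb al) (comb be) hA hB).
      assert (eA0 : on_I t, comb al t = 0).
      { intros t ht. rewrite eA, z0 by auto. ring. }
      split; intros; exfalso; eapply hno; eauto.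
    + split.
      * intros u v (hu & huT & hu0 & _) (hv & hvT & hv0 & _).
        destruct (Req_dec (u 0) (v 0)) as [|hne]; auto. exfalso.
        apply (weight_nonzero (comb al) (comb be) hA hB (al 0%nat) u v n0 eA hu hv hu0 hv0).
        apply (two_cycles_weight (comb al) (comb be) hA hB); auto.
      * intros u (hu & huT & hu0 & _) e.
        apply (weight_nonzero (comb al) (comb be) hA hB (al 0%nat) u u n0 eA hu hu hu0 hu0).
        rewrite <- e. apply J_ext. intros; ring.
  - assert (hc : exists c b, on_I t,
      comb be t = c * comb al t + b * f t).
    { destruct (Req_dec (al 1%nat) 0) as [z1|n1].
      - assert (n2 : al 2%nat <> 0) by (intros e; apply hnz; auto).
        rewrite z1 in hdep.
        assert (h1 : be 1%nat = 0).
        { assert (h : al 2%nat * be 1%nat = 0) by lra.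
          apply Rmult_integral in h. destruct h; [contradiction|auto]. }
        exists (be 2%nat / al 2%nat), (be 0%nat - be 2%nat / al 2%nat * al 0%nat).
        intros t _. rewrite !comb_eq, hF0, z1, h1. field; auto.
      - exists (be 1%nat / al 1%nat), (be 0%nat - be 1%nat / al 1%nat * al 0%nat).
        intros t _. rewrite !comb_eq, hF0.
        assert (h2 : be 2%nat = be 1%nat / al 1%nat * al 2%nat).
        { apply Rmult_eq_reg_l with (al 1%nat); auto.
          replace (al 1%nat * (be 1%nat / al 1%nat * al 2%nat)) with (al 2%nat * be 1%nat)
            by (field; auto). lra. }
        rewrite h2. field; auto. }
    destruct hc as (c & b & eB). destruct (Req_dec b 0) as [hb|hb].
    + assert (hsep := fun u => separable_isolated_cycle (comb al) (comb be) hA hB c b eB u hb).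
      split.
      * intros u v hu hv. destruct (hsep u hu) as [_ eu]. destruct (hsep v hv) as [_ ev].
        rewrite eu, ev; lra.
      * intros u hu. destruct (hsep u hu) as [hJ eu]. intros e. apply hJ.
        destruct hu as (_ & _ & hu0 & _).
        assert (h : log_multiplier (comb al) u = c ^ 2 * J (comb al)).
        { rewrite <- J_scal by auto. apply J_ext. intros t ht. rewrite eu by auto. ring. }
        rewrite e in h. symmetry in h. apply Rmult_integral in h. destruct h as [h|]; auto.
        exfalso. apply hu0. rewrite eu by lra.
        assert (c = 0); [|lra]. apply Rmult_integral in h. destruct h; lra.
    + split.
      * intros u v (hu & huT & hu0 & _) (hv & hvT & hv0 & _).
        apply (affine_unique_cycle (comb al) (comb be) hA hB c b eB); auto.
      * intros u (hu & huT & hu0 & _).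
        apply (affine_not_singular (comb al) (comb be) hA hB c b eB); auto.
Qed.

Lemma at_most_two A' B' :
  in_span (Icc 0 T) 2 F A' -> in_span (Icc 0 T) 2 F B' ->
  at_most_nonzero_limit_cycles T A' B' 2.
Proof.
  intros [al eA'] [be eB'] (l & hnd & hl & hsum).
  assert (eA : on_I t, comb al t = A' t) by (intros; symmetry; apply eA'; auto).
  assert (eB : on_I t, comb be t = B' t) by (intros; symmetry; apply eB'; auto).
  assert (hA := cts_comb al). assert (hB := cts_comb be).
  assert (hiso := fun x k => limit_cycle_isolated (comb al) (comb be) A' B' x k hA hB eA eB).
  assert (hdouble : forall v k, isolated_cycle (comb al) (comb be) v ->
    zero_mult_ge (poincare_dom T A' B') (fun y => poincare T A' B' y - y) (v 0) k ->
    (2 <= k)%nat -> log_multiplier (comb al) v = 0).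
  { intros v k (hv & hvT & hv0 & _) hm hk.
    apply (singular_of_double_zero (comb al) (comb be) A' B' hA hB eA eB v k); auto. }
  destruct (classic (independent al be)) as [hind|hdep].
  - destruct (multiplicity_cases _ l hnd hl hsum) as
      [(x & k & hx & hk)|[(x & y & j & k & hx & hy & hxy & hj)|
       (x & y & z & i & j & k & hx & hy & hz & hxy & hxz & hyz)]].
    + destruct (hiso x k hx) as (v & hv & h0 & hm).
      assert (hs := hdouble v k hv hm ltac:(lia)).
      destruct hv as (hv & hvT & hv0 & _).
      apply (singular_coefficient_nonzero al be hind v hv hvT hv0 hs).
      apply (coefficient_zero_of_triple_zero (comb al) (comb be) A' B' hA hB eA eB v k); auto.
    + destruct (hiso x j hx) as (v & hv & h0 & hm). destruct (hiso y k hy) as (w & hw & h1 & _).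
      assert (hs := hdouble v j hv hm hj).
      destruct hv as (hv & hvT & hv0 & _). destruct hw as (hw & hwT & hw0 & _).
      apply (no_other_cycle_than_singular al be hind v w); auto. lra.
    + destruct (hiso x i hx) as (u & (hu & huT & hu0 & _) & e1 & _).
      destruct (hiso y j hy) as (v & (hv & hvT & hv0 & _) & e2 & _).
      destruct (hiso z k hz) as (w & (hw & hwT & hw0 & _) & e3 & _).
      apply (no_three_cycles al be hind u v w); auto; lra.
  - destruct (dependent_cycles al be hdep) as [huniq hsimple].
    destruct (multiplicity_cases _ l hnd hl hsum) as
      [(x & k & hx & hk)|[(x & y & j & k & hx & hy & hxy & hj)|
       (x & y & z & i & j & k & hx & hy & _ & hxy & _)]].
    + destruct (hiso x k hx) as (v & hv & h0 & hm).
      apply (hsimple v hv), (hdouble v k); auto. lia.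
    + destruct (hiso x j hx) as (v & hv & h0 & _). destruct (hiso y k hy) as (w & hw & h1 & _).
      apply hxy. rewrite <- h0, <- h1. auto.
    + destruct (hiso x i hx) as (v & hv & h0 & _). destruct (hiso y j hy) as (w & hw & h1 & _).
      apply hxy. rewrite <- h0, <- h1. auto.
Qed.

(** * Two limit cycles bifurcating from the zero solution *)

(** As there are no three closed solutions besides 0, two of them are isolated. *)
Lemma limit_cycle_of_two al be u v :
  independent al be -> sol (comb al) (comb be) u -> u T = u 0 -> u 0 <> 0 ->
  sol (comb al) (comb be) v -> v T = v 0 -> v 0 <> 0 -> u 0 <> v 0 ->
  nonzero_limit_cycle_mult_ge T (comb al) (comb be) (u 0) 1.
Proof.
  intros hind hu huT hu0 hv hvT hv0 hne.
  assert (hA := cts_comb al). assert (hB := cts_comb be).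
  assert (hsu : solution T (comb al) (comb be) u) by (apply (sol_solution (comb al) (comb be)); auto).
  split.
  - exists u. split; [split; [split; auto|]|split; [|auto]].
    + set (eps := Rmin (Rabs (u 0)) (Rabs (u 0 - v 0))).
      exists eps. split.
      { apply Rmin_pos; apply Rabs_pos_lt; lra. }
      intros y [hy hyT] hclose.
      destruct (solution_sol (comb al) (comb be) (comb al) (comb be) y) as (w & hw & e); auto.
      intros t ht. rewrite <- e by auto.
      apply (sol_unique (comb al) (comb be) w u 0); auto; [lra|].
      destruct (Req_dec (w 0) (u 0)) as [|hwu]; auto. exfalso.
      assert (h0 := hclose 0 ltac:(unfold Icc; lra)). rewrite <- e in h0 by lra.
      assert (h1 := Rmin_l (Rabs (u 0)) (Rabs (u 0 - v 0))).
      assert (h2 := Rmin_r (Rabs (u 0)) (Rabs (u 0 - v 0))). fold eps in h1, h2.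
      apply (no_three_cycles al be hind u v w); auto.
      * rewrite !e by lra. auto.
      * intros e0. rewrite e0, Rminus_0_l, Rabs_Ropp in h0. lra.
      * intros e0. rewrite <- e0, Rabs_minus_sym in h0. lra.
    + exists 0. split; [unfold Icc; lra|auto].
  - split; [exists u; auto|].
    exists (fun _ y => poincare T (comb al) (comb be) y - y). split; [split|].
    + auto.
    + simpl; intros; lia.
    + intros j hj. rewrite (poincare_eq (comb al) (comb be)) by auto. lra.
Qed.

(** When A and B have mean 0, the parameter has a strict extremum at the initial value 0, so
    that its values on one side of 0 are attained once on either side of it. *)
Lemma two_cycles_exist : exists al be u v,
  independent al be /\
  sol (comb al) (comb be) u /\ u T = u 0 /\ u 0 < 0 /\
  sol (comb al) (comb be) v /\ v T = v 0 /\ 0 < v 0.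
Proof.
  assert (hJf := J_f_pos).
  set (mean := fun i => J (F i) / J f).
  set (al := fun i => match i with O => - mean 1%nat | 1%nat => 1 | _ => 0 end : R).
  set (be := fun i => match i with O => - mean 2%nat | 2%nat => 1 | _ => 0 end : R).
  assert (hind : independent al be) by (unfold independent; simpl; lra).
  assert (hA := cts_comb al). assert (hB := cts_comb be).
  assert (hF1 := hFc 1%nat ltac:(lia)). assert (hF2 := hFc 2%nat ltac:(lia)).
  assert (hJA : J (comb al) = 0).
  { rewrite (J_ext _ (fun t => F 1%nat t - mean 1%nat * f t)).
    - rewrite J_minus, J_scal by auto with cts. unfold mean. field; lra.
    - intros t _. rewrite comb_eq, hF0. unfold al. ring. }
  assert (hJB : J (comb be) = 0).
  { rewrite (J_ext _ (fun t => F 2%nat t - mean 2%nat * f t)).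
    - rewrite J_minus, J_scal by auto with cts. unfold mean. field; lra.
    - intros t _. rewrite comb_eq, hF0. unfold be. ring. }
  destruct (orientation al be hind) as (s & hs & harea).
  assert (hJB0 : J (shift (comb be) 0) = 0) by (rewrite J_shift, hJB by auto; ring).
  destruct (closed_small_pos (comb al) (comb be) hA hB hJB) as (d1 & hd1 & hex1).
  destruct (closed_small_pos (comb al) (fun t => - comb be t) hA) as (d2 & hd2 & hex2);
    auto with cts.
  { rewrite (J_ext _ (fun t => -1 * comb be t)) by (intros; ring).
    rewrite J_scal, hJB by auto. ring. }
  destruct (parameter_near_center (comb al) (comb be) hA hB s hs harea 0 1 hJA hJB0 ltac:(lra))
    as (d3 & hd3 & hcenter).
  set (d := Rmin d1 (Rmin d2 (d3 / 2))).
  assert (hd : 0 < d /\ d <= d1 /\ d <= d2 /\ d < d3).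
  { unfold d, Rmin; repeat destruct Rle_dec; lra. }
  clearbody d.
  assert (hex : forall x, - d <= x <= d -> exists l v, cycle (comb al) (comb be) l v /\
    v 0 = x /\ on_I t, Rabs (v t) <= 1).
  { intros x hx. destruct (Rtotal_order x 0) as [hn|[->|hp]].
    - destruct (hex2 (- x) ltac:(lra)) as (l & v & hv & h0 & hT' & bv).
      exists (- l), (fun t => - v t). split; [|split; [lra|]].
      + apply cycle_of_closed; auto; [|lra|lra]. apply sol_shift_opp, hv.
      + intros t ht. rewrite Rabs_Ropp. auto.
    - exists 0, (fun _ => 0). split; [apply cycle_zero; auto|split; [auto|]].
      intros; rewrite Rabs_R0; lra.
    - destruct (hex1 x ltac:(lra)) as (l & v & hv & h0 & hT' & bv).
      exists l, v. split; [|split; auto]. apply cycle_of_closed; auto; lra. }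
  destruct (parameter_function (comb al) (comb be) hA hB (- d) d 1 ltac:(lra) ltac:(lra) hex)
    as (L & hLc & hL & hLeq).
  assert (hL0 : L 0 = 0).
  { apply (hLeq 0 (fun _ => 0)); [apply cycle_zero; auto|lra]. }
  assert (hLpos : forall x, - d <= x <= d -> x <> 0 -> 0 < s * L x).
  { intros x hx hx0. destruct (hL x hx) as (v & hv & h0 & bv).
    assert (h := hcenter (L x) v hv bv). rewrite h0, Rminus_0_r in h. apply h.
    split; [apply Rabs_pos_lt; auto|]. apply Rle_lt_trans with d; [apply Rabs_le|]; lra. }
  set (m := Rmin (s * L d) (s * L (- d)) / 2).
  assert (hm : 0 < m /\ m < s * L d /\ m < s * L (- d)).
  { assert (h1 := hLpos d ltac:(lra) ltac:(lra)).
    assert (h2 := hLpos (- d) ltac:(lra) ltac:(lra)).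
    unfold m, Rmin; destruct Rle_dec; lra. }
  assert (hcont : continuity (fun x => s * L x - m)).
  { intros x. apply continuity_pt_minus; [apply (continuity_pt_scal L s x), hLc|].
    apply continuity_pt_const. intros y z; reflexivity. }
  destruct (IVT_cor _ 0 d hcont ltac:(lra)) as [zp [hzp ep]].
  { rewrite hL0. nra. }
  destruct (IVT_cor _ (- d) 0 hcont ltac:(lra)) as [zn [hzn en]].
  { rewrite hL0. nra. }
  assert (hp0 : zp <> 0) by (intros e; rewrite e, hL0 in ep; lra).
  assert (hn0 : zn <> 0) by (intros e; rewrite e, hL0 in en; lra).
  destruct (hL zp ltac:(lra)) as (v & (hv & hvT & _) & hv0 & _).
  destruct (hL zn ltac:(lra)) as (u & (hu & huT & _) & hu0 & _).
  assert (eL : L zn = L zp) by (destruct hs as [e|e]; rewrite e in *; lra).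
  rewrite eL in hu.
  set (e0 := fun i => match i with O => 1 | _ => 0 end : R).
  set (be' := lin2 1 (L zp) be e0).
  assert (ebe : forall t, shift (comb be) (L zp) t = comb be' t).
  { intros t. unfold be'. rewrite comb_lin2, (comb_eq e0), hF0. unfold shift, e0. ring. }
  exists al, be', u, v.
  split; [|split; [|split; [auto|split; [lra|split; [|split; [auto|lra]]]]]].
  - unfold independent, be', lin2; simpl. lra.
  - apply (sol_ext (comb al) (shift (comb be) (L zp))); auto.
  - apply (sol_ext (comb al) (shift (comb be) (L zp))); auto.
Qed.

Lemma exactly_two_attained : exists A' B',
  in_span (Icc 0 T) 2 F A' /\ in_span (Icc 0 T) 2 F B' /\
  exactly_nonzero_limit_cycles T A' B' 2.
Proof.
  destruct two_cycles_exist as (al & be & u & v & hind & hu & huT & hu0 & hv & hvT & hv0).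
  assert (hsA : in_span (Icc 0 T) 2 F (comb al)) by (exists al; reflexivity).
  assert (hsB : in_span (Icc 0 T) 2 F (comb be)) by (exists be; reflexivity).
  exists (comb al), (comb be). split; [auto|split; [auto|split; [|apply at_most_two; auto]]].
  exists ((u 0, 1%nat) :: (v 0, 1%nat) :: nil). split; [|split].
  - repeat constructor; simpl; [intros [e|[]]; lra|intros []].
  - intros t k [e|[e|[]]]; injection e as <- <-.
    + apply (limit_cycle_of_two al be u v); auto; lra.
    + apply (limit_cycle_of_two al be v u); auto; lra.
  - simpl; lia.
Qed.

End Interval.

Theorem theorem1 (T : R) (hT : 0 < T) (f : nat -> R -> R)
    (hET : ET_system (Ico 0 T) 2 f)
    (hcont : forall i, (i <= 2)%nat -> continuous_in (Icc 0 T) (f i))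
    (hpos : forall t, Icc 0 T t -> 0 < f 0%nat t) :
  (forall A B : R -> R,
     in_span (Icc 0 T) 2 f A -> in_span (Icc 0 T) 2 f B ->
     at_most_nonzero_limit_cycles T A B 2) /\
  (exists A B : R -> R,
     in_span (Icc 0 T) 2 f A /\ in_span (Icc 0 T) 2 f B /\
     exactly_nonzero_limit_cycles T A B 2).
Proof.
  assert (hc : forall i, (i <= 2)%nat -> cts T (f i)).
  { intros i hi. apply continuous_in_cts; auto. }
  assert (hc0 := hc 0%nat ltac:(lia)).
  split.
  - intros A B hA hB. apply (at_most_two T hT (f 0%nat) hc0 hpos f); auto.
  - apply (exactly_two_attained T hT (f 0%nat) hc0 hpos f); auto.
Qed.
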